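(* Let $\alpha\in\mathbb R$, let $\kappa\in\mathbb N_0\cup\{\infty\}$, let $(s_j)_{j=0}^{\kappa}$ be a sequence of complex $q\times q$ matrices, let $\mathcal D$ be a discrete subset of the open upper half-plane $\Pi_+$, and let $S:\mathbb C\setminus[\alpha,\infty)\to\mathbb C^{q\times q}$ be holomorphic. Then: (a) If $n\in\mathbb N_0$ satisfies $2n\le\kappa$, then $S\in\mathcal S_{0,q,[\alpha,\infty)}[(s_j)_{j=0}^{2n},\le]$ if and only if $P^{[S]}_{2n-1}(z)$ and $P^{[S]}_{2n}(z)$ are both positive semidefinite for all $z\in\Pi_+\setminus\mathcal D$. (b) If $n\in\mathbb N_0$ satisfies $2n+1\le\kappa$, then $S\in\mathcal S_{0,q,[\alpha,\infty)}[(s_j)_{j=0}^{2n+1},\le]$ if and only if $P^{[S]}_{2n}(z)$ and $P^{[S]}_{2n+1}(z)$ are both positive semidefinite for all $z\in\Pi_+\setminus\mathcal D$.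
   Context: $q\ge1$ is an integer; $\Pi_+:=\{z\in\mathbb C:\operatorname{Im}z>0\}$. For a sequence $(s_j)_{j=0}^{\kappa}$ of complex $q\times q$ matrices put $H_n:=[s_{j+k}]_{j,k=0}^n$ ($2n\le\kappa$), $s_{\alpha\triangleright j}:=-\alpha s_j+s_{j+1}$ ($0\le j\le\kappa-1$), $H_{\alpha\triangleright n}:=[s_{\alpha\triangleright(j+k)}]_{j,k=0}^n$ ($2n+1\le\kappa$), $s_{-1}:=0_{q\times q}$, $u_n:=-\operatorname{col}(s_{j-1})_{j=0}^n$, $y_{0,n}:=\operatorname{col}(s_j)_{j=0}^n$. Let $T_{q,n}:=[\delta_{j,k+1}I_q]_{j,k=0}^n$, $v_{q,n}:=\operatorname{col}(\delta_{j,0}I_q)_{j=0}^n$ and $R_{T_{q,n}}(z):=(I_{(n+1)q}-zT_{q,n})^{-1}$, $z\in\mathbb C$. Potapov matrices: for a set $G\subseteq\mathbb C$ with $G\setminus\mathbb R\neq\emptyset$, a function $f:G\to\mathbb C^{q\times q}$ and $z\in G\setminus\mathbb R$ put $P^{[f]}_{-1}(z):=\frac{(z-\alpha)f(z)-[(z-\alpha)f(z)]^*}{z-\bar z}$; for $2n\le\kappa$, $P^{[f]}_{2n}(z):=\begin{pmatrix}H_n& B(z)\\ B(z)^*&\frac{f(z)-f(z)^*}{z-\bar z}\end{pmatrix}$ with $B(z):=R_{T_{q,n}}(z)[v_{q,n}f(z)-u_n]$; for $2n+1\le\kappa$, $P^{[f]}_{2n+1}(z):=\begin{pmatrix}H_{\alpha\triangleright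 n}& C(z)\\ C(z)^*&\frac{(z-\alpha)f(z)-[(z-\alpha)f(z)]^*}{z-\bar z}\end{pmatrix}$ with $C(z):=R_{T_{q,n}}(z)[v_{q,n}(z-\alpha)f(z)+\alpha u_n+y_{0,n}]$. Stieltjes class: $\mathcal S_{0,q,[\alpha,\infty)}$ is the set of holomorphic $S:\mathbb C\setminus[\alpha,\infty)\to\mathbb C^{q\times q}$ such that $\frac1{2i}(S(z)-S(z)^* )$ is positive semidefinite for all $z\in\Pi_+$, $S(x)$ is positive semidefinite for all $x\in(-\infty,\alpha)$, and $\sup_{y\ge1}y\|S(iy)\|<\infty$. Each such $S$ has a unique nonnegative Hermitian $q\times q$ measure $\sigma$ on the Borel sets of $[\alpha,\infty)$ with $S(z)=\int_{[\alpha,\infty)}\frac{1}{t-z}\sigma(dt)$ (its Stieltjes measure). For $m\in\mathbb N_0$, $\mathcal S_{0,q,[\alpha,\infty)}[(s_j)_{j=0}^m,\le]$ is the set of $S\in\mathcal S_{0,q,[\alpha,\infty)}$ whose Stieltjes measure $\sigma$ satisfies: $t^j$ is $\sigma$-integrable for $j\le m$, $\int t^j\sigma(dt)=s_j$ for $0\le j\le m-1$, and $s_m-\int t^m\sigma(dt)$ is positive semidefinite. *)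

(* Defs.v *)
(* mathcomp + mathcomp-analysis, complex numbers R[i] from
   mathcomp-real-closed, over an arbitrary R : realType. *)
From HB Require Import structures.
From mathcomp Require Import all_boot all_order all_algebra.
From mathcomp Require Import all_classical all_reals all_analysis.
From mathcomp Require Import complex.
Set Implicit Arguments.
Unset Strict Implicit.
Unset Printing Implicit Defensive.
Import Order.TTheory GRing.Theory Num.Theory.
Import numFieldNormedType.Exports.
Local Open Scope classical_set_scope.
Local Open Scope ring_scope.

(* ---------- complex plane ---------- *)

(* open upper half-plane Pi_+ *)
Definition UHP (R : realType) (z : R[i]) : Prop := 0 < complex.Im z.

(* z lies on the half-line [alpha, oo) (as a subset of C) *)
Definition on_halfline (R : realType) (alpha : R) (z : R[i]) : Prop :=
  complex.Im z = 0 /\ alpha <= complex.Re z.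

(* D is a discrete subset of C: every point of D is isolated in D *)
Definition discrete_set (R : realType) (D : set R[i]) : Prop :=
  forall z, D z -> exists r : R, 0 < r /\
    forall w, D w -> `|w - z| < r%:C%C -> w = z.

(* f is holomorphic on the (open) set U: each entry is complex differentiable
   at each point of U *)
Definition holomorphic_on (R : realType) (m n : nat) (U : set R[i])
  (f : R[i] -> 'M[R[i]]_(m, n)) : Prop :=
  forall z, U z -> forall i j,
    derivable ((fun w => f w i j) : (R[i])^o -> (R[i])^o) z 1.

(* ---------- matrices ---------- *)

(* conjugate transpose A^* *)
Definition adjmx (R : realType) (m n : nat) (A : 'M[R[i]]_(m, n)) : 'M[R[i]]_(n, m) :=
  (map_mx Num.conj A)^T.

(* positive semidefinite (Hermitian, nonnegative quadratic form) *)
Definition psdmx (R : realType) (m : nat) (A : 'M[R[i]]_m) : Prop :=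
  A = adjmx A /\ forall u : 'cV[R[i]]_m, 0 <= (adjmx u *m A *m u) 0 0.

(* ---------- nonnegative Hermitian q x q measures on Borel sets of A ---------- *)

(* sigma is defined on the Borel subsets of A, with psd values, and is
   countably additive (entrywise, i.e. real and imaginary parts of every entry
   are countably additive). *)
Definition herm_measure (R : realType) (q : nat) (A : set R)
  (sigma : set R -> 'M[R[i]]_q) : Prop :=
  sigma set0 = 0 /\
  (forall B, measurable B -> B `<=` A -> psdmx (sigma B)) /\
  (forall F : nat -> set R, (forall n, measurable (F n)) -> (forall n, F n `<=` A) ->
     trivIset setT F -> forall i j,
       ((fun N => complex.Re (\sum_(n < N) sigma (F n) i j)) @ \oo -->
          complex.Re (sigma (\bigcup_n F n) i j)) /\
       ((fun N => complex.Im (\sum_(n < N) sigma (F n) i j)) @ \oo -->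
          complex.Im (sigma (\bigcup_n F n) i j))).

(* f : R -> C is integrable on A w.r.t. the nonnegative measure m *)
Definition cintegrable (R : realType) (m : {measure set R -> \bar R}) (A : set R)
  (f : R -> R[i]) : Prop :=
  m.-integrable A (fun t => (complex.Re (f t))%:E) /\
  m.-integrable A (fun t => (complex.Im (f t))%:E).

(* Integral of a complex-valued function f against a complex measure nu on the
   Borel subsets of A: nu = (m1 - m2) + i (m3 - m4) with finite nonnegative
   measures m_k, f integrable w.r.t. each m_k (this exists iff f is integrable
   w.r.t. the variation of nu, and the value c does not depend on the choice). *)
Definition cmeasure_integral (R : realType) (A : set R) (nu : set R -> R[i])
  (f : R -> R[i]) (c : R[i]) : Prop :=
  exists m1 m2 m3 m4 : {measure set R -> \bar R},
    (m1 A < +oo)%E /\ (m2 A < +oo)%E /\ (m3 A < +oo)%E /\ (m4 A < +oo)%E /\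
    (forall B, measurable B -> B `<=` A ->
       nu B = Complex (fine (m1 B) - fine (m2 B)) (fine (m3 B) - fine (m4 B))) /\
    cintegrable m1 A f /\ cintegrable m2 A f /\
    cintegrable m3 A f /\ cintegrable m4 A f /\
    let a := fun t => complex.Re (f t) in
    let b := fun t => complex.Im (f t) in
    c = Complex
      (Rintegral m1 A a - Rintegral m2 A a - Rintegral m3 A b + Rintegral m4 A b)
      (Rintegral m1 A b - Rintegral m2 A b + Rintegral m3 A a - Rintegral m4 A a).

(* f is sigma-integrable and  \int_A f dsigma = M  (entrywise) *)
Definition mx_integral (R : realType) (q : nat) (A : set R)
  (sigma : set R -> 'M[R[i]]_q) (f : R -> R[i]) (M : 'M[R[i]]_q) : Prop :=
  forall i j, cmeasure_integral A (fun B => sigma B i j) f (M i j).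

(* ---------- Stieltjes classes ---------- *)

Definition halfline (R : realType) (alpha : R) : set R := [set t | alpha <= t].

(* S_{0,q,[alpha,oo)} *)
Definition stieltjes_class (R : realType) (q : nat) (alpha : R)
  (S : R[i] -> 'M[R[i]]_q) : Prop :=
  holomorphic_on (fun z => ~ on_halfline alpha z) S /\
  (forall z, UHP z -> psdmx ((2 * 'i)%C^-1 *: (S z - adjmx (S z)))) /\
  (forall x : R, x < alpha -> psdmx (S x%:C%C)) /\
  (exists K : R, forall y : R, 1 <= y -> forall i j,
     `|S (Complex 0 y) i j| * y%:C%C <= K%:C%C).

(* sigma is the Stieltjes measure of S *)
Definition stieltjes_measure_of (R : realType) (q : nat) (alpha : R)
  (S : R[i] -> 'M[R[i]]_q) (sigma : set R -> 'M[R[i]]_q) : Prop :=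
  herm_measure (halfline alpha) sigma /\
  forall z, ~ on_halfline alpha z ->
    mx_integral (halfline alpha) sigma (fun t => (t%:C%C - z)^-1) (S z).

(* S_{0,q,[alpha,oo)}[(s_j)_{j=0}^m, <=] *)
Definition stieltjes_moment_class (R : realType) (q : nat) (alpha : R)
  (s : nat -> 'M[R[i]]_q) (m : nat) (S : R[i] -> 'M[R[i]]_q) : Prop :=
  stieltjes_class alpha S /\
  exists sigma, stieltjes_measure_of alpha S sigma /\
    (forall j, (j < m)%N ->
       mx_integral (halfline alpha) sigma (fun t => (t ^+ j)%:C%C) (s j)) /\
    (exists M, mx_integral (halfline alpha) sigma (fun t => (t ^+ m)%:C%C) M /\
       psdmx (s m - M)).

(* ---------- Potapov matrices ---------- *)

(* kappa in N_0 \cup {oo}: None = oo *)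
Definition le_kappa (m : nat) (kappa : option nat) : Prop :=
  if kappa is Some k then (m <= k)%N else True.

Section Potapov.
Variables (R : realType) (q : nat) (alpha : R) (s : nat -> 'M[R[i]]_q).

(* H_n *)
Definition Hmx (n : nat) := \mxblock_(j < n.+1, k < n.+1) s (j + k)%N.
(* s_{alpha |> j} *)
Definition salpha (j : nat) : 'M[R[i]]_q := - (alpha%:C%C *: s j) + s j.+1.
(* H_{alpha |> n} *)
Definition Hamx (n : nat) := \mxblock_(j < n.+1, k < n.+1) salpha (j + k)%N.
(* T_{q,n} *)
Definition Tmx (n : nat) :=
  \mxblock_(j < n.+1, k < n.+1) (if (j : nat) == k.+1 then 1%:M else 0 : 'M[R[i]]_q).
(* R_{T_{q,n}}(z) *)
Definition RTmx (n : nat) (z : R[i]) := invmx (1%:M - z *: Tmx n).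
(* v_{q,n} *)
Definition vmx (n : nat) :=
  \mxcol_(j < n.+1) (if (j : nat) == 0%N then 1%:M else 0 : 'M[R[i]]_q).
(* s_{j-1} with s_{-1} = 0 *)
Definition sm1 (j : nat) : 'M[R[i]]_q := if j is j'.+1 then s j' else 0.
(* u_n *)
Definition umx (n : nat) := - \mxcol_(j < n.+1) sm1 j.
(* y_{0,n} *)
Definition ymx (n : nat) := \mxcol_(j < n.+1) s j.

Variable f : R[i] -> 'M[R[i]]_q.

(* P^{[f]}_{-1}(z) *)
Definition Pm1 (z : R[i]) : 'M[R[i]]_q :=
  (z - z^*)^-1 *: ((z - alpha%:C%C) *: f z - adjmx ((z - alpha%:C%C) *: f z)).

(* P^{[f]}_{2n}(z) *)
Definition Peven (n : nat) (z : R[i]) :=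
  let B := RTmx n z *m (vmx n *m f z - umx n) in
  block_mx (Hmx n) B (adjmx B) ((z - z^*)^-1 *: (f z - adjmx (f z))).

(* P^{[f]}_{2n+1}(z) *)
Definition Podd (n : nat) (z : R[i]) :=
  let C := RTmx n z *m (vmx n *m ((z - alpha%:C%C) *: f z)
                        + alpha%:C%C *: umx n + ymx n) in
  block_mx (Hamx n) C (adjmx C)
    ((z - z^*)^-1 *: ((z - alpha%:C%C) *: f z - adjmx ((z - alpha%:C%C) *: f z))).

(* "P^{[f]}_k(z) is positive semidefinite", for k >= -1 *)
Definition Ppsd (k : int) (z : R[i]) : Prop :=
  match k with
  | Posz m => if odd m then psdmx (Podd m./2 z) else psdmx (Peven m./2 z)
  | Negz 0 => psdmx (Pm1 z)
  | Negz _ => False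
  end.

End Potapov.

(* Main.v *)
(** Compressing with a vector u replaces S by the scalar function F = u^* S u and the
    matrices s_j by numbers.  Positivity of the Potapov form with a single nonzero
    x_0 reads |F|^2 Im z <= s_0 Im F, so F is a Nevanlinna function of mass at most
    s_0, and Stieltjes inversion (the Poisson formula, from Goursat's lemma on
    rectangles, and an ultrafilter limit of the densities Im F(t + ie) dt / pi)
    represents it by a measure m on the half-line.  A substitution turns the form of
    order n + 1 for (F, s_j) into the form of order n for z^2 F + z s_0 + s_1 and
    s_(j+2), whose measure is t^2 m; Fatou's lemma and dominated convergence along
    z = iy then give the moments by induction.  The odd case is the even one for
    (z - alpha) F + s_0 and the weight t - alpha.  The measures of all u satisfy the
    linear relations of a Hermitian form because the functions Im F do, hence they
    are the compressions of one matrix measure.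

    Conversely, for a mass N >= 0 at the point t the Potapov form is X^* N X with
    X = sum_j t^j x_j + w / (t - z) (times t - alpha in the odd case), and a
    real-linear functional of (S(z), s_j) that is nonnegative on all point masses is
    nonnegative on their integrals.  The exceptional set is removed by continuity
    along vertical segments, since all its points are isolated in it. *)

Require Import Defs.
From HB Require Import structures.
From mathcomp Require Import all_boot all_order all_algebra.
From mathcomp Require Import all_classical all_reals all_analysis.
From mathcomp Require Import measurable_realfun complex ring lra.
Import Order.TTheory GRing.Theory Num.Theory.
Import numFieldNormedType.Exports.
Local Open Scope classical_set_scope.
Local Open Scope ring_scope.

Set Implicit Arguments.
Unset Strict Implicit.
Unset Printing Implicit Defensive.

(** * Complex differentiability *)

(** Two features of the definitions shape the argument. An integral against [sigma] is given entry
    by entry through four finite measures that are only asserted to exist and may change with the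
    entry and the integrand, so a matrix inequality cannot simply be integrated. Positivity of a sum
    of integrals over such unrelated measures m_k is deduced instead from its frozen version, sum_k
    phi_k(t) m_k(B) >= 0 for all points t and Borel sets B, by replacing the continuous phi_k
    locally by constants. In the other direction polarization at four vectors supplies the quadruple
    of measures for every entry. The measures of the vectors u are constructed independently of each
    other. They fit together because one fixed ultrafilter defines all the limits, so that finite
    linear relations survive. They are carried by the half-line because Im((z - alpha) F) >= 0 and
    the bound from the form of order 0 make the density at height e left of alpha of order e. The
    Cauchy estimate obtained from Goursat's lemma has a poor constant; the identity theorem absorbs
    it by taking high powers. *)

Section ComplexModulus.
Variable R : realType.
Local Notation C := R[i].
Implicit Types (z w : C) (f g : C -> C).

(* Norms in R[i] are elements of R[i]; [nc] is the modulus as an element of R. *)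
Definition nc z : R := complex.Re `|z|.

Lemma ncE z : `|z| = (nc z)%:C%C.
Proof. by rewrite /nc normc_def. Qed.

Lemma nc_sqrt z : nc z = Num.sqrt (complex.Re z ^+ 2 + complex.Im z ^+ 2).
Proof. by rewrite /nc normc_def. Qed.

Lemma nc_sqr z : nc z ^+ 2 = complex.Re z ^+ 2 + complex.Im z ^+ 2.
Proof. by rewrite nc_sqrt sqr_sqrtr// addr_ge0 ?sqr_ge0. Qed.

Lemma nc_ge0 z : 0 <= nc z. Proof. by rewrite nc_sqrt sqrtr_ge0. Qed.

Lemma lecR (x y : R) : (x%:C%C <= y%:C%C :> C) = (x <= y).
Proof. by rewrite lecE /= eqxx. Qed.

Lemma ltcR (x y : R) : (x%:C%C < y%:C%C :> C) = (x < y).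
Proof. by rewrite ltcE /= eqxx. Qed.

Lemma ncD z w : nc (z + w) <= nc z + nc w.
Proof. by rewrite -lecR rmorphD/= -!ncE ler_normD. Qed.

Lemma ncM z w : nc (z * w) = nc z * nc w.
Proof. by have := normrM z w; rewrite !ncE -rmorphM => -[]. Qed.

Lemma ncN z : nc (- z) = nc z.
Proof. by rewrite /nc normrN. Qed.

Lemma ncB z w : nc (z - w) <= nc z + nc w.
Proof. by rewrite -(ncN w) ncD. Qed.

Lemma nc_distC z w : nc (z - w) = nc (w - z).
Proof. by rewrite -ncN opprB. Qed.

Lemma ncV z : nc z^-1 = (nc z)^-1.
Proof. by have := normfV z; rewrite !ncE -(fmorphV (real_complex R)) => -[]. Qed.

Lemma nc0 : nc 0 = 0. Proof. by rewrite /nc normr0. Qed.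
Lemma nc1 : nc 1 = 1. Proof. by rewrite /nc normr1. Qed.

Lemma nc_gt0 z : (0 < nc z) = (z != 0).
Proof. by rewrite -ltcR -ncE normr_gt0. Qed.

Lemma ncX z n : nc (z ^+ n) = nc z ^+ n.
Proof. by elim: n => [|n IH]; rewrite ?expr0 ?nc1// !exprS ncM IH. Qed.

Lemma nc_real (x : R) : nc x%:C%C = `|x|.
Proof. by rewrite nc_sqrt /= expr0n/= addr0 sqrtr_sqr. Qed.

Lemma nc_i : nc 'i%C = 1.
Proof. by rewrite nc_sqrt /= expr0n/= add0r expr1n sqrtr1. Qed.

Lemma nc_conj z : nc z^* = nc z.
Proof. by rewrite /nc norm_conjC. Qed.

Lemma Re_le_nc z : `|complex.Re z| <= nc z.
Proof.
by rewrite -ler_sqr ?nnegrE ?nc_ge0// nc_sqr real_normK ?num_real// lerDl sqr_ge0.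
Qed.

Lemma Im_le_nc z : `|complex.Im z| <= nc z.
Proof.
by rewrite -ler_sqr ?nnegrE ?nc_ge0// nc_sqr real_normK ?num_real// lerDr sqr_ge0.
Qed.

Lemma nc_le z : nc z <= `|complex.Re z| + `|complex.Im z|.
Proof.
rewrite -ler_sqr ?nnegrE ?nc_ge0 ?addr_ge0// nc_sqr sqrrD !real_normK ?num_real//.
by rewrite lerD2r lerDl mulrn_wge0// mulr_ge0.
Qed.

Lemma nc_le_dist z w : nc z <= nc w + nc (z - w).
Proof. by rewrite -{1}(subrK w z) (le_trans (ncD _ _))// addrC. Qed.

Lemma cReD z w : complex.Re (z + w) = complex.Re z + complex.Re w.
Proof. by case: z w => a b [c d]. Qed.
Lemma cImD z w : complex.Im (z + w) = complex.Im z + complex.Im w.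
Proof. by case: z w => a b [c d]. Qed.
Lemma cReN z : complex.Re (- z) = - complex.Re z.
Proof. by case: z => a b. Qed.
Lemma cImN z : complex.Im (- z) = - complex.Im z.
Proof. by case: z => a b. Qed.
Lemma cReM z w : complex.Re (z * w) =
  complex.Re z * complex.Re w - complex.Im z * complex.Im w.
Proof. by case: z w => a b [c d]. Qed.
Lemma cImM z w : complex.Im (z * w) =
  complex.Re z * complex.Im w + complex.Im z * complex.Re w.
Proof. by case: z w => a b [c d]. Qed.
Lemma cReJ z : complex.Re z^* = complex.Re z.
Proof. by case: z => a b. Qed.
Lemma cImJ z : complex.Im z^* = - complex.Im z.
Proof. by case: z => a b. Qed.

Lemma complex_eq z w : complex.Re z = complex.Re w ->
  complex.Im z = complex.Im w -> z = w.
Proof. by case: z w => a b [c d] /= -> ->. Qed.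

Lemma cReV z : complex.Re z^-1 = complex.Re z / nc z ^+ 2.
Proof. by rewrite nc_sqr; case: z. Qed.

Lemma cImV z : complex.Im z^-1 = - (complex.Im z / nc z ^+ 2).
Proof. by rewrite nc_sqr; case: z. Qed.

(** Written without a quotient and with real [e] and [r]: the case w = z needs no exception and all
    estimates take place in R. *)
Definition cdiff f z := exists d, forall e : R, 0 < e ->
  exists2 r : R, 0 < r & forall w, nc (w - z) < r ->
    nc (f w - f z - d * (w - z)) <= e * nc (w - z).

Lemma cdiffP f z :
  cdiff f z <-> derivable (f : C^o -> C^o) z 1.
Proof.
split=> [[d hd]|].
  apply/cvg_ex; exists d; apply/cvgrPdist_lt => e e0.
  have eE : e = (complex.Re e)%:C%C.
    by move: e0; rewrite ltcE/= => /andP[/eqP]; case: (e) => a b /= -> _.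
  have {}e0 : 0 < complex.Re e by rewrite -ltcR -eE.
  have [r r0 hr] := hd (complex.Re e / 2) (divr_gt0 e0 (ltr0Sn _ 1)).
  near=> h.
  have h0 : h != 0 by near: h; exact: nbhs_dnbhs_neq.
  have hr' : nc h < r.
    have : `|h| < r%:C%C.
      near: h; apply: dnbhs0_lt; rewrite ltcR//.
    by rewrite ncE ltcR.
  have := hr (h + z); rewrite addrK => /(_ hr') {}hr.
  rewrite /= /GRing.scale/= mulr1 eE ncE ltcR.
  have -> : d - h^-1 * (f (h + z) - f z) = - (h^-1 * (f (h + z) - f z - d * h)).
    by field.
  rewrite ncN ncM ncV; have n0 : 0 < nc h by rewrite nc_gt0.
  rewrite ltr_pdivrMl// (le_lt_trans hr)// mulrC ltr_pM2l//.
  by rewrite gtr_pMr// invf_lt1// ltr1n.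
move=> /cvg_ex[/= d /cvgrPdist_lt hd]; exists d => e e0.
have /hd : (0 : C) < e%:C%C by rewrite ltcR.
rewrite near_withinE => /nbhs_ballP[/= r0 r00 hr].
have r0E : r0 = (complex.Re r0)%:C%C.
  by move: r00; rewrite ltcE/= => /andP[/eqP]; case: (r0) => a b /= -> _.
exists (complex.Re r0); first by rewrite -ltcR -r0E.
move=> w wz; have [->|wz0] := eqVneq w z.
  by rewrite !subrr mulr0 subrr nc0 mulr0.
have := hr (w - z); rewrite /ball/= sub0r normrN r0E ncE ltcR => /(_ wz).
rewrite subr_eq0 => /(_ wz0).
rewrite ncE /GRing.scale/= mulr1 subrK ltcR => /ltW.
have wz1 : w - z != 0 by rewrite subr_eq0.
have -> : d - (w - z)^-1 * (f w - f z) = - ((w - z)^-1 * (f w - f z - d * (w - z))).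
  by field.
by rewrite ncN ncM ncV ler_pdivrMl ?nc_gt0// [e * _]mulrC.
Unshelve. all: end_near. Qed.

Lemma cdiff_cst (c : C) z : cdiff (fun=> c) z.
Proof. by apply/cdiffP; exact: derivable_cst. Qed.
Lemma cdiff_id z : cdiff id z.
Proof. by apply/cdiffP; exact: derivable_id. Qed.
Lemma cdiffD f g z : cdiff f z -> cdiff g z -> cdiff (fun w => f w + g w) z.
Proof. by move=> /cdiffP hf /cdiffP hg; apply/cdiffP; exact: derivableD. Qed.
Lemma cdiffN f z : cdiff f z -> cdiff (fun w => - f w) z.
Proof. by move=> /cdiffP hf; apply/cdiffP; exact: derivableN. Qed.
Lemma cdiffB f g z : cdiff f z -> cdiff g z -> cdiff (fun w => f w - g w) z.
Proof. by move=> hf hg; apply: cdiffD => //; exact: cdiffN. Qed.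
Lemma cdiffM f g z : cdiff f z -> cdiff g z -> cdiff (fun w => f w * g w) z.
Proof. by move=> /cdiffP hf /cdiffP hg; apply/cdiffP; exact: (derivableM hf hg). Qed.
Lemma cdiffV f z : f z != 0 -> cdiff f z -> cdiff (fun w => (f w)^-1) z.
Proof. by move=> f0 /cdiffP hf; apply/cdiffP; exact: derivableV. Qed.
Lemma cdiffX f n z : cdiff f z -> cdiff (fun w => f w ^+ n) z.
Proof.
move=> hf; elim: n => [|n IH].
  by under eq_fun do rewrite expr0; exact: cdiff_cst.
by under eq_fun do rewrite exprS; exact: cdiffM.
Qed.
Lemma cdiff_sum (I : Type) (r : seq I) (F : I -> C -> C) z :
  (forall i, cdiff (F i) z) -> cdiff (fun w => \sum_(i <- r) F i w) z.
Proof.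
move=> h; elim: r => [|i r IH].
  by under eq_fun do rewrite big_nil; exact: cdiff_cst.
by under eq_fun do rewrite big_cons; exact: cdiffD.
Qed.

Lemma cdiff_near f g z (r : R) : 0 < r ->
  (forall w, nc (w - z) < r -> f w = g w) -> cdiff f z -> cdiff g z.
Proof.
move=> r0 fg [d hd]; exists d => e /hd[s s0 hs].
exists (Num.min r s); first by rewrite lt_min r0.
move=> w; rewrite lt_min => /andP[wr ws].
by rewrite -!fg// ?subrr ?nc0//; exact: hs.
Qed.

Definition ccont f z := forall e : R, 0 < e ->
  exists2 r : R, 0 < r & forall w, nc (w - z) < r -> nc (f w - f z) < e.

Lemma cdiff_lip f z : cdiff f z -> exists K, exists2 r : R, 0 < r &
  forall w, nc (w - z) < r -> nc (f w - f z) <= K * nc (w - z).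
Proof.
move=> [d /(_ 1 ltr01)[r r0 hr]]; exists (nc d + 1); exists r => // w /hr.
rewrite mulrDl mul1r -ncM; set a := f w - f z; set b := d * _; move=> h.
by have := nc_le_dist a b; lra.
Qed.

Lemma cdiff_cont f z : cdiff f z -> ccont f z.
Proof.
move=> /cdiff_lip[K [r r0 hr]] e e0.
have K0 : 0 < `|K| + 1 by rewrite ltr_wpDl.
exists (Num.min r (e / (`|K| + 1))); first by rewrite lt_min r0 divr_gt0.
move=> w; rewrite lt_min ltr_pdivlMr// => /andP[wr ws].
apply: le_lt_trans (hr _ wr) (le_lt_trans _ ws).
rewrite mulrC ler_wpM2l ?nc_ge0//; apply: (le_trans (ler_norm _)).
by rewrite lerDl.
Qed.

End ComplexModulus.

(** * Goursat's lemma on rectangles *)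

Section RectangleIntegral.
Variable R : realType.
Local Notation C := R[i].
Local Notation mu := (@lebesgue_measure R).
Implicit Types (a b c d : R) (h g : C -> C) (phi psi : R -> C).

Definition ccon a b phi :=
  {within `[a, b], continuous (fun t => complex.Re (phi t))} /\
  {within `[a, b], continuous (fun t => complex.Im (phi t))}.

Definition cI a b phi : C :=
  Complex (\int[mu]_(t in `[a, b]) complex.Re (phi t))
          (\int[mu]_(t in `[a, b]) complex.Im (phi t)).

Lemma within_cont_integrable a b (f : R -> R) :
  {within `[a, b], continuous f} -> mu.-integrable `[a, b] (EFin \o f).
Proof. by move=> fc; apply: continuous_compact_integrable => //; exact: segment_compact. Qed.
Let wci := within_cont_integrable.

Lemma eq_cI a b phi psi : (forall t, a <= t <= b -> phi t = psi t) ->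
  cI a b phi = cI a b psi.
Proof.
by move=> h; congr Complex; apply: eq_Rintegral => t;
  rewrite inE/= in_itv/= => /h ->.
Qed.

Lemma cIB a b phi psi : ccon a b phi -> ccon a b psi ->
  cI a b (fun t => phi t - psi t) = cI a b phi - cI a b psi.
Proof.
move=> [h1 h2] [h3 h4]; apply: complex_eq; rewrite /= ?(cReD, cImD, cReN, cImN)/= -RintegralB//;
  try exact: wci; by apply: eq_Rintegral => t _; rewrite ?(cReD, cImD, cReN, cImN).
Qed.

Lemma cIZ a b (k : C) phi : ccon a b phi ->
  cI a b (fun t => k * phi t) = k * cI a b phi.
Proof.
move=> [h1 h2]; have I (r : R) (f : R -> R) : {within `[a, b], continuous f} ->
    mu.-integrable `[a, b] (EFin \o (fun t => r * f t)).
  move=> /wci/(integrableZl _ r) => /(_ (measurable_itv _)).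
  by apply: eq_integrable => // t _; rewrite /= EFinM.
apply: complex_eq; rewrite /= ?(cReM, cImM)/= -!RintegralZl//; try exact: wci.
  by rewrite -RintegralB ?I//; apply: eq_Rintegral => t _; rewrite cReM.
by rewrite -RintegralD ?I//; apply: eq_Rintegral => t _; rewrite cImM.
Qed.

Lemma cI_cst a b (k : C) : a <= b -> cI a b (fun=> k) = k * (b - a)%:C%C.
Proof.
move=> ab; have E : fine (mu `[a, b]) = b - a.
  rewrite lebesgue_measure_itv/= lte_fin; case: ltP => //= ba.
  by apply/esym/eqP; rewrite subr_eq0 eq_le ab ba.
apply: complex_eq; rewrite /= ?(cReM, cImM)/= Rintegral_cst// E.
  by rewrite mulr0 subr0.
by rewrite mulr0 add0r.
Qed.

(** The factor 2 comes from bounding the real and the imaginary integral separately; later arguments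
    tolerate any constant. *)
Lemma cI_norm a b phi (M : R) : a <= b -> ccon a b phi ->
  (forall t, a <= t <= b -> nc (phi t) <= M) ->
  nc (cI a b phi) <= 2 * M * (b - a).
Proof.
move=> ab [h1 h2] hM.
have E : fine (mu `[a, b]) = b - a.
  rewrite lebesgue_measure_itv/= lte_fin; case: ltP => //= ba.
  by apply/esym/eqP; rewrite subr_eq0 eq_le ab ba.
have K (f : R -> R) : {within `[a, b], continuous f} ->
    (forall t, a <= t <= b -> `|f t| <= M) ->
    `|\int[mu]_(t in `[a, b]) f t| <= M * (b - a).
  move=> fc fM; apply: (le_trans (le_normr_Rintegral _ (wci _))) => //.
  rewrite -E -Rintegral_cst//; apply: le_Rintegral => //.
  - exact: (integrable_norm (wci fc)).
  - by apply: wci; apply: continuous_subspaceT => x; exact: cst_continuous.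
apply: (le_trans (nc_le _)) => /=.
rewrite -mulrA mulr_natl mulr2n lerD// K// => t /hM; apply: le_trans.
  exact: Re_le_nc.
exact: Im_le_nc.
Qed.

Lemma within_itv_sub a b a' b' (f : R -> R) : a <= a' -> b' <= b ->
  {within `[a, b], continuous f} -> {within `[a', b'], continuous f}.
Proof.
move=> aa bb; apply: continuous_subspaceW => x /=; rewrite !in_itv/=.
by move=> /andP[h1 h2]; rewrite (le_trans aa)// (le_trans _ bb).
Qed.

Lemma cI_split a m b phi : a <= m -> m <= b -> ccon a b phi ->
  cI a b phi = cI a m phi + cI m b phi.
Proof.
move=> am mb [h1 h2].
have K (f : R -> R) : {within `[a, b], continuous f} ->
    \int[mu]_(t in `[a, b]) f t =
    \int[mu]_(t in `[a, m]) f t + \int[mu]_(t in `[m, b]) f t.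
  move=> /[dup] fc /wci/(@Rintegral_itvB _ _ _ _ m); rewrite !bnd_simp => /(_ am mb).
  rewrite Rintegral_itv_obnd_cbnd; last first.
    apply: (@integrableS _ _ _ mu `[m, b]) => //.
      by apply: subset_itvr; rewrite bnd_simp.
    by apply: wci; exact: (within_itv_sub am (lexx b)).
  by move=> <-; rewrite addrC subrK.
by apply: complex_eq; rewrite /= ?(cReD, cImD)/= K.
Qed.

Lemma ccon_path h (gam : R -> C) a b :
  (forall s t, nc (gam s - gam t) <= `|s - t|) ->
  (forall t, a <= t <= b -> ccont h (gam t)) -> ccon a b (fun t => h (gam t)).
Proof.
move=> gl hc.
have K : forall t, t \in `[a, b] -> forall e : R, 0 < e ->
    \forall s \near t, nc (h (gam s) - h (gam t)) < e.
  move=> t; rewrite in_itv/= => /hc tc e /tc[r r0 hr].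
  near=> s; apply: hr; apply: (le_lt_trans (gl _ _)).
  rewrite distrC; near: s; exact: (@cvgr_dist_lt _ _ _ (nbhs t) _ id).
split; apply: continuous_in_subspaceT.
  move=> t /set_mem/= tab; apply/cvgrPdist_lt => e e0.
  have := K t tab e e0; apply: filterS => s; apply: le_lt_trans.
  by rewrite distrC -cReN -cReD Re_le_nc.
move=> t /set_mem/= tab; apply/cvgrPdist_lt => e e0.
have := K t tab e e0; apply: filterS => s; apply: le_lt_trans.
by rewrite distrC -cImN -cImD Im_le_nc.
Unshelve. all: end_near. Qed.

Lemma nc_hor (c s t : R) : nc (Complex s c - Complex t c) <= `|s - t|.
Proof.
by rewrite (le_trans (nc_le _))//= ?(cReD,cImD,cReN,cImN)/= subrr normr0 addr0.
Qed.

Lemma nc_ver (c s t : R) : nc (Complex c s - Complex c t) <= `|s - t|.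
Proof.
by rewrite (le_trans (nc_le _))//= ?(cReD,cImD,cReN,cImN)/= subrr normr0 add0r.
Qed.

Definition in_rect a b c d (z : C) :=
  a <= complex.Re z <= b /\ c <= complex.Im z <= d.

(** The counterclockwise boundary integral over [a, b] x [c, d]: dw is dx on the horizontal sides
    and i dy on the vertical ones. *)
Definition rI h a b c d : C :=
  cI a b (fun x => h (Complex x c)) - cI a b (fun x => h (Complex x d)) +
  'i%C * (cI c d (fun y => h (Complex b y)) - cI c d (fun y => h (Complex a y))).

Definition side_cont h a b c d :=
  [/\ forall x, a <= x <= b -> ccont h (Complex x c),
      forall x, a <= x <= b -> ccont h (Complex x d),
      forall y, c <= y <= d -> ccont h (Complex b y) &
      forall y, c <= y <= d -> ccont h (Complex a y)].

Lemma side_ccon h a b c d : side_cont h a b c d ->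
  [/\ ccon a b (fun x => h (Complex x c)), ccon a b (fun x => h (Complex x d)),
      ccon c d (fun y => h (Complex b y)) & ccon c d (fun y => h (Complex a y))].
Proof.
by move=> [h1 h2 h3 h4]; split; apply: ccon_path => // s t;
  try exact: nc_hor; exact: nc_ver.
Qed.

Lemma rIB h g a b c d : side_cont h a b c d -> side_cont g a b c d ->
  rI (fun w => h w - g w) a b c d = rI h a b c d - rI g a b c d.
Proof.
move=> /side_ccon[h1 h2 h3 h4] /side_ccon[g1 g2 g3 g4].
by rewrite /rI !cIB//; ring.
Qed.

Lemma rIZ (k : C) h a b c d : side_cont h a b c d ->
  rI (fun w => k * h w) a b c d = k * rI h a b c d.
Proof. by move=> /side_ccon[h1 h2 h3 h4]; rewrite /rI !cIZ//; ring. Qed.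

Lemma rI_norm h a b c d (M : R) : a <= b -> c <= d -> side_cont h a b c d ->
  (forall x, a <= x <= b -> nc (h (Complex x c)) <= M) ->
  (forall x, a <= x <= b -> nc (h (Complex x d)) <= M) ->
  (forall y, c <= y <= d -> nc (h (Complex b y)) <= M) ->
  (forall y, c <= y <= d -> nc (h (Complex a y)) <= M) ->
  nc (rI h a b c d) <= 4 * M * ((b - a) + (d - c)).
Proof.
move=> ab cd /side_ccon[h1 h2 h3 h4] m1 m2 m3 m4.
have := cI_norm ab h1 m1; have := cI_norm ab h2 m2.
have := cI_norm cd h3 m3; have := cI_norm cd h4 m4.
rewrite /rI; set A := cI _ _ _; set B := cI _ _ _; set E := cI _ _ _; set F := cI _ _ _.
move=> HA HB HE HF.
apply: (le_trans (ncD _ _)); rewrite ncM nc_i mul1r.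
by apply: (le_trans (lerD (ncB _ _) (ncB _ _))); lra.
Qed.

Lemma rI_vsplit h a m b c d : a <= m -> m <= b ->
  (forall x, a <= x <= b -> ccont h (Complex x c)) ->
  (forall x, a <= x <= b -> ccont h (Complex x d)) ->
  rI h a b c d = rI h a m c d + rI h m b c d.
Proof.
move=> am mb h1 h2; rewrite /rI.
rewrite (@cI_split a m b (fun x => h (Complex x c)))//; last first.
  by apply: ccon_path => // s t; exact: nc_hor.
rewrite (@cI_split a m b (fun x => h (Complex x d)))//; last first.
  by apply: ccon_path => // s t; exact: nc_hor.
by ring.
Qed.

Lemma rI_hsplit h a b c m d : c <= m -> m <= d ->
  (forall y, c <= y <= d -> ccont h (Complex a y)) ->
  (forall y, c <= y <= d -> ccont h (Complex b y)) ->
  rI h a b c d = rI h a b c m + rI h a b m d.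
Proof.
move=> cm md h1 h2; rewrite /rI.
rewrite (@cI_split c m d (fun y => h (Complex a y)))//; last first.
  by apply: ccon_path => // s t; exact: nc_ver.
rewrite (@cI_split c m d (fun y => h (Complex b y)))//; last first.
  by apply: ccon_path => // s t; exact: nc_ver.
by ring.
Qed.

Lemma side_cont_rect h a b c d : a <= b -> c <= d ->
  (forall z, in_rect a b c d z -> ccont h z) -> side_cont h a b c d.
Proof.
move=> ab cd hc; split=> t tt; apply: hc; rewrite /in_rect/= ?tt ?lexx ?ab ?cd//.
Qed.

(** On opposite sides an affine function differs by a constant, so the horizontal pair gives i l (c
    - d)(b - a) and the vertical pair its negative. *)
Lemma rI_affine (k l p : C) a b c d : a <= b -> c <= d ->
  rI (fun w => k + l * (w - p)) a b c d = 0.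
Proof.
move=> ab cd.
have ct z : ccont (fun w => k + l * (w - p)) z.
  apply: cdiff_cont; apply: cdiffD; first exact: cdiff_cst.
  apply: cdiffM; first exact: cdiff_cst.
  by apply: cdiffB; [exact: cdiff_id|exact: cdiff_cst].
have [h1 h2 h3 h4] := side_ccon (@side_cont_rect _ a b c d ab cd (fun z _ => ct z)).
rewrite /rI -!cIB//.
under eq_cI => t _.
  rewrite (_ : _ - _ = l * ('i%C * (c - d)%:C%C)); last first.
    have -> : Complex t c = t%:C%C + 'i%C * c%:C%C by rewrite [LHS]complexE.
    have -> : Complex t d = t%:C%C + 'i%C * d%:C%C by rewrite [LHS]complexE.
    by rewrite rmorphB; ring.
  over.
rewrite cI_cst//.
under eq_cI => t _.
  rewrite (_ : _ - _ = l * (b - a)%:C%C); last first.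
    have -> : Complex b t = b%:C%C + 'i%C * t%:C%C by rewrite [LHS]complexE.
    have -> : Complex a t = a%:C%C + 'i%C * t%:C%C by rewrite [LHS]complexE.
    by rewrite rmorphB; ring.
  over.
by rewrite cI_cst// !rmorphB; ring.
Qed.

End RectangleIntegral.

Ltac order_lra := match goal with
  | |- is_true (_ <= _) => lra | |- is_true (_ < _) => lra end.

(** * Bisection, and removal of one bounded singularity *)

Section Goursat.
Variable R : realType.
Local Notation C := R[i].
Implicit Types (a b c d : R) (h g : C -> C).

Lemma in_rect_sub a b c d a' b' c' d' (z : C) : a <= a' -> b' <= b -> c <= c' ->
  d' <= d -> in_rect a' b' c' d' z -> in_rect a b c d z.
Proof.
move=> h1 h2 h3 h4 [/andP[h5 h6] /andP[h7 h8]].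
by split; apply/andP; split; lra.
Qed.

Section Bisection.
Variables (h : C -> C) (a0 c0 L M : R).
Hypotheses (L0 : 0 <= L) (M0 : 0 <= M).
Hypothesis hd : forall z, in_rect a0 (a0 + L) c0 (c0 + M) z -> cdiff h z.

Let l (n : nat) := L / 2 ^+ n.
Let m (n : nat) := M / 2 ^+ n.
Let Q n (p : R * R) := nc (rI h p.1 (p.1 + l n) p.2 (p.2 + m n)).
Let inside n (p : R * R) :=
  [/\ a0 <= p.1, p.1 + l n <= a0 + L, c0 <= p.2 & p.2 + m n <= c0 + M].
Let refines n (p p' : R * R) :=
  [/\ p.1 <= p'.1, p'.1 + l n.+1 <= p.1 + l n, p.2 <= p'.2,
      p'.2 + m n.+1 <= p.2 + m n & Q n p <= 4 * Q n.+1 p'].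

Let l_ge0 n : 0 <= l n. Proof. by rewrite divr_ge0. Qed.
Let m_ge0 n : 0 <= m n. Proof. by rewrite divr_ge0. Qed.
Let lS n : l n = l n.+1 + l n.+1.
Proof. by rewrite /l exprS invfM; field. Qed.
Let mS n : m n = m n.+1 + m n.+1.
Proof. by rewrite /m exprS invfM; field. Qed.

(** The boundary integral is the sum of those over the four quarters, so one quarter carries at
    least a fourth of its modulus. *)
Lemma bisection_step n p : inside n p -> exists p', inside n.+1 p' /\ refines n p p'.
Proof.
case: p => a c [/= i1 i2 i3 i4]; rewrite /refines /Q /inside /=.
have := l_ge0 n.+1; have := m_ge0 n.+1; have := lS n; have := mS n.
set ln := l n; set mn := m n; set l' := l n.+1; set m' := m n.+1 => mE lE m0 l0.
rewrite -/ln in i2; rewrite -/mn in i4.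
clearbody ln mn l' m'.
have ct x y : a <= x <= a + ln -> c <= y <= c + mn -> ccont h (Complex x y).
  move=> /andP[x1 x2] /andP[y1 y2]; apply: cdiff_cont; apply: hd.
  by split; apply/andP; split; rewrite /=; lra.
have E : rI h a (a + ln) c (c + mn) =
    rI h a (a + l') c (c + m') + rI h (a + l') (a + l' + l') c (c + m') +
    (rI h a (a + l') (c + m') (c + m' + m') +
     rI h (a + l') (a + l' + l') (c + m') (c + m' + m')).
  rewrite lE mE [a + (l' + l')]addrA [c + (m' + m')]addrA (@rI_hsplit _ _ _ _ c (c + m') (c + m' + m')); try order_lra;
    try (by move=> y /andP[y1 y2]; apply: ct; apply/andP; split; lra).
  rewrite (@rI_vsplit _ _ a (a + l') (a + l' + l') c); try order_lra;
    try (by move=> y /andP[y1 y2]; apply: ct; apply/andP; split; lra).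
  rewrite (@rI_vsplit _ _ a (a + l') (a + l' + l') (c + m')); try order_lra;
    try (by move=> y /andP[y1 y2]; apply: ct; apply/andP; split; lra).
  by ring.
rewrite E; move: E => _.
set A := rI h a _ c _; set B := rI h _ _ c _; set A' := rI h a _ _ _.
set B' := rI h _ _ _ _.
have N : nc (A + B + (A' + B')) <= nc A + nc B + (nc A' + nc B').
  by apply: (le_trans (ncD _ _)); apply: lerD; exact: ncD.
have [hA|[hB|[hA'|hB']]] : nc (A + B + (A' + B')) <= 4 * nc A \/
    nc (A + B + (A' + B')) <= 4 * nc B \/ nc (A + B + (A' + B')) <= 4 * nc A' \/
    nc (A + B + (A' + B')) <= 4 * nc B'.
  move: N; move: (nc _) (nc A) (nc B) (nc A') (nc B') => u v1 v2 v3 v4 N.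
  have [|?] := lerP u (4 * v1); first by left.
  have [|?] := lerP u (4 * v2); first by right; left.
  have [|?] := lerP u (4 * v3); first by right; right; left.
  by right; right; right; lra.
- by exists (a, c); split; split => //; clear -i1 i2 i3 i4 mE lE m0 l0 => /=; lra.
- by exists (a + l', c); split; split => //; clear -i1 i2 i3 i4 mE lE m0 l0 => /=; lra.
- by exists (a, c + m'); split; split => //; clear -i1 i2 i3 i4 mE lE m0 l0 => /=; lra.
- by exists (a + l', c + m'); split; split => //; clear -i1 i2 i3 i4 mE lE m0 l0 => /=; lra.
Qed.

Lemma goursat_norm : rI h a0 (a0 + L) c0 (c0 + M) = 0.
Proof.
(* Placing [inside] among the premises makes the step total, so that [choice] yields a function to
   iterate. *)
have step (np : nat * (R * R)) : exists p', inside np.1 np.2 ->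
    inside np.1.+1 p' /\ refines np.1 np.2 p'.
  have [/bisection_step[p' ?]|ni] := pselect (inside np.1 np.2); first by exists p'.
  by exists np.2.
have [f fP] := choice step.
pose P := fix P n := if n is n'.+1 then f (n', P n') else (a0, c0).
have l0E : l 0%N = L by rewrite /l expr0 divr1.
have m0E : m 0%N = M by rewrite /m expr0 divr1.
have insP n : inside n (P n).
  elim: n => [|n IH]; first by split; rewrite /= ?l0E ?m0E.
  by have [] := fP (n, P n) IH.
have refP n : refines n (P n) (P n.+1) by have [] := fP (n, P n) (insP n).
have nest n k : [/\ (P n).1 <= (P (k + n)%N).1,
    (P (k + n)%N).1 + l (k + n)%N <= (P n).1 + l n,
    (P n).2 <= (P (k + n)%N).2 &
    (P (k + n)%N).2 + m (k + n)%N <= (P n).2 + m n].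
  elim: k => [|k [h1 h2 h3 h4]]; first by rewrite add0n.
  by have [g1 g2 g3 g4 _] := refP (k + n)%N; rewrite addSn; split; lra.
have bnd1 n k : (P k).1 <= (P n).1 + l n.
  have [nk|/ltnW kn] := leqP n k.
    have [_ h2 _ _] := nest n (k - n)%N; rewrite subnK// in h2.
    by have := l_ge0 k; lra.
  have [h1 _ _ _] := nest k (n - k)%N; rewrite subnK// in h1.
  by have := l_ge0 n; lra.
have bnd2 n k : (P k).2 <= (P n).2 + m n.
  have [nk|/ltnW kn] := leqP n k.
    have [_ _ _ h2] := nest n (k - n)%N; rewrite subnK// in h2.
    by have := m_ge0 k; lra.
  have [_ _ h1 _] := nest k (n - k)%N; rewrite subnK// in h1.
  by have := m_ge0 n; lra.
(* The suprema of the lower left corners give the common point of the nested rectangles, since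
   [bnd1] and [bnd2] put every corner below every upper edge. *)
pose x := sup (range (fun n => (P n).1)); pose y := sup (range (fun n => (P n).2)).
have x1 n : (P n).1 <= x.
  apply: ub_le_sup; last by exists n.
  by exists ((P 0%N).1 + l 0%N) => _ [k _ <-]; exact: bnd1.
have x2 n : x <= (P n).1 + l n.
  by apply: ge_sup; [exists (P 0%N).1; exists 0%N|move=> _ [k _ <-]; exact: bnd1].
have y1 n : (P n).2 <= y.
  apply: ub_le_sup; last by exists n.
  by exists ((P 0%N).2 + m 0%N) => _ [k _ <-]; exact: bnd2.
have y2 n : y <= (P n).2 + m n.
  by apply: ge_sup; [exists (P 0%N).2; exists 0%N|move=> _ [k _ <-]; exact: bnd2].
pose p : C := Complex x y.
have [D hD] : cdiff h p.
  apply: hd; split; rewrite /=.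
    by have := x1 0%N; have := x2 0%N; rewrite /= l0E => -> ->.
  by have := y1 0%N; have := y2 0%N; rewrite /= m0E => -> ->.
(* Around p the function is affine up to e |w - p|, and the affine part integrates to 0. The n-th
   rectangle thus contributes at most 4 e (l n + m n)^2, where (l n + m n)^2 = (L + M)^2 / 4^n
   cancels the factor 4^n collected during the bisection. *)
have small : forall e : R, 0 < e ->
    nc (rI h a0 (a0 + L) c0 (c0 + M)) <= 4 * e * (L + M) ^+ 2.
  move=> e e0; have [r r0 hr] := hD e e0.
  have [n nr] : exists n : nat, (L + M) / 2 ^+ n < r.
    have : (fun n => geometric (L + M) (2^-1) n) @ \oo --> 0.
      by apply: cvg_geometric; rewrite ger0_norm// invf_lt1// ltr1n.
    move=> /cvgrPdist_lt/(_ r r0)[n _ /(_ n (leqnn n))].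
    rewrite /geometric/= sub0r normrN => hn; exists n.
    by rewrite -exprVn (le_lt_trans (ler_norm _)).
  have s2 : l n + m n < r by rewrite -mulrDl.
  have insn := insP n; case: insn; set a := (P n).1; set c := (P n).2 => i1 i2 i3 i4.
  have near z : in_rect a (a + l n) c (c + m n) z -> nc (z - p) <= l n + m n.
    move=> [/andP[z1 z2] /andP[z3 z4]]; apply: (le_trans (nc_le _)).
    rewrite cReD cImD cReN cImN /=.
    have := x1 n; have := x2 n; have := y1 n; have := y2 n; rewrite -/a -/c => *.
    by apply: lerD; rewrite ler_norml; apply/andP; split; lra.
  have hc z : in_rect a (a + l n) c (c + m n) z -> ccont h z.
    by move=> hz; apply: cdiff_cont; apply: hd; apply: in_rect_sub hz.
  have ln0 := l_ge0 n; have mn0 := m_ge0 n.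
  have sh : side_cont h a (a + l n) c (c + m n) by apply: side_cont_rect; rewrite ?lerDl.
  pose A (w : C) := h p + D * (w - p).
  have cA z : cdiff A z.
    apply: cdiffD; first exact: cdiff_cst.
    apply: cdiffM; first exact: cdiff_cst.
    by apply: cdiffB; [exact: cdiff_id|exact: cdiff_cst].
  have sA : side_cont A a (a + l n) c (c + m n).
    by apply: side_cont_rect; rewrite ?lerDl// => z _; exact: cdiff_cont.
  have E : rI h a (a + l n) c (c + m n) =
      rI (fun w => h w - A w) a (a + l n) c (c + m n).
    by rewrite rIB// rI_affine ?lerDl// subr0.
  have cd z : in_rect a (a + l n) c (c + m n) z -> ccont (fun w => h w - A w) z.
    move=> hz; apply: cdiff_cont; apply: cdiffB => //.
    by apply: hd; apply: in_rect_sub hz.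
  have bd z : in_rect a (a + l n) c (c + m n) z ->
      nc (h z - A z) <= e * (l n + m n).
    move=> hz; rewrite /A opprD addrA.
    apply: (le_trans (hr _ (le_lt_trans (near _ hz) s2))).
    by rewrite ler_pM2l// near.
  have Qn : Q n (P n) <= 4 * e * (l n + m n) ^+ 2.
    rewrite /Q -/a -/c E.
    apply: (@le_trans _ _ (4 * (e * (l n + m n)) *
      ((a + l n - a) + (c + m n - c)))); last first.
      by rewrite le_eqVlt; apply/orP; left; apply/eqP; move: (l n) (m n) => u v; ring.
    apply: rI_norm; rewrite ?lerDl//.
    - by apply: side_cont_rect; rewrite ?lerDl.
    - by move=> t tt; apply: bd; split => //=; rewrite lexx lerDl.
    - by move=> t tt; apply: bd; split => //=; rewrite lexx lerDl mn0.
    - by move=> t tt; apply: bd; split => //=; rewrite lexx lerDl ln0.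
    - by move=> t tt; apply: bd; split => //=; rewrite lexx lerDl.
  have Q0 : Q 0%N (P 0%N) <= 4 ^+ n * Q n (P n).
    elim: (n) => [|k IH]; first by rewrite expr0 mul1r.
    apply: (le_trans IH); rewrite exprSr -mulrA ler_pM2l ?exprn_gt0//.
    by have [_ _ _ _] := refP k.
  move: Q0; rewrite {1}/Q /= l0E m0E => /le_trans; apply.
  apply: (le_trans (ler_wpM2l _ Qn)); first by rewrite exprn_ge0.
  rewrite -mulrDl expr_div_n -exprM muln2 -addnn exprD -exprMn.
  rewrite (_ : (2 * 2 : R) = 4); last by ring.
  by rewrite mulrCA [4 ^+ n * _]mulrC divfK// expf_neq0.
apply/eqP; rewrite -[_ == 0]negbK -nc_gt0; apply/negP => Q0.
set S := (L + M) ^+ 2 in small.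
have S0 : 0 <= S by rewrite sqr_ge0.
(* This [e] turns the bound into the integral's modulus times S / (2 (S + 1)), a factor below 1 even
   when S = 0. *)
have := small (nc (rI h a0 (a0 + L) c0 (c0 + M)) / (8 * (S + 1))).
rewrite divr_gt0// ?mulr_gt0// ?ltr_wpDl// => /(_ isT).
set q := nc _ in Q0 *.
rewrite (_ : 4 * _ * S = q * (S / (2 * (S + 1)))); last first.
  by field; rewrite gt_eqF// ltr_wpDl.
rewrite leNgt => /negP; apply.
by rewrite gtr_pMr// ltr_pdivrMr ?mulr_gt0 ?ltr_wpDl//; lra.
Qed.

End Bisection.

Theorem goursat h a b c d : a <= b -> c <= d ->
  (forall z, in_rect a b c d z -> cdiff h z) -> rI h a b c d = 0.
Proof.
move=> ab cd hd; rewrite -[b](subrKC a) -[d](subrKC c).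
by apply: goursat_norm; rewrite ?subr_ge0// !subrKC.
Qed.

(** Two vertical and two horizontal cuts isolate the square of half side e about p. The other pieces
    contribute 0 by [goursat], and the square at most 4 K times its half perimeter 4 e, which tends
    to 0 with e. *)
Theorem goursat_except h a b c d (p : C) (K r : R) :
  a < complex.Re p < b -> c < complex.Im p < d -> 0 < r ->
  (forall z, in_rect a b c d z -> z != p -> cdiff h z) ->
  (forall z, nc (z - p) < r -> z != p -> nc (h z) <= K) ->
  rI h a b c d = 0.
Proof.
move=> /andP[ap pb] /andP[cp pd] r0 hd hK.
set x := complex.Re p in ap pb; set y := complex.Im p in cp pd.
have xE : complex.Re p = x by []. have yE : complex.Im p = y by [].
clearbody x y.
have small (e : R) : 0 < e -> a <= x - e -> x + e <= b -> c <= y - e -> y + e <= d ->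
   2 * e < r -> nc (rI h a b c d) <= 16 * (K * e).
  move=> e0 e1 e2 e3 e4 er.
  have ct z : in_rect a b c d z -> z != p -> ccont h z.
    by move=> z1 z2; apply: cdiff_cont; exact: hd.
  have nex s t : s != x -> Complex s t != p.
    by move=> sx; apply/eqP => E; move: sx; rewrite -?xE -?yE -E eqxx.
  have ney s t : t != y -> Complex s t != p.
    by move=> sx; apply/eqP => E; move: sx; rewrite -?xE -?yE -E eqxx.
  have xl : x - e < x by rewrite gtrBl.
  have xr : x < x + e by rewrite ltrDl.
  have yl : y - e < y by rewrite gtrBl.
  have yr : y < y + e by rewrite ltrDl.
  have ab : a <= b by rewrite (le_trans (le_trans e1 (ltW xl))) ?(le_trans (ltW xr)).
  have cd : c <= d by rewrite (le_trans (le_trans e3 (ltW yl))) ?(le_trans (ltW yr)).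
  have hor s t : a <= s <= b -> c <= t <= d -> t != y -> ccont h (Complex s t).
    by move=> ss tt ty; apply: ct => //; exact: ney.
  have ver s t : a <= s <= b -> c <= t <= d -> s != x -> ccont h (Complex s t).
    by move=> ss tt ty; apply: ct => //; exact: nex.
  have cy : c != y by rewrite lt_eqF// (le_lt_trans e3).
  have dy : d != y by rewrite gt_eqF// (lt_le_trans _ e4).
  have xe1 : x - e != x by rewrite lt_eqF.
  have xe2 : x + e != x by rewrite gt_eqF.
  have ye1 : y - e != y by rewrite lt_eqF.
  have ye2 : y + e != y by rewrite gt_eqF.
  have cc : c <= c <= d by rewrite lexx.
  have dd : c <= d <= d by rewrite lexx andbT.
  have xa : a <= x - e <= b by rewrite e1 (le_trans (ltW xl)) ?(le_trans (ltW xr)).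
  have xb : a <= x + e <= b by rewrite e2 (le_trans (le_trans e1 (ltW xl)) (ltW xr)).
  have yc : c <= y - e <= d by rewrite e3 (le_trans (ltW yl)) ?(le_trans (ltW yr)).
  have yd : c <= y + e <= d by rewrite e4 (le_trans (le_trans e3 (ltW yl)) (ltW yr)).
  have xxe : x - e <= x + e by rewrite (le_trans (ltW xl)) ?ltW.
  have yye : y - e <= y + e by rewrite (le_trans (ltW yl)) ?ltW.
  have inx s : x - e <= s <= x + e -> a <= s <= b.
    by move=> /andP[s1 s2]; rewrite (le_trans e1 s1) (le_trans s2 e2).
  have iny s : y - e <= s <= y + e -> c <= s <= d.
    by move=> /andP[s1 s2]; rewrite (le_trans e3 s1) (le_trans s2 e4).
  have off z : in_rect a b c d z ->
      [|| complex.Re z < x, x < complex.Re z, complex.Im z < y | y < complex.Im z] -> cdiff h z.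
    move=> zr zo; apply: hd => //; apply/eqP => zp; move: zo.
    by rewrite zp xE yE !ltxx.
  have -> : rI h a b c d = rI h (x - e) (x + e) (y - e) (y + e).
    rewrite (@rI_vsplit _ _ a (x - e)); [|by case/andP: xa|by case/andP: xa|
      by move=> s ss; exact: hor|by move=> s ss; exact: hor].
    rewrite (@rI_vsplit _ _ (x - e) (x + e) b) //; last 2 first.
      by move=> s /andP[s1 s2]; apply: hor; rewrite ?(le_trans e1 s1).
      by move=> s /andP[s1 s2]; apply: hor; rewrite ?(le_trans e1 s1).
    rewrite (@goursat _ a (x - e))//; last first.
      move=> z [/andP[z1 z2] z3]; apply: off; last by rewrite (le_lt_trans z2).
      by split; rewrite ?z1 ?(le_trans z2)//; case/andP: xa.
    rewrite (@goursat _ (x + e) b)//; last first.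
      move=> z [/andP[z1 z2] z3]; apply: off; last by rewrite (lt_le_trans xr z1) orbT.
      by split; rewrite ?z2 ?(le_trans _ z1)//; case/andP: xb.
    rewrite add0r addr0 (@rI_hsplit _ _ _ _ c (y - e) d); [|by case/andP: yc|by case/andP: yc|
      by move=> s ss; exact: ver|by move=> s ss; exact: ver].
    rewrite (@rI_hsplit _ _ _ _ (y - e) (y + e) d) //; last 2 first.
      by move=> s /andP[s1 s2]; apply: ver; rewrite ?(le_trans e3 s1).
      by move=> s /andP[s1 s2]; apply: ver; rewrite ?(le_trans e3 s1).
    rewrite (@goursat _ _ _ c (y - e))//; last first.
      move=> z [/inx z3 /andP[z1 z2]]; apply: off; last by rewrite (le_lt_trans z2 yl) ?orbT.
      by split; rewrite ?z1 ?(le_trans z2)//; case/andP: yc.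
    rewrite (@goursat _ _ _ (y + e) d)//; last first.
      move=> z [/inx z3 /andP[z1 z2]]; apply: off; last by rewrite (lt_le_trans yr z1) ?orbT.
      by split; rewrite ?z2 ?(le_trans _ z1)//; case/andP: yd.
    by rewrite add0r addr0.
  have xs s : x - e <= s <= x + e -> `|s - x| <= e by rewrite ler_distl.
  have ys s : y - e <= s <= y + e -> `|s - y| <= e by rewrite ler_distl.
  have bd s t : x - e <= s <= x + e -> y - e <= t <= y + e -> Complex s t != p ->
      nc (h (Complex s t)) <= K.
    move=> /xs s1 /ys t1; apply: hK; apply: (le_lt_trans (nc_le _)).
    rewrite cReD cImD cReN cImN/= xE yE (le_lt_trans (lerD s1 t1))//.
    by rewrite -mulr2n -mulr_natl.
  have -> : 16 * (K * e) = 4 * K * ((x + e - (x - e)) + (y + e - (y - e))) by ring.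
  have m1 : x - e <= x - e <= x + e by rewrite lexx.
  have m2 : x - e <= x + e <= x + e by rewrite lexx andbT.
  have m3 : y - e <= y - e <= y + e by rewrite lexx.
  have m4 : y - e <= y + e <= y + e by rewrite lexx andbT.
  apply: rI_norm => //.
  - split=> s ss; [apply: hor|apply: hor|apply: ver|apply: ver] => //;
      by [exact: inx|exact: iny].
  - by move=> s ss; apply: bd => //; exact: ney.
  - by move=> s ss; apply: bd => //; exact: ney.
  - by move=> s ss; apply: bd => //; exact: nex.
  - by move=> s ss; apply: bd => //; exact: nex.
apply/eqP; rewrite -[_ == 0]negbK -nc_gt0; apply/negP => Q0.
have K1 : 0 < `|K| + 1 by rewrite ltr_wpDl.
have [e e0 [e1 e2 e3 e4 [e5 e6]]] : exists2 e : R, 0 < e &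
    [/\ a <= x - e, x + e <= b, c <= y - e, y + e <= d &
     2 * e < r /\ 16 * (`|K| + 1) * e < nc (rI h a b c d)].
  have xa := ltW ap; have px : 0 < x - a by rewrite subr_gt0.
  have pb' : 0 < b - x by rewrite subr_gt0.
  have pc : 0 < y - c by rewrite subr_gt0.
  have pd' : 0 < d - y by rewrite subr_gt0.
  have near0 (u v : R) : 0 < u -> 0 < v -> \forall e \near 0^'+, u * e < v.
    move=> u0 v0; near=> e; rewrite mulrC -ltr_pdivlMr//.
    by near: e; apply: nbhs_right_lt; rewrite divr_gt0.
  have near1 (v : R) : 0 < v -> \forall e \near 0^'+, e <= v.
    by move=> v0; apply: nbhs_right_le.
  have K16 : 0 < 16 * (`|K| + 1) by rewrite mulr_gt0.
  near (0 : R)^'+ => e; exists e => //.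
  split; last split.
  - by rewrite lerBrDr -lerBrDl; near: e; exact: near1.
  - by rewrite -lerBrDl; near: e; exact: near1.
  - by rewrite lerBrDr -lerBrDl; near: e; exact: near1.
  - by rewrite -lerBrDl; near: e; exact: near1.
  - by near: e; exact: near0.
  - by near: e; exact: near0.
have := small e e0 e1 e2 e3 e4 e5.
apply/negP; rewrite -ltNge; apply: le_lt_trans e6.
by rewrite mulrA ler_pM2r// ler_pM2l// (le_trans (ler_norm K))// lerDl.
Unshelve. all: end_near. Qed.

End Goursat.

(** * Identity theorem on the slit plane *)

Section Identity.
Variable R : realType.
Local Notation C := R[i].
Local Notation mu := (@lebesgue_measure R).
Implicit Types (a b c d : R) (g h E : C -> C).

Lemma eq_rI g h a b c d : (forall w, g w = h w) -> rI g a b c d = rI h a b c d.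
Proof. by move=> /funext ->. Qed.

Definition square (w0 : C) (r : R) (z : C) :=
  in_rect (complex.Re w0 - r) (complex.Re w0 + r)
          (complex.Im w0 - r) (complex.Im w0 + r) z.

Definition on_sides (w0 : C) (r : R) (z : C) :=
  [\/ complex.Re z = complex.Re w0 - r, complex.Re z = complex.Re w0 + r,
      complex.Im z = complex.Im w0 - r | complex.Im z = complex.Im w0 + r].

Lemma on_sides_nc (w0 : C) (r : R) z : 0 < r -> on_sides w0 r z -> r <= nc (z - w0).
Proof.
move=> r0 [] h.
- apply: (le_trans _ (Re_le_nc _)); rewrite cReD cReN h.
  by rewrite addrAC subrr add0r normrN ler_norm.
- apply: (le_trans _ (Re_le_nc _)); rewrite cReD cReN h.
  by rewrite addrAC subrr add0r ler_norm.
- apply: (le_trans _ (Im_le_nc _)); rewrite cImD cImN h.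
  by rewrite addrAC subrr add0r normrN ler_norm.
- apply: (le_trans _ (Im_le_nc _)); rewrite cImD cImN h.
  by rewrite addrAC subrr add0r ler_norm.
Qed.

Lemma Rintegral_ge_cst a b (m : R) (f : R -> R) : a <= b ->
  {within `[a, b], continuous f} -> (forall t, a <= t <= b -> m <= f t) ->
  m * (b - a) <= \int[mu]_(t in `[a, b]) f t.
Proof.
move=> ab fc fm; have E : fine (mu `[a, b]) = b - a.
  rewrite lebesgue_measure_itv/= lte_fin; case: ltP => //= ba.
  by apply/esym/eqP; rewrite subr_eq0 eq_le ab ba.
rewrite -E -Rintegral_cst//; apply: le_Rintegral => //.
- apply: within_cont_integrable; apply: continuous_subspaceT => x.
  exact: cst_continuous.
- exact: within_cont_integrable.
Qed.

Lemma Rintegral_le_cst a b (m : R) (f : R -> R) : a <= b ->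
  {within `[a, b], continuous f} -> (forall t, a <= t <= b -> f t <= m) ->
  \int[mu]_(t in `[a, b]) f t <= m * (b - a).
Proof.
move=> ab fc fm; have E : fine (mu `[a, b]) = b - a.
  rewrite lebesgue_measure_itv/= lte_fin; case: ltP => //= ba.
  by apply/esym/eqP; rewrite subr_eq0 eq_le ab ba.
rewrite -E -Rintegral_cst//; apply: le_Rintegral => //.
- exact: within_cont_integrable.
- apply: within_cont_integrable; apply: continuous_subspaceT => x.
  exact: cst_continuous.
Qed.

(* The winding number integral need not be computed: its imaginary part is
   bounded below by the four sides. *)
Lemma rI_inv_ge (w0 : C) (r : R) : 0 < r ->
  4 <= complex.Im (rI (fun w => (w - w0)^-1)
    (complex.Re w0 - r) (complex.Re w0 + r) (complex.Im w0 - r) (complex.Im w0 + r)).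
Proof.
move=> r0; set x := complex.Re w0; set y := complex.Im w0.
have len (u : R) : (2 * r)^-1 * (u + r - (u - r)) = 1.
  rewrite (_ : u + r - (u - r) = 2 * r); last by ring.
  by rewrite mulVf// mulf_neq0// gt_eqF.
have le (u : R) : u - r <= u + r by rewrite lerD2l ge0_cp// ltW.
have sc : side_cont (fun w => (w - w0)^-1) (x - r) (x + r) (y - r) (y + r).
  have ct z : on_sides w0 r z -> ccont (fun w : C => (w - w0)^-1) z.
    move=> zs; apply: cdiff_cont; apply: cdiffV.
      by rewrite -nc_gt0 (lt_le_trans r0)// on_sides_nc.
    by apply: cdiffB; [exact: cdiff_id|exact: cdiff_cst].
  by split=> t _; apply: ct; [constructor 3|constructor 4|constructor 2|constructor 1].
have [[_ c1] [_ c2] [c3 _] [c4 _]] := side_ccon sc.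
have bnd (u v k : R) : u - r <= v <= u + r -> k = r ->
    (2 * r)^-1 <= k / ((v - u) ^+ 2 + r ^+ 2).
  move=> uv ->; have vu : (v - u) ^+ 2 <= r ^+ 2.
    rewrite -(real_normK (num_real (v - u))); apply: lerXn2r; rewrite ?nnegrE ?(ltW r0)//.
    by rewrite ler_norml; move: uv => /andP[uv1 uv2]; apply/andP; split; lra.
  rewrite ler_pdivlMr ?ltr_pwDr ?exprn_gt0 ?sqr_ge0//.
  rewrite ler_pdivrMl ?mulr_gt0//.
  have -> : 2 * r * r = r ^+ 2 + r ^+ 2 by rewrite expr2; ring.
  by rewrite lerD2r.
rewrite /rI !(cImD, cImN, cImM, cReD, cReN)/= mul0r mul1r add0r.
have i1 : 1 <= \int[mu]_(t in `[x - r, x + r])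
    complex.Im ((Complex t (y - r) - w0)^-1).
  rewrite -(len x); apply: Rintegral_ge_cst => // t tt.
  rewrite cImV nc_sqr !(cReD, cImD, cReN, cImN)/= -/x -/y.
  have -> : y - r - y = - r by ring.
  by rewrite mulNr opprK sqrrN; apply: bnd.
have i2 : 1 <= - \int[mu]_(t in `[x - r, x + r])
    complex.Im ((Complex t (y + r) - w0)^-1).
  rewrite lerNr (_ : - 1 = - (2 * r)^-1 * (x + r - (x - r))); last by rewrite mulNr len.
  apply: Rintegral_le_cst => // t tt.
  rewrite cImV nc_sqr !(cReD, cImD, cReN, cImN)/= -/x -/y.
  have -> : y + r - y = r by ring.
  by rewrite ?mulNr lerN2; apply: bnd.
have i3 : 1 <= \int[mu]_(t in `[y - r, y + r])
    complex.Re ((Complex (x + r) t - w0)^-1).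
  rewrite -(len y); apply: Rintegral_ge_cst => // t tt.
  rewrite cReV nc_sqr !(cReD, cImD, cReN, cImN)/= -/x -/y.
  have -> : x + r - x = r by ring.
  by rewrite addrC; apply: bnd.
have i4 : 1 <= - \int[mu]_(t in `[y - r, y + r])
    complex.Re ((Complex (x - r) t - w0)^-1).
  rewrite lerNr (_ : - 1 = - (2 * r)^-1 * (y + r - (y - r))); last by rewrite mulNr len.
  apply: Rintegral_le_cst => // t tt.
  rewrite cReV nc_sqr !(cReD, cImD, cReN, cImN)/= -/x -/y.
  have -> : x - r - x = - r by ring.
  by rewrite ?mulNr lerN2 sqrrN addrC; apply: bnd.
by move: i1 i2 i3 i4; move: (Rintegral _ _ _) (Rintegral _ _ _) (Rintegral _ _ _)
  (Rintegral _ _ _) => u1 u2 u3 u4; lra.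
Qed.

(** The quotient (g w - g w0) / (w - w0) is bounded near w0, so its boundary integral vanishes and g
    w0 times the winding integral equals the integral of g w / (w - w0). The first is at least 4 |g
    w0| in modulus by [rI_inv_ge], the second at most 16 M. *)
Lemma cauchy_bound g (w0 : C) (r M : R) : 0 < r ->
  (forall z, square w0 r z -> cdiff g z) ->
  (forall z, square w0 r z -> on_sides w0 r z -> nc (g z) <= M) ->
  nc (g w0) <= 4 * M.
Proof.
move=> r0 gd gM; set x := complex.Re w0; set y := complex.Im w0.
have le (u : R) : u - r <= u + r by rewrite lerD2l ge0_cp// ltW.
have lt (u : R) : u - r < u < u + r by rewrite gtrBl ltrDl r0.
have w0s : square w0 r w0 by split; apply/andP; split; rewrite ?gerBl ?lerDl ltW.
have idd z : z != w0 -> cdiff (fun w => (w - w0)^-1) z.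
  move=> zw; apply: cdiffV; first by rewrite subr_eq0.
  by apply: cdiffB; [exact: cdiff_id|exact: cdiff_cst].
have H0 : rI (fun w => (g w - g w0) * (w - w0)^-1) (x - r) (x + r) (y - r) (y + r) = 0.
  have [K [s s0 hs]] := cdiff_lip (gd _ w0s).
  apply: (goursat_except (p := w0) (K := K) (r := s)) => //.
    move=> z zr zw; apply: cdiffM (idd _ zw).
    by apply: cdiffB; [exact: gd|exact: cdiff_cst].
  move=> z zs zw; rewrite ncM ncV ler_pdivrMr ?nc_gt0 ?subr_eq0//; exact: hs.
have nsd z : on_sides w0 r z -> z != w0.
  by move=> /(on_sides_nc r0) zr; rewrite -subr_eq0 -nc_gt0 (lt_le_trans r0).
have sc f : (forall z, square w0 r z -> z != w0 -> cdiff f z) ->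
    side_cont f (x - r) (x + r) (y - r) (y + r).
  move=> hf; split=> t tt; apply: cdiff_cont; apply: hf;
    by [split => //=; rewrite lexx le | apply: nsd;
      by [constructor 3|constructor 4|constructor 2|constructor 1]].
have s1 : side_cont (fun w => g w * (w - w0)^-1) (x - r) (x + r) (y - r) (y + r).
  by apply: sc => z zs zw; apply: cdiffM (idd _ zw); exact: gd.
have s2 := sc _ (fun z _ => idd z).
have s3 : side_cont (fun w => g w0 * (w - w0)^-1) (x - r) (x + r) (y - r) (y + r).
  by apply: sc => z zs zw; apply: cdiffM (idd _ zw); exact: cdiff_cst.
have E : rI (fun w => g w * (w - w0)^-1) (x - r) (x + r) (y - r) (y + r) =
    g w0 * rI (fun w => (w - w0)^-1) (x - r) (x + r) (y - r) (y + r).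
  apply/eqP; rewrite -subr_eq0 -rIZ// -rIB// -[X in _ == X]H0; apply/eqP.
  by apply: eq_rI => w; rewrite mulrBl.
have J4 : 4 <= nc (rI (fun w => (w - w0)^-1) (x - r) (x + r) (y - r) (y + r)).
  apply: (le_trans (rI_inv_ge w0 r0)); rewrite -/x -/y.
  by apply: (le_trans (ler_norm _)); exact: Im_le_nc.
have bM z : square w0 r z -> on_sides w0 r z -> nc (g z * (z - w0)^-1) <= M / r.
  move=> z1 z2; rewrite ncM ncV; have zr := on_sides_nc r0 z2.
  apply: ler_pM; rewrite ?nc_ge0 ?invr_ge0 ?nc_ge0//; first exact: gM.
  by rewrite lef_pV2// posrE (lt_le_trans r0).
have : nc (rI (fun w => g w * (w - w0)^-1) (x - r) (x + r) (y - r) (y + r)) <=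
    4 * (M / r) * ((x + r - (x - r)) + (y + r - (y - r))).
  apply: rI_norm => // t tt; apply: bM;
    by [split => //=; rewrite lexx le |
      by [constructor 3|constructor 4|constructor 2|constructor 1]].
have -> : 4 * (M / r) * ((x + r - (x - r)) + (y + r - (y - r))) = 16 * M.
  by field; rewrite gt_eqF.
rewrite E ncM => h.
have : 4 * nc (g w0) <= 16 * M.
  by apply: le_trans h; rewrite mulrC ler_wpM2l ?nc_ge0.
by move: (nc (g w0)) => u; lra.
Qed.

Lemma ccon_bounded a b (phi : R -> C) : a <= b -> ccon a b phi ->
  exists B, forall t, a <= t <= b -> nc (phi t) <= B.
Proof.
move=> ab [h1 h2].
have K (f : R -> R) : {within `[a, b], continuous f} ->
    exists B, forall t, a <= t <= b -> `|f t| <= B.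
  move=> fc; have [u _ hu] := EVT_max ab fc; have [v _ hv] := EVT_min ab fc.
  exists (`|f u| + `|f v|) => t tt; rewrite ler_norml; apply/andP; split.
    rewrite lerNl; apply: (@le_trans _ _ (- f v)); first by rewrite lerN2 hv.
    by rewrite (le_trans (ler_norm _))// normrN lerDr.
  by rewrite (le_trans (hu _ _))// (le_trans (ler_norm _))// lerDl.
have [B1 k1] := K _ h1; have [B2 k2] := K _ h2.
by exists (B1 + B2) => t tt; rewrite (le_trans (nc_le _))// lerD ?k1 ?k2.
Qed.

Lemma sides_bounded g (w0 : C) (r : R) : 0 < r ->
  (forall z, square w0 r z -> ccont g z) ->
  exists B, forall z, square w0 r z -> on_sides w0 r z -> nc (g z) <= B.
Proof.
move=> r0 gc; set x := complex.Re w0; set y := complex.Im w0.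
have le (u : R) : u - r <= u + r by rewrite lerD2l ge0_cp// ltW.
have sc : side_cont g (x - r) (x + r) (y - r) (y + r) by apply: side_cont_rect.
have [c1 c2 c3 c4] := side_ccon sc.
have [B1 k1] := ccon_bounded (le _) c1; have [B2 k2] := ccon_bounded (le _) c2.
have [B3 k3] := ccon_bounded (le _) c3; have [B4 k4] := ccon_bounded (le _) c4.
exists (Num.max (Num.max B1 B2) (Num.max B3 B4)) => -[u v] [/= zs1 zs2] [] /= zE;
  rewrite !le_max zE.
- by rewrite (k4 _ zs2) !orbT.
- by rewrite (k3 _ zs2) !orbT.
- by rewrite (k1 _ zs1).
- by rewrite (k2 _ zs1) !orbT.
Qed.

Lemma geometric_le0 (x B k : R) : 0 <= k < 1 ->
  (forall N : nat, x <= B * k ^+ N) -> x <= 0.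
Proof.
move=> /andP[k0 k1] xN; have : (fun n => geometric B k n) @ \oo --> 0.
  by apply: cvg_geometric; rewrite ger0_norm.
move=> cv; rewrite -(cvg_lim _ cv)//; apply: limr_ge; first by apply/cvg_ex; exists 0.
by near=> n; exact: xN.
Unshelve. all: end_near. Qed.

(* E ((w0 - w1) / (w - w1)) ^ N is holomorphic because E vanishes near w1, takes
   the value E w0 at w0, and tends to 0 on the sides of the square. *)
Lemma identity_step E (w0 w1 : C) (r e : R) : 0 < r -> 0 < e ->
  (forall z, square w0 r z -> cdiff E z) ->
  (forall z, nc (z - w1) < e -> E z = 0) -> nc (w1 - w0) < r / 2 -> E w0 = 0.
Proof.
move=> r0 e0 Ed E0 w10; have [w01|w01] := eqVneq w0 w1.
  by apply: E0; rewrite w01 subrr nc0.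
set rho := nc (w1 - w0) in w10.
have [B hB] := sides_bounded r0 (fun z zs => cdiff_cont (Ed z zs)).
have rr : 0 < r - rho.
  have : r / 2 < r by rewrite gtr_pMr// invf_lt1// ltr1n.
  by move=> h; rewrite subr_gt0 (lt_trans w10).
pose k := rho / (r - rho).
have k01 : 0 <= k < 1.
  rewrite divr_ge0 ?nc_ge0 ?ltW//= ltr_pdivrMr// mul1r ltrBrDr -mulr2n -mulr_natr.
  by rewrite -ltr_pdivlMr.
apply/eqP; rewrite -[_ == 0]negbK -nc_gt0 -leNgt.
apply: (geometric_le0 (B := 4 * B) (k := k)) => // N.
pose g w := E w * ((w0 - w1) / (w - w1)) ^+ N.
have gw0 : g w0 = E w0 by rewrite /g divff ?subr_eq0// expr1n mulr1.
rewrite -gw0 -mulrA; apply: (cauchy_bound (r := r)) => //.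
- move=> z zs; have [->|zw] := eqVneq z w1.
    apply: (cdiff_near (f := fun=> 0) (r := e)) => //; last exact: cdiff_cst.
    by move=> w /E0 Ew; rewrite /g Ew mul0r.
  apply: cdiffM; first exact: Ed.
  apply: cdiffX; apply: cdiffM; first exact: cdiff_cst.
  apply: cdiffV; first by rewrite subr_eq0.
  by apply: cdiffB; [exact: cdiff_id|exact: cdiff_cst].
- move=> z z1 z2; rewrite /g ncM ncX.
  apply: ler_pM; rewrite ?nc_ge0 ?exprn_ge0 ?nc_ge0 ?hB//.
  have zr := on_sides_nc r0 z2; apply: lerXn2r; rewrite ?nnegrE ?nc_ge0//.
    by case/andP: k01.
  have zw : r - rho <= nc (z - w1).
    rewrite lerBlDr; apply: (le_trans zr); rewrite /rho.
    have -> : z - w0 = (z - w1) + (w1 - w0) by ring.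
    exact: ncD.
  rewrite ncM ncV nc_distC -/rho ler_wpM2l ?nc_ge0//.
  by rewrite lef_pV2// posrE (lt_le_trans rr).
Qed.

(** The square of half side r about such a point misses the half-line. *)
Definition clear_of (alpha r : R) (z : C) :=
  complex.Re z + r < alpha \/ r < `|complex.Im z|.

(** The slit plane is star-shaped about alpha - 1; the clearance has to be uniform along the segment
    for the chain of discs in [slit_identity]. *)
Lemma segment_clear (alpha : R) (w : C) : ~ on_halfline alpha w ->
  exists2 r : R, 0 < r & forall t : R, 0 <= t <= 1 ->
    clear_of alpha r ((alpha - 1)%:C%C + t%:C%C * (w - (alpha - 1)%:C%C)).
Proof.
case: w => u v nw.
have E t : (alpha - 1)%:C%C + t%:C%C * ((Complex u v) - (alpha - 1)%:C%C) =
    Complex (alpha - 1 + t * (u - alpha + 1)) (t * v).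
  by apply: complex_eq; rewrite /= ?(cReD, cImD, cReM, cImM, cReN, cImN)/=; ring.
have [ua|au] := ltP u alpha.
  exists (Num.min 1 (alpha - u) / 2); first by rewrite divr_gt0// lt_min ltr01 subr_gt0.
  set m := Num.min _ _; move=> t /andP[t0 t1]; rewrite E; left => /=.
  have m0 : 0 < m by rewrite lt_min ltr01 subr_gt0.
  have m1 : m <= 1 by rewrite ge_min lexx.
  have m2 : m <= alpha - u by rewrite ge_min lexx orbT.
  by nra.
have v0 : v != 0 by apply/eqP => v0; apply: nw; rewrite /on_halfline /= v0.
set L := u - alpha + 1.
have L0 : 1 <= L by rewrite /L; lra.
have L1 : 0 < L by lra.
have nv : 0 < `|v| by rewrite normr_gt0.
have d0 : 0 < `|v| / L by rewrite divr_gt0.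
exists (Num.min 1 (`|v| / L) / 4); first by rewrite divr_gt0// lt_min ltr01.
set m := Num.min _ _; move=> t /andP[t0 t1]; rewrite E /clear_of /= -/L.
have m0 : 0 < m by rewrite lt_min ltr01.
have m1 : m <= 1 by rewrite ge_min lexx.
have m2 : m * L <= `|v| by rewrite -ler_pdivlMr// ge_min lexx orbT.
(* The real part is alpha - 1 + t L. For t L <= 1/2 the point is at least 1/2 left of alpha;
   otherwise its height t |v| exceeds |v| / (2 L). Both beat m / 4. *)
have [tL|tL] := lerP (t * L) (1 / 2); [left|right]; first lra.
rewrite normrM (ger0_norm t0).
move: L L1 m m0 m2 tL nv {d0 m1 E v0 L0 au nw} => L L1 m m0 m2 tL nv.
rewrite -(ltr_pM2r L1); nra.
Qed.

(** Vanishing is carried from alpha - 1 to w through overlapping discs of radius r / 8 centred on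
    the segment. Points of neighbouring discs are closer than r / 4 to the previous centre, which is
    what [identity_step] asks of squares of half side r / 2. *)
Theorem slit_identity (alpha : R) E :
  (forall z, ~ on_halfline alpha z -> cdiff E z) ->
  (forall z, UHP z -> E z = 0) -> forall z, ~ on_halfline alpha z -> E z = 0.
Proof.
move=> Ed E0 w nw; have [r r0 hr] := segment_clear nw.
set x0 : C := (alpha - 1)%:C%C in hr.
pose p (t : R) : C := x0 + t%:C%C * (w - x0).
have r8 : 0 < r / 8 by rewrite divr_gt0.
have sq t z : 0 <= t <= 1 -> nc (z - p t) < r / 8 ->
    forall y, square z (r / 2) y -> cdiff E y.
  move=> tt zp y [/andP[y1 y2] /andP[y3 y4]]; apply: Ed => -[yI yR].
  have := Re_le_nc (z - p t); have := Im_le_nc (z - p t).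
  rewrite cReD cReN cImD cImN => i1 i2.
  have /ltr_normlP[j1 j2] := le_lt_trans i1 zp.
  have /ltr_normlP[j3 j4] := le_lt_trans i2 zp.
  have [hc|] := hr t tt; rewrite -/(p t); first by rewrite -/(p t) in hc; lra.
  by rewrite ltr_normr => /orP[] hc; lra.
have step t t' : 0 <= t' <= 1 -> nc (p t' - p t) < r / 8 ->
    (forall z, nc (z - p t) < r / 8 -> E z = 0) ->
    forall z, nc (z - p t') < r / 8 -> E z = 0.
  move=> tt' pp Et z zp; apply: (identity_step (r := r / 2) (w1 := p t) _ r8) => //.
  - by rewrite divr_gt0.
  - exact: (sq t').
  - have -> : p t - z = (p t - p t') + (p t' - z) by ring.
    by apply: (le_lt_trans (ncD _ _)); rewrite nc_distC [nc (_ - z)]nc_distC; lra.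
(* The disc of radius r / 16 about w1 = alpha - 1 + i r / 16 lies in the upper half-plane, where E
   is already 0. *)
have base z : nc (z - p 0) < r / 8 -> E z = 0.
  move=> zp; pose w1 : C := x0 + Complex 0 (r / 16).
  have p0 : p 0 = x0 by rewrite /p mul0r addr0.
  apply: (identity_step (r := r / 2) (w1 := w1) (e := r / 16)).
  - by rewrite divr_gt0.
  - by rewrite divr_gt0.
  - by apply: (sq 0) => //; rewrite lexx ler01.
  - move=> y yw; apply: E0; rewrite /UHP.
    have := Im_le_nc (y - w1) => /le_lt_trans/(_ yw).
    rewrite cImD cImN /w1 cImD /= add0r => /ltr_normlP[]; lra.
  - have -> : w1 - z = (w1 - p 0) + (p 0 - z) by ring.
    apply: (le_lt_trans (ncD _ _)).
    have : nc (w1 - p 0) <= r / 16.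
      rewrite p0 /w1 addrAC subrr add0r (le_trans (nc_le _))//= normr0 add0r.
      by rewrite ger0_norm// divr_ge0// ltW.
    by rewrite [nc (_ - z)]nc_distC; lra.
pose N := (Num.truncn (nc (w - x0) / (r / 8))).+1.
have hN : nc (w - x0) / N%:R < r / 8.
  by rewrite ltr_pdivrMr// mulrC -ltr_pdivrMr// truncnS_gt.
have all_k k : (k <= N)%N -> forall z, nc (z - p (k%:R / N%:R)) < r / 8 -> E z = 0.
  elim: k => [|k IH] kN; first by rewrite mul0r.
  apply: (step (k%:R / N%:R)); last by apply: IH; exact: ltnW.
    by rewrite divr_ge0//= ler_pdivrMr// mul1r ler_nat.
  have -> : p (k.+1%:R / N%:R) - p (k%:R / N%:R) = (N%:R^-1)%:C%C * (w - x0).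
    by rewrite /p -addn1 natrD mulrDl rmorphD/= mul1r; ring.
  rewrite ncM nc_real ger0_norm ?invr_ge0// mulrC//.
apply: (all_k N (leqnn N)).
by rewrite /p divff ?pnatr_eq0// rmorph1 mul1r subrKC subrr nc0.
Qed.

End Identity.

(** * Poisson formula on half-planes *)

Section FatouBound.
Context d (T : measurableType d) (R : realType).
Variable mu : {measure set T -> \bar R}.
Local Open Scope ereal_scope.

Lemma fatou_le (D : set T) (f_ : nat -> T -> \bar R) (f : T -> \bar R) (c : \bar R) :
  measurable D -> (forall n, measurable_fun D (f_ n)) ->
  (forall n x, D x -> 0 <= f_ n x) ->
  (forall x, D x -> f_ n x @[n --> \oo] --> f x) ->
  (\forall n \near \oo, \int[mu]_(x in D) f_ n x <= c) ->
  \int[mu]_(x in D) f x <= c.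
Proof.
move=> mD mf f0 ff fc.
have <- : \int[mu]_(x in D) limn_einf (f_ ^~ x) = \int[mu]_(x in D) f x.
  by apply: eq_integral => x /set_mem Dx; rewrite (cvg_limn_einf_sup (ff x Dx)).
apply: (le_trans (fatou mu mD mf f0)).
rewrite limn_einf_lim; apply: lime_le; first exact: is_cvg_einfs.
case: fc => N _ hN; near=> n.
apply: (@le_trans _ _ (\int[mu]_(x in D) f_ n x)).
  by apply: ereal_inf_lbound; exists n => //=.
by apply: hN => /=; near: n; exact: nbhs_infty_ge.
Unshelve. all: end_near. Qed.

End FatouBound.

Section Poisson.
Variable R : realType.
Local Notation C := R[i].
Local Notation mu := (@lebesgue_measure R).
Implicit Types (h F : C -> C).

Lemma path_continuous h (gam : R -> C) :
  (forall s t, nc (gam s - gam t) <= `|s - t|) ->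
  (forall t, ccont h (gam t)) ->
  continuous (fun t => complex.Re (h (gam t))) /\
  continuous (fun t => complex.Im (h (gam t))).
Proof.
move=> gl hc.
have K (t e : R) : 0 < e -> \forall s \near t, nc (h (gam s) - h (gam t)) < e.
  move=> /(hc t)[r r0 hr]; near=> s; apply: hr; apply: (le_lt_trans (gl _ _)).
  rewrite distrC; near: s; exact: (@cvgr_dist_lt _ _ _ (nbhs t) _ id).
split=> t; apply/cvgrPdist_lt => e e0; have := K t e e0; apply: filterS => s;
  apply: le_lt_trans.
  by rewrite distrC -cReN -cReD Re_le_nc.
by rewrite distrC -cImN -cImD Im_le_nc.
Unshelve. all: end_near. Qed.

(** Up to the factor y / pi this is the Poisson kernel of the upper half-plane at x + i y; y *
    [pker x y t] is the imaginary part of 1 / (t - (x + i y)). *)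
Definition pker (x y t : R) : R := ((t - x) ^+ 2 + y ^+ 2)^-1.

Lemma pker_den_gt0 (x y t : R) : 0 < y -> 0 < (t - x) ^+ 2 + y ^+ 2.
Proof. by move=> y0; rewrite ltr_wpDl ?sqr_ge0// exprn_gt0. Qed.

Lemma pker_gt0 (x y t : R) : 0 < y -> 0 < pker x y t.
Proof. by move=> y0; rewrite invr_gt0 pker_den_gt0. Qed.

Lemma pker_continuous (x y : R) : 0 < y -> continuous (pker x y).
Proof.
move=> y0 t; apply: cvgV; first by rewrite gt_eqF// pker_den_gt0.
apply: cvgD; last exact: cvg_cst.
by apply: cvgM; (apply: cvgB; [exact: cvg_id|exact: cvg_cst]).
Qed.

Lemma integral_pker (x y N : R) : 0 < y -> 0 < N ->
  \int[mu]_(t in `[x - N, x + N]) pker x y t = 2 / y * atan (N / y).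
Proof.
move=> y0 N0; pose G (t : R) := y^-1 * atan ((t - x) / y).
have dG (t : R) : is_derive t 1 G (pker x y t).
  have H : is_derive t 1 (fun t : R => (t - x) / y) y^-1.
    have -> : (fun t : R => (t - x) / y) = (fun t => y^-1 *: (t - x)).
      by apply/funext => u; rewrite mulrC.
    rewrite -[X in is_derive _ _ _ X]mulr1; apply: is_deriveZ.
    rewrite -[X in is_derive _ _ _ X]subr0; apply: is_deriveB.
  have H2 := @is_derive1_comp R atan (fun t : R => (t - x) / y) t _ _ (is_derive1_atan _) H.
  have -> : pker x y t = y^-1 *: ((1 + ((t - x) / y) ^+ 2)^-1 * y^-1).
    rewrite /pker /GRing.scale/=; field.
    have := pker_den_gt0 x t y0; rewrite addrC => h.
    by rewrite !gt_eqF.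
  exact: is_deriveZ.
have cG : continuous G.
  by move=> t; apply: differentiable_continuous; apply/derivable1_diffP; exact: ex_derive.
rewrite /Rintegral (@continuous_FTC2 _ (pker x y) G).
- rewrite -EFinB /= /G.
  have -> : x + N - x = N by ring.
  have -> : x - N - x = - N by ring.
  by rewrite mulNr atanN; field; rewrite gt_eqF.
- by rewrite (lt_trans (y := x)) ?gtrBl ?ltrDl.
- by apply: continuous_subspaceT; exact: pker_continuous.
- split; first by move=> t _; exact: ex_derive.
    by apply: cvg_at_right_filter; exact: cG.
  by apply: cvg_at_left_filter; exact: cG.
- by move=> t _; rewrite derive1E; exact: derive_val.
Qed.

(* The kernel is the difference of the Cauchy kernels of z = x + i(e+y) and of its
   reflection x + i(e-y), which lies outside the rectangle. *)
Lemma poisson_rect F (e B x y N : R) : 0 < e -> 0 < y -> 2 * y <= N ->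
  (forall z : C, e <= complex.Im z -> cdiff F z) ->
  (forall z : C, e <= complex.Im z -> nc (F z) <= B) ->
  `| \int[mu]_(t in `[x - N, x + N]) (complex.Im (F (Complex t e)) * pker x y t) -
     complex.Im (F (Complex x (e + y))) * \int[mu]_(t in `[x - N, x + N]) pker x y t |
  <= 64 * B / N.
Proof.
move=> e0 y0 yN Fd FB; pose z : C := Complex x (e + y).
pose z' : C := Complex x (e - y).
have N0 : 0 < N by apply: lt_le_trans yN; rewrite mulr_gt0.
have B0 : 0 <= B by apply: (le_trans (nc_ge0 (F z))); apply: FB; rewrite /= lerDl ltW.
have yN' : y < N by lra.
have le (u : R) : u - N <= u + N by rewrite lerD2l ge0_cp// ltW.
have eN : e <= e + N by rewrite lerDl ltW.
pose h (w : C) := (F w - F z) * ((w - z)^-1 * (w - z')^-1).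
have wz' w : e <= complex.Im w -> w != z'.
  by move=> ew; apply/eqP => wE; move: ew; rewrite wE /= leNgt gtrBl y0.
have idd u w : w != u -> cdiff (fun w => (w - u)^-1) w.
  move=> wu; apply: cdiffV; first by rewrite subr_eq0.
  by apply: cdiffB; [exact: cdiff_id|exact: cdiff_cst].
have hd w : e <= complex.Im w -> w != z -> cdiff h w.
  move=> ew wz; apply: cdiffM.
    by apply: cdiffB; [exact: Fd|exact: cdiff_cst].
  by apply: cdiffM; apply: idd => //; exact: wz'.
have ez : e <= complex.Im z by rewrite /= lerDl ltW.
(* The singularity at z is bounded: [cdiff_lip] bounds the difference quotient, and |w - z| < y
   forces |w - z'| > y because z and z' are 2 y apart. *)
have H0 : rI h (x - N) (x + N) e (e + N) = 0.
  have [K [s s0 hs]] := cdiff_lip (Fd z ez).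
  apply: (goursat_except (p := z) (K := `|K| * y^-1) (r := Num.min s y)) => //=.
  - by rewrite gtrBl ltrDl N0.
  - by rewrite ltrDl y0 ltrD2l.
  - by rewrite lt_min s0.
  - by move=> w [_ /andP[w1 _]]; exact: hd.
  - move=> w; rewrite lt_min => /andP[ws wy] wz.
    rewrite /h mulrA !ncM !ncV; apply: ler_pM; rewrite ?mulr_ge0 ?invr_ge0 ?nc_ge0//.
      rewrite ler_pdivrMr ?nc_gt0 ?subr_eq0// (le_trans (hs _ ws))//.
      by rewrite ler_wpM2r ?nc_ge0// ler_norm.
    rewrite lef_pV2 ?posrE//.
      have := nc_le_dist (z - z') (w - z'); rewrite (_ : z - z' - (w - z') = z - w); last by ring.
      rewrite nc_distC => h1; have : 2 * y <= nc (z - z').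
        apply: (le_trans _ (Im_le_nc _)); rewrite cImD cImN /=.
        by rewrite (_ : e + y - (e - y) = 2 * y) ?ler_norm//; ring.
      by rewrite [nc (z - z')]nc_distC; move: h1 wy; rewrite [nc (z - w)]nc_distC; lra.
    rewrite nc_gt0 subr_eq0; apply: wz'.
    have := Im_le_nc (w - z) => /le_lt_trans/(_ wy).
    by rewrite cImD cImN /= => /ltr_normlP[]; lra.
have sc : side_cont h (x - N) (x + N) e (e + N).
  split=> t /andP[t1 t2]; apply: cdiff_cont; apply: hd => //=; apply/eqP => -[]; lra.
(* As 2 y <= N, a point at distance N from x + i e is at distance at least N / 2 from both poles.
   The integrand is O(1 / N^2) on sides of length O(N), so the three remote sides are negligible. *)
have far w : e <= complex.Im w -> N <= nc (w - Complex x e) -> nc (h w) <= 8 * B / N ^+ 2.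
  move=> ew Nw; have K u : nc (Complex x e - u) = y -> nc (w - u)^-1 <= 2 / N.
    move=> uy; have : N / 2 <= nc (w - u).
      have := nc_le_dist (w - Complex x e) (w - u).
      rewrite (_ : w - Complex x e - (w - u) = - (Complex x e - u)); last by ring.
      by rewrite ncN uy; lra.
    move=> h1; have p1 : 0 < N / 2 by rewrite divr_gt0.
    by rewrite ncV -[2 / N]invrK invf_div lef_pV2// posrE (lt_le_trans p1).
  rewrite /h !ncM (_ : 8 * B / N ^+ 2 = (B + B) * (2 / N * (2 / N))); last first.
    by field; rewrite gt_eqF.
  have nzz (u : R) : nc (Complex x e - Complex x u) = `|e - u|.
    rewrite nc_sqrt !(cReD, cImD, cReN, cImN)/= subrr expr0n/= add0r.
    by rewrite sqrtr_sqr.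
  apply: ler_pM; rewrite ?mulr_ge0 ?nc_ge0//.
    by apply: (le_trans (ncB _ _)); apply: lerD; exact: FB.
  apply: ler_pM; rewrite ?nc_ge0//; apply: K; rewrite nzz.
    by rewrite opprD addrA subrr add0r normrN ger0_norm// ltW.
  by rewrite opprB addrC subrK ger0_norm// ltW.
have hbot t : complex.Im (h (Complex t e)) =
    complex.Im (F (Complex t e)) * pker x y t - complex.Im (F z) * pker x y t.
  have -> : h (Complex t e) = (F (Complex t e) - F z) * (pker x y t)%:C%C.
    rewrite /h /pker; congr (_ * _); rewrite (fmorphV (real_complex R)) -invfM; congr (_^-1).
    by apply: complex_eq; rewrite /= ?(cReD, cImD, cReM, cImM, cReN, cImN)/=; ring.
  by rewrite cImM cImD cImN /=; ring.
have IFc : continuous (fun t => complex.Im (F (Complex t e))).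
  have [] // := @path_continuous F (fun t => Complex t e).
    by move=> s t; exact: nc_hor.
  by move=> t; apply: cdiff_cont; apply: Fd; rewrite /=.
have I1 : mu.-integrable `[x - N, x + N]
    (EFin \o (fun t => complex.Im (F (Complex t e)) * pker x y t)).
  apply: within_cont_integrable; apply: continuous_subspaceT => t.
  by apply: cvgM; [exact: IFc|exact: pker_continuous].
have I2 : mu.-integrable `[x - N, x + N] (EFin \o pker x y).
  by apply: within_cont_integrable; apply: continuous_subspaceT; exact: pker_continuous.
rewrite -RintegralZl// -RintegralB//; last first.
  apply: within_cont_integrable; apply: continuous_subspaceT => t.
  by apply: cvgM; [exact: cvg_cst|exact: pker_continuous].
under eq_Rintegral do rewrite -hbot.
apply: (@le_trans _ _ (nc (cI (x - N) (x + N) (fun t => h (Complex t e))))).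
  exact: (Im_le_nc (cI (x - N) (x + N) (fun t => h (Complex t e)))).
have [_ c2 c3 c4] := side_ccon sc.
have M2 : forall t, x - N <= t <= x + N -> nc (h (Complex t (e + N))) <= 8 * B / N ^+ 2.
  move=> t _; apply: far => //; apply: (le_trans _ (Im_le_nc _)).
  by rewrite cImD cImN /= addrAC subrr add0r ger0_norm// ltW.
have M3 : forall t, e <= t <= e + N -> nc (h (Complex (x + N) t)) <= 8 * B / N ^+ 2.
  move=> t /andP[et _]; apply: far => //; apply: (le_trans _ (Re_le_nc _)).
  by rewrite cReD cReN /= addrAC subrr add0r ger0_norm// ltW.
have M4 : forall t, e <= t <= e + N -> nc (h (Complex (x - N) t)) <= 8 * B / N ^+ 2.
  move=> t /andP[et _]; apply: far => //; apply: (le_trans _ (Re_le_nc _)).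
  by rewrite cReD cReN /= addrAC subrr add0r normrN ger0_norm// ltW.
have b2 := cI_norm (le x) c2 M2; have b3 := cI_norm eN c3 M3; have b4 := cI_norm eN c4 M4.
have := H0; rewrite /rI => /eqP; rewrite addr_eq0 subr_eq => /eqP ->.
apply: (le_trans (ncD _ _)); rewrite ncN ncM nc_i mul1r.
apply: (le_trans (lerD (ncB _ _) (lexx _))).
apply: (le_trans (lerD (lerD b3 b4) b2)); rewrite le_eqVlt; apply/orP; left; apply/eqP.
by field; rewrite gt_eqF.
Qed.

(** [poisson_rect] as N tends to infinity: atan (N / y) tends to pi / 2, and the truncated integrals
    converge monotonically because Im F is nonnegative. *)
Lemma poisson F (e B x y : R) : 0 < e -> 0 < y ->
  (forall z : C, e <= complex.Im z -> cdiff F z) ->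
  (forall z : C, e <= complex.Im z -> nc (F z) <= B) ->
  (forall z : C, e <= complex.Im z -> 0 <= complex.Im (F z)) ->
  (\int[mu]_t (complex.Im (F (Complex t e)) * (y * pker x y t))%:E =
   (pi * complex.Im (F (Complex x (e + y))))%:E)%E.
Proof.
move=> e0 y0 Fd FB F0; set v := complex.Im (F _).
pose phi t := complex.Im (F (Complex t e)) * pker x y t.
have IFc : continuous (fun t => complex.Im (F (Complex t e))).
  have [] // := @path_continuous F (fun t => Complex t e).
    by move=> s t; exact: nc_hor.
  by move=> t; apply: cdiff_cont; apply: Fd; rewrite /=.
have phic : continuous phi.
  by move=> t; apply: cvgM; [exact: IFc|exact: pker_continuous].
have phi0 t : 0 <= phi t by rewrite mulr_ge0 ?F0//= ltW// pker_gt0.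
have mphi : measurable_fun setT (EFin \o phi).
  by apply/measurable_EFinP; exact: continuous_measurable_fun.
pose A (n : nat) : set (measurableTypeR R) := `[x - n%:R, x + n%:R]%classic.
have cvgA : (\int[mu]_(t in A n) (phi t)%:E)%E @[n --> \oo] -->
    (\int[mu]_(t in \bigcup_n A n) (phi t)%:E)%E.
  apply: ge0_nondecreasing_set_cvg_integral => //.
  - move=> m n mn; rewrite subsetEset; apply: subset_itv; rewrite bnd_simp.
      by rewrite lerD2l lerN2 ler_nat.
    by rewrite lerD2l ler_nat.
  - by move=> n; exact: measurable_itv.
  - by move=> n; apply: measurable_funS mphi.
  - by move=> n t _; rewrite lee_fin.
have AT : \bigcup_n A n = setT.
  rewrite -subTset => t _; exists (Num.truncn `|t - x|).+1 => //=.
  by rewrite /A/= in_itv/= -ler_distl ltW// truncnS_gt.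
rewrite AT in cvgA.
have cvgR : (\int[mu]_(t in A n) phi t) @[n --> \oo] --> pi / y * v.
  have K1 : (v * (2 / y * atan (n%:R / y))) @[n --> \oo] --> pi / y * v.
    rewrite (_ : pi / y * v = v * (2 / y * (pi / 2))); last by field; rewrite gt_eqF.
    apply: cvgM; first exact: cvg_cst.
    apply: cvgM; first exact: cvg_cst.
    apply: (cvg_comp (fun n : nat => n%:R / y) atan); last exact: cvgy_atan.
    apply/cvgryPge => M; near=> n; rewrite ler_pdivlMr//.
    by near: n; exact: nbhs_infty_ger.
  have K2 : (64 * B / n%:R) @[n --> \oo] --> (0 : R).
    rewrite -[X in _ --> X](mulr0 (64 * B)); apply: cvgM; first exact: cvg_cst.
    apply/gtr0_cvgV0; first by near=> n; rewrite ltr0n; near: n; exact: nbhs_infty_gt.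
    exact: cvgr_idn.
  have K3 : (\int[mu]_(t in A n) phi t - v * (2 / y * atan (n%:R / y)))
      @[n --> \oo] --> (0 : R).
    apply/cvgrPdist_le => d d0; near=> n; rewrite sub0r normrN.
    have n0 : 0 < n%:R :> R by rewrite ltr0n; near: n; exact: nbhs_infty_gt.
    rewrite -(@integral_pker x)//; apply: (le_trans (poisson_rect _ e0 y0 _ Fd FB)).
      by near: n; exact: nbhs_infty_ger.
    rewrite (le_trans (ler_norm _))//; near: n.
    by move/cvgrPdist_le : K2 => /(_ d d0); apply: filterS => n; rewrite sub0r normrN.
  have -> : (fun n => \int[mu]_(t in A n) phi t) = (fun n =>
      (\int[mu]_(t in A n) phi t - v * (2 / y * atan (n%:R / y))) +
      v * (2 / y * atan (n%:R / y))) by apply/funext => n; rewrite subrK.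
  by rewrite -[X in _ --> X]add0r; exact: (cvgD K3 K1).
have E : (\int[mu]_t (phi t)%:E)%E = (pi / y * v)%:E.
  apply: (cvg_unique _ cvgA); first exact: ereal_hausdorff.
  have -> : (fun n => \int[mu]_(t in A n) (phi t)%:E)%E =
      (fun n => (\int[mu]_(t in A n) phi t)%:E).
    apply/funext => n; rewrite /Rintegral fineK//.
    apply: integrable_fin_num => //=; first exact: measurable_itv.
    by apply: within_cont_integrable; apply: continuous_subspaceT.
  by apply: cvg_EFin; [near=> n|exact: cvgR].
have -> : pi * v = y * (pi / y * v) by field; rewrite gt_eqF.
rewrite EFinM -E -ge0_integralZl//; last 2 first.
  by move=> t _; rewrite lee_fin.
  by rewrite lee_fin ltW.
by apply: eq_integral => t _; rewrite -EFinM /phi mulrCA.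
Unshelve. all: end_near. Qed.

(** The Poisson formula at i (e + y), multiplied by y, with y tending to infinity: y^2 *
    [pker 0 y t] tends to 1 and y Im F(i (e + y)) <= c, so Fatou's lemma bounds the whole
    integral. *)
Lemma nevanlinna_mass F (e c : R) : 0 < e -> 0 <= c ->
  (forall z : C, UHP z -> cdiff F z) ->
  (forall z : C, UHP z -> nc (F z) * complex.Im z <= c) ->
  (forall z : C, UHP z -> 0 <= complex.Im (F z)) ->
  (\int[mu]_t (complex.Im (F (Complex t e)))%:E <= (pi * c)%:E)%E.
Proof.
move=> e0 c0 Fd Fc F0.
have Uz (z : C) : e <= complex.Im z -> UHP z by apply: lt_le_trans.
have FB (z : C) : e <= complex.Im z -> nc (F z) <= c / e.
  move=> ez; rewrite ler_pdivlMr// (le_trans _ (Fc z (Uz z ez)))//.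
  by rewrite ler_wpM2l ?nc_ge0.
have IFc : continuous (fun t => complex.Im (F (Complex t e))).
  have [] // := @path_continuous F (fun t => Complex t e).
    by move=> s t; exact: nc_hor.
  by move=> t; apply: cdiff_cont; apply: Fd; rewrite /UHP/=.
pose f_ (n : nat) (t : R) := complex.Im (F (Complex t e)) *
  (n.+1%:R * (n.+1%:R * pker 0 n.+1%:R t)).
apply: (@fatou_le _ _ _ mu setT (fun n t => (f_ n t)%:E)) => //.
- move=> n; apply/measurable_EFinP; apply: continuous_measurable_fun => t.
  apply: cvgM; first exact: IFc.
  do 2 (apply: cvgM; first exact: cvg_cst); exact: pker_continuous.
- move=> n t _; rewrite lee_fin mulr_ge0 ?F0 ?/UHP//=.
  by rewrite !mulr_ge0// ltW// pker_gt0.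
- move=> t _; apply: cvg_EFin; first by near=> n.
  rewrite -[X in _ --> X]mulr1; apply: cvgM; first exact: cvg_cst.
  have -> : (fun n : nat => n.+1%:R * (n.+1%:R * pker 0 n.+1%:R t)) =
      (fun n => (t ^+ 2 * (n.+1%:R^-1 * n.+1%:R^-1) + 1)^-1).
    apply/funext => n; rewrite /pker subr0.
    have k0 : 0 < n.+1%:R :> R by [].
    move: (n.+1%:R) k0 => k k0; field.
    by rewrite (gt_eqF k0) gt_eqF// ltr_wpDl ?sqr_ge0// ?mulr_gt0 ?exprn_gt0.
  rewrite -[X in _ --> X]invr1; apply: cvgV => //.
  rewrite -[X in _ --> X]add0r; apply: cvgD; last exact: cvg_cst.
  rewrite -[X in _ --> X](mulr0 (t ^+ 2)); apply: cvgM; first exact: cvg_cst.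
  by rewrite -[X in _ --> X](mulr0 0); apply: cvgM; exact: cvg_harmonic.
- near=> n; have n0 : 0 < n.+1%:R :> R by [].
  under eq_integral do rewrite /f_ mulrCA EFinM.
  rewrite ge0_integralZl//; last 2 first.
  + apply/measurable_EFinP; apply: continuous_measurable_fun => t.
    by apply: cvgM; [exact: IFc|apply: cvgM; [exact: cvg_cst|exact: pker_continuous]].
  + move=> t _; rewrite lee_fin mulr_ge0 ?F0 ?/UHP//=.
    by rewrite !mulr_ge0// ltW// pker_gt0.
  rewrite (poisson (B := c / e) _ e0 n0) //; last 2 first.
  + by move=> z ez; apply: Fd; exact: Uz.
  + by move=> z ez; apply: F0; exact: Uz.
  rewrite -EFinM lee_fin mulrCA ler_wpM2l ?pi_ge0//.
  set z : C := Complex _ _; have zU : UHP z by rewrite /UHP /= addr_gt0.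
  apply: le_trans (Fc z zU); rewrite mulrC.
  apply: ler_pM => //; first exact: F0.
    by apply: (le_trans (ler_norm _)); exact: Im_le_nc.
  by rewrite /= lerDr ltW.
Unshelve. all: end_near. Qed.

End Poisson.

(** * Stieltjes inversion *)

Section StepApproximation.
Context d (T : measurableType d) (R : realType).
Variable m : {measure set T -> \bar R}.
Variables (p phi : T -> R) (eps : R).
Hypothesis p0 : forall t, 0 <= p t.
Hypothesis ip : m.-integrable setT (EFin \o p).
Hypothesis ipp : m.-integrable setT (EFin \o (fun t => phi t * p t)).

Lemma weighted_mean_approx (D : set T) (v : R) : measurable D ->
  (forall t, D t -> `|phi t - v| <= eps) ->
  `|\int[m]_(t in D) (phi t * p t) - v * \int[m]_(t in D) p t|
    <= eps * \int[m]_(t in D) p t.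
Proof.
move=> mD hD; have sub f : m.-integrable setT (EFin \o f) -> m.-integrable D (EFin \o f).
  by apply: integrableS.
have ivp : m.-integrable D (EFin \o (fun t => v * p t)).
  by have := integrableZl mD v (sub _ ip); apply: eq_integrable.
have iep : m.-integrable D (EFin \o (fun t => eps * p t)).
  by have := integrableZl mD eps (sub _ ip); apply: eq_integrable.
have idf : m.-integrable D (EFin \o (fun t => phi t * p t - v * p t)).
  by have := integrableB mD (sub _ ipp) ivp; apply: eq_integrable.
have E1 : \int[m]_(t in D) (v * p t) = v * \int[m]_(t in D) p t.
  by rewrite RintegralZl// sub.
have E2 : \int[m]_(t in D) (eps * p t) = eps * \int[m]_(t in D) p t.
  by rewrite RintegralZl// sub.
rewrite -E1 -E2 -(RintegralB mD (sub _ ipp) ivp).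
apply: (le_trans (le_normr_Rintegral mD idf)); apply: le_Rintegral => //.
  exact: integrable_norm idf.
by move=> t Dt; rewrite -mulrBl normrM (ger0_norm (p0 t)) ler_wpM2r// hD.
Qed.

(** The weight [p] lets one estimate serve two measures: the limit measure with weight 1, and
    Lebesgue measure with weight [dens F e]. The sets [B n] collect the cells [A 0], ...,
    [A (n - 1)]; outside [B N] the function is already small. *)
Lemma step_approx (N : nat) (A B : nat -> set T) (v : nat -> R) :
  (forall k, measurable (A k)) -> (forall k, measurable (B k)) ->
  B 0%N = set0 -> (forall k, B k.+1 = B k `|` A k) ->
  (forall k, [disjoint B k & A k]) ->
  (forall k t, (k < N)%N -> A k t -> `|phi t - v k| <= eps) ->
  (forall t, ~ B N t -> `|phi t| <= eps) ->
  `|\int[m]_t (phi t * p t) - \sum_(k < N) v k * \int[m]_(t in A k) p t|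
    <= eps * \int[m]_t p t.
Proof.
move=> mA mB B0 BS dBA hA hB.
have sub D f : measurable D -> m.-integrable setT (EFin \o f) -> m.-integrable D (EFin \o f).
  by move=> mD; apply: integrableS.
have split D E f : measurable D -> measurable E -> [disjoint D & E] ->
    m.-integrable setT (EFin \o f) ->
    \int[m]_(t in D `|` E) f t = \int[m]_(t in D) f t + \int[m]_(t in E) f t.
  by move=> mD mE dDE fi; apply: Rintegral_setU => //; apply: sub => //; exact: measurableU.
have step n : (n <= N)%N ->
    `|\int[m]_(t in B n) (phi t * p t) - \sum_(k < n) v k * \int[m]_(t in A k) p t|
      <= eps * \int[m]_(t in B n) p t.
  elim: n => [|n IH] nN.
    by rewrite B0 !Rintegral_set0 big_ord0 subr0 normr0 mulr0.
  rewrite BS !split// big_ord_recr/= mulrDr.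
  rewrite opprD addrACA; apply: (le_trans (ler_normD _ _)); apply: lerD.
    by apply: IH; exact: ltnW.
  by apply: weighted_mean_approx => // t; exact: hA.
have dB : [disjoint B N & ~` B N] by apply/disj_setPS; rewrite setICr.
have mC : measurable (~` B N) by exact: measurableC.
have wm : `|\int[m]_(t in ~` B N) (phi t * p t)| <= eps * \int[m]_(t in ~` B N) p t.
  rewrite -[X in `|X|]subr0 -(mul0r (\int[m]_(t in ~` B N) p t)).
  by apply: weighted_mean_approx => // t Bt; rewrite subr0 hB.
rewrite -(setUv (B N)) !split// mulrDr addrAC.
by apply: (le_trans (ler_normD _ _)); apply: lerD => //; exact: step.
Qed.

End StepApproximation.

(** Summation by parts. It will be applied to the jumps D k = [gplus] - [glim] at the partition
    points, which need not be small one by one but have total at most c, while v varies by at most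
    eps from one point to the next. *)
Lemma abel_jump_bound (R : realType) (eps c : R) (N : nat) (v D : nat -> R) :
  (forall k, 0 <= D k) -> \sum_(k < N.+1) D k <= c -> 0 <= eps ->
  `|v 0%N| <= eps -> `|v N| <= eps -> (forall k, (k < N)%N -> `|v k.+1 - v k| <= eps) ->
  `|\sum_(k < N) v k * (D k.+1 - D k)| <= 3 * (eps * c).
Proof.
move=> D0 Dc e0 v0 vN vS.
have parts n : \sum_(k < n) v k * (D k.+1 - D k) =
    v n * D n - v 0%N * D 0%N - \sum_(k < n) (v k.+1 - v k) * D k.+1.
  elim: n => [|n IH]; first by rewrite !big_ord0 subrr subr0.
  by rewrite !big_ord_recr/= IH; ring.
have sumS n : (n <= N)%N -> \sum_(k < n) D k.+1 <= c.
  move=> nN; apply: le_trans Dc.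
  rewrite big_ord_recl/= -[leLHS]add0r; apply: lerD => //.
  rewrite -(subnKC nN) big_split_ord/= lerDl; exact: sumr_ge0.
have Dk k : (k <= N)%N -> D k <= c.
  move=> kN; apply: le_trans Dc; rewrite (bigD1 (Ordinal (kN : (k < N.+1)%N)))//= lerDl.
  exact: sumr_ge0.
have b1 k (u : R) : (k <= N)%N -> `|u| <= eps -> `|u * D k| <= eps * c.
  by move=> kN ue; rewrite normrM ler_pM// ger0_norm// Dk.
rewrite parts.
have H3 : `|\sum_(k < N) (v k.+1 - v k) * D k.+1| <= eps * c.
  apply: (le_trans (ler_norm_sum _ _ _)).
  apply: (@le_trans _ _ (\sum_(k < N) eps * D k.+1)).
    by apply: ler_sum => k _; rewrite normrM (ger0_norm (D0 _)) ler_wpM2r// vS.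
  by rewrite -mulr_sumr ler_wpM2l// sumS.
apply: (le_trans (ler_normB _ _)).
have H12 : `|v N * D N - v 0%N * D 0%N| <= eps * c + eps * c.
  by apply: (le_trans (ler_normB _ _)); apply: lerD; exact: b1.
apply: (le_trans (lerD H12 H3)); rewrite le_eqVlt; apply/orP; left; apply/eqP; ring.
Qed.

(** * Limits along an ultrafilter finer than e -> 0+ *)

Section Ultralimit.
Variable R : realType.

Lemma ultra0_exists : exists U : set_system R, UltraFilter U /\ (0 : R)^'+ `<=` U.
Proof. exact: ultraFilterLemma. Qed.

(* Along [ultra0] every bounded family indexed by small e > 0 converges, which
   replaces Helly's selection theorem. *)
Definition ultra0 : set_system R := sval (cid ultra0_exists).

Lemma ultra0P : UltraFilter ultra0 /\ (0 : R)^'+ `<=` ultra0.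
Proof. exact: (svalP (cid ultra0_exists)). Qed.

Lemma ultra0_ultra : UltraFilter ultra0.
Proof. by have [] := ultra0P. Qed.

Instance ultra0_proper : ProperFilter ultra0.
Proof. exact: (@ultra_proper _ _ ultra0_ultra). Qed.

Lemma ultra0_gt0 : \forall e \near ultra0, 0 < e.
Proof. by have [_] := ultra0P; apply; exact: nbhs_right_gt. Qed.

Lemma ultra0_bounded_cvg (f : R -> R) (M : R) :
  (forall e, 0 < e -> `|f e| <= M) -> cvg (f @ ultra0).
Proof.
move=> fM; have fin : (f @ ultra0) `[- M, M]%classic.
  rewrite /fmap/=; have := ultra0_gt0; apply: filterS => e /fM.
  by rewrite /= in_itv/= ler_norml.
have := @segment_compact R (- M) M (f @ ultra0) _ fin.
move=> [l [_ cl]]; apply/cvg_ex; exists l => B Bl.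
have [//|UnB] := in_ultra_setVsetC (f @^-1` B) ultra0_ultra.
have [y [yB1 yB2]] := cl (~` B) B UnB Bl.
by case: yB1.
Qed.

Lemma ultra0_cvg_sub (f : R -> R) (l : R) :
  f @ (0 : R)^'+ --> l -> f @ ultra0 --> l.
Proof. by move=> fl B /fl h; have [_] := ultra0P; apply. Qed.

End Ultralimit.

#[global] Existing Instance ultra0_proper.

(** * The limiting distribution function *)

Section Helly.
Variable R : realType.
Local Notation C := R[i].
Local Notation mu := (@lebesgue_measure R).
Implicit Types (F : C -> C) (c e x : R).

(** The set function is repacked as a measure for the measurable structure of R that
    [cmeasure_integral] refers to. *)
Lemma lebesgue_stieltjes_exists (G : R -> R) : nondecreasing G ->
  right_continuous G -> exists s : {measure set R -> \bar R},
    forall a b, a <= b -> s `]a, b]%classic = (G b - G a)%:E.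
Proof.
move=> Gnd Grc.
pose H : cumulative R R := HB.pack_for (cumulative R R) G
  (@isCumulative.Build R _ R G Gnd Grc).
pose L : set R -> \bar R := fun A => lebesgue_stieltjes_measure H A.
have L0 : L set0 = 0%E by exact: (measure0 (lebesgue_stieltjes_measure H)).
have Lge0 A : (0 <= L A)%E by exact: (measure_ge0 (lebesgue_stieltjes_measure H)).
have Ls : semi_sigma_additive L.
  exact: (@measure_semi_sigma_additive _ _ _ (lebesgue_stieltjes_measure H)).
pose s : {measure set R -> \bar R} := HB.pack_for {measure set R -> \bar R} L
  (@isMeasure.Build _ _ _ L L0 Lge0 Ls).
exists s => a b ab; rewrite -[LHS]/(lebesgue_stieltjes_measure H `]a, b]%classic).
rewrite /lebesgue_stieltjes_measure /measure_extension measurable_mu_extE; last exact: is_ocitv.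
exact: (wlength_itv_bnd H false false ab).
Qed.

Definition nevanlinna c F := [/\ 0 <= c, forall z, UHP z -> cdiff F z,
  forall z, UHP z -> nc (F z) * complex.Im z <= c &
  forall z, UHP z -> 0 <= complex.Im (F z)].

Definition dens F e (t : R) : R := complex.Im (F (Complex t e)) / pi.
Definition gdist F e x : R := \int[mu]_(t in `]-oo, x]) dens F e t.
(** The ultrafilter is the same for all F and x; this is what lets linear relations between several
    functions pass to the limit. *)
Definition glim F x : R := lim ((fun e => gdist F e x) @ (@ultra0 R)).
(** An ultralimit of distribution functions is monotone but may fail to be right-continuous, as a
    Stieltjes measure requires; right limits repair this. *)
Definition gplus F x : R := lim (glim F @ x^'+).

Section Inversion.
Variables (F : C -> C) (c : R).
Hypothesis nF : nevanlinna c F.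

Let c0 : 0 <= c. Proof. by case: nF. Qed.

Lemma dens_ge0 e t : 0 < e -> 0 <= dens F e t.
Proof. by case: nF => _ _ _ F0 e0; rewrite divr_ge0 ?pi_ge0// F0. Qed.

Lemma dens_continuous e : 0 < e -> continuous (dens F e).
Proof.
case: nF => _ Fd _ _ e0; have [_ IFc] := @path_continuous R F (fun t => Complex t e)
  (fun s t => nc_hor e s t) (fun t => cdiff_cont (Fd (Complex t e) e0)).
by move=> t; apply: cvgM; [exact: IFc|exact: cvg_cst].
Qed.

Lemma dens_measurable e : 0 < e -> measurable_fun [set: measurableTypeR R] (dens F e).
Proof. by move=> e0; exact: continuous_measurable_fun (dens_continuous e0). Qed.

Lemma dens_mass e : 0 < e -> (\int[mu]_t (dens F e t)%:E <= c%:E)%E.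
Proof.
move=> e0; case: nF => _ Fd Fc F0; have := nevanlinna_mass e0 c0 Fd Fc F0.
rewrite (_ : c%:E = ((pi^-1)%:E * (pi * c)%:E)%E); last first.
  by rewrite -EFinM mulrA mulVf ?mul1r// gt_eqF// pi_gt0.
have [_ IFc] := @path_continuous R F (fun t => Complex t e)
  (fun s t => nc_hor e s t) (fun t => cdiff_cont (Fd (Complex t e) e0)).
under [leLHS in _ -> (leLHS <= _)%E]eq_integral do rewrite /dens mulrC EFinM.
rewrite ge0_integralZl//.
- by move=> h; apply: lee_pmul => //; rewrite ?lee_fin ?invr_ge0 ?pi_ge0//;
    apply: integral_ge0 => t _; rewrite lee_fin F0.
- by apply/measurable_EFinP; exact: continuous_measurable_fun.
- by move=> t _; rewrite lee_fin F0.
- by rewrite lee_fin invr_ge0 pi_ge0.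
Qed.

Lemma dens_integrable e : 0 < e -> mu.-integrable setT (EFin \o dens F e).
Proof.
move=> e0; apply/integrableP; split; first by apply/measurable_EFinP; exact: dens_measurable.
rewrite (_ : (\int[mu]_x _)%E = (\int[mu]_t (dens F e t)%:E)%E); last first.
  by apply: eq_integral => t _; rewrite /= ger0_norm// dens_ge0.
by apply: (le_lt_trans (dens_mass e0)); rewrite ltry.
Qed.

Lemma dens_Rmass e : 0 < e -> 0 <= \int[mu]_t dens F e t <= c.
Proof.
move=> e0; apply/andP; split; first by apply: Rintegral_ge0 => t _; exact: dens_ge0.
rewrite -lee_fin /Rintegral fineK; first exact: dens_mass.
exact: integrable_fin_num (dens_integrable e0).
Qed.

Lemma gdist_incr e a b : 0 < e -> a <= b ->
  \int[mu]_(t in `]a, b]) dens F e t = gdist F e b - gdist F e a.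
Proof.
move=> e0 ab; rewrite /gdist -(@Rintegral_itvB _ _ -oo%O (BRight b) a) ?bnd_simp//.
by apply: (integrableS _ _ _ (dens_integrable e0)).
Qed.

Lemma gdist_bounds e x : 0 < e -> 0 <= gdist F e x <= c.
Proof.
move=> e0; have /andP[_ hc] := dens_Rmass e0.
apply/andP; split; first by apply: Rintegral_ge0 => t _; exact: dens_ge0.
apply: le_trans hc; rewrite /gdist Rintegral_mkcond.
apply: le_Rintegral => //; last 2 first.
- exact: dens_integrable.
- by move=> t _; rewrite patchE; case: ifP => // _; exact: dens_ge0.
rewrite -restrict_EFin; apply/integrable_restrict => //.
by rewrite setTI; apply: (integrableS _ _ _ (dens_integrable e0)).
Qed.

Lemma gdist_nd e a b : 0 < e -> a <= b -> gdist F e a <= gdist F e b.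
Proof.
move=> e0 ab; rewrite -subr_ge0 -gdist_incr//.
by apply: Rintegral_ge0 => t _; exact: dens_ge0.
Qed.

Lemma glim_cvg x : (fun e => gdist F e x) @ (@ultra0 R) --> glim F x.
Proof.
apply: (@ultra0_bounded_cvg R _ c) => e e0.
by have /andP[h1 h2] := gdist_bounds x e0; rewrite ger0_norm.
Qed.

Lemma glim_nd : nondecreasing (glim F).
Proof.
move=> a b ab; have ha := @glim_cvg a; have hb := @glim_cvg b.
apply: (ler_cvg_to ha hb).
by have := @ultra0_gt0 R; apply: filterS => e e0; exact: gdist_nd.
Qed.

Lemma glim_bounds x : 0 <= glim F x <= c.
Proof.
have hx := @glim_cvg x; apply/andP; split.
  have h0 : (fun=> 0 : R) @ (@ultra0 R) --> (0 : R) by exact: cvg_cst.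
  apply: (ler_cvg_to h0 hx).
  by have := @ultra0_gt0 R; apply: filterS => e /(gdist_bounds x)/andP[].
have hc : (fun=> c) @ (@ultra0 R) --> c by exact: cvg_cst.
apply: (ler_cvg_to hx hc).
by have := @ultra0_gt0 R; apply: filterS => e /(gdist_bounds x)/andP[].
Qed.

Lemma gplus_cvg x : glim F @ x^'+ --> gplus F x.
Proof.
apply: nondecreasing_at_right_is_cvgr.
  by near=> y => u v _ _; exact: glim_nd.
near=> y; exists 0 => _ [u _ <-]; by have /andP[] := glim_bounds u.
Unshelve. all: end_near. Qed.

Lemma glim_le_gplus x : glim F x <= gplus F x.
Proof.
apply: ler_cvg_to (cvg_cst (glim F x)) (@gplus_cvg x) _.
near=> y; apply: glim_nd; near: y; exact: nbhs_right_ge.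
Unshelve. all: end_near. Qed.

Lemma gplus_le_glim x y : x < y -> gplus F x <= glim F y.
Proof.
move=> xy; apply: ler_cvg_to (@gplus_cvg x) (cvg_cst (glim F y)) _.
near=> z; apply: glim_nd; near: z; exact: nbhs_right_le.
Unshelve. all: end_near. Qed.

Lemma gplus_nd : nondecreasing (gplus F).
Proof.
move=> a b; rewrite le_eqVlt => /predU1P[->//|ab].
exact: (le_trans (gplus_le_glim ab) (glim_le_gplus b)).
Qed.

Lemma gplus_bounds x : 0 <= gplus F x <= c.
Proof.
have /andP[h1 _] := glim_bounds x; have /andP[_ h2] := glim_bounds (x + 1).
have xx : x < x + 1 by rewrite ltrDl.
by rewrite (le_trans h1 (glim_le_gplus x))/= (le_trans (gplus_le_glim xx) h2).
Qed.

Lemma gplus_rc : right_continuous (gplus F).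
Proof.
move=> x; apply/cvgrPdist_le => e e0.
have [y [xy hy]] : exists y, x < y /\ glim F y <= gplus F x + e.
  have := @gplus_cvg x => /cvgrPdist_le/(_ e e0) h.
  near (x : R)^'+ => y; exists y; split; first by near: y; exact: nbhs_right_gt.
  have : `|gplus F x - glim F y| <= e by near: y.
  by rewrite ler_distlC => /andP[].
near=> z.
have xz : x < z by near: z; exact: nbhs_right_gt.
have zy : z < y by near: z; exact: nbhs_right_lt.
rewrite ler_distlC; apply/andP; split.
  by apply: (@le_trans _ _ (gplus F x)); [rewrite gerBl ltW|rewrite gplus_nd// ltW].
by apply: le_trans hy; exact: gplus_le_glim.
Unshelve. all: end_near. Qed.

End Inversion.
End Helly.

(** * Partitions adapted to the Poisson kernel *)

Section PoissonKernelPartition.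
Variable R : realType.
Local Notation mu := (@lebesgue_measure R).
Implicit Types (x y e t s : R).

Lemma pker_weight_ge0 x y t : 0 < y -> 0 <= y * pker x y t.
Proof. by move=> y0; rewrite mulr_ge0// ltW// pker_gt0. Qed.

Lemma pker_bound x y t : 0 < y -> y * pker x y t <= y^-1.
Proof.
move=> y0; rewrite -ler_pdivlMl// /pker -invfM lef_pV2 ?posrE ?pker_den_gt0 ?mulr_gt0//.
by rewrite lerDr sqr_ge0.
Qed.

Lemma pker_lipschitz x y t s : 0 < y ->
  `|y * pker x y t - y * pker x y s| <= `|t - s| / y ^+ 2.
Proof.
(* The inequality 2 y |u - x| <= (u - x)^2 + y^2. *)
move=> y0; have h u : `|u - x| * pker x y u <= (2 * y)^-1.
  rewrite ler_pdivrMr ?pker_den_gt0// ler_pdivlMl ?mulr_gt0//.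
  have := sqr_ge0 (`|u - x| - y); rewrite sqrrB real_normK ?num_real// -mulr_natl.
  by move: (`|u - x|) ((u - x) ^+ 2) => v w; lra.
have hy u : pker x y u <= (y ^+ 2)^-1.
  by rewrite lef_pV2 ?posrE ?pker_den_gt0 ?exprn_gt0// lerDr sqr_ge0.
have E : y * pker x y t - y * pker x y s = y * (s - t) *
    ((s - x) * pker x y s * pker x y t + (t - x) * pker x y t * pker x y s).
  by rewrite /pker; field; rewrite !gt_eqF ?pker_den_gt0.
have p0 u : 0 <= pker x y u by rewrite ltW// pker_gt0.
have K : `|(s - x) * pker x y s * pker x y t + (t - x) * pker x y t * pker x y s|
    <= (2 * y)^-1 * (y ^+ 2)^-1 + (2 * y)^-1 * (y ^+ 2)^-1.
  apply: (le_trans (ler_normD _ _)); rewrite 4!normrM (ger0_norm (p0 s)) (ger0_norm (p0 t)).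
  by apply: lerD; apply: ler_pM; rewrite ?mulr_ge0.
rewrite E normrM (le_trans (ler_wpM2l _ K))//.
rewrite normrM (gtr0_norm y0) distrC le_eqVlt; apply/orP; left; apply/eqP.
by field; rewrite gt_eqF.
Qed.

Lemma pker_partition x y e : 0 < y -> 0 < e -> exists N, exists a : nat -> R,
  [/\ {homo a : i j / (i <= j)%N >-> i <= j},
      forall k t, (k < N)%N -> a k < t <= a k.+1 ->
        `|y * pker x y t - y * pker x y (a k)| <= e,
      forall t, ~ (a 0%N < t <= a N) -> `|y * pker x y t| <= e,
      `|y * pker x y (a 0%N)| <= e /\ `|y * pker x y (a N)| <= e &
      forall k, a k < a k.+1].
Proof.
(* At distance at least T from x the weighted kernel is at most y / T^2 <= y / T <= e, by T >= 1 and
   T >= y / e. *)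
move=> y0 e0; pose T := Num.max 1 (y / e).
have T1 : 1 <= T by rewrite le_max lexx.
have T2 : y / e <= T by rewrite le_max lexx orbT.
have T0 : 0 < T by rewrite (lt_le_trans ltr01).
clearbody T.
have far t : T <= `|t - x| -> `|y * pker x y t| <= e.
  move=> tT; rewrite ger0_norm ?pker_weight_ge0//.
  rewrite ler_pdivrMr ?pker_den_gt0// mulrC -ler_pdivrMr//.
  apply: (le_trans T2); rewrite -(real_normK (num_real (t - x))).
  apply: (@le_trans _ _ (`|t - x| ^+ 2)); last by rewrite lerDl sqr_ge0.
  by rewrite expr2 (le_trans tT)// ler_peMl// (le_trans T1 tT).
(* Chosen so that the mesh h = 2 T / N satisfies h / y^2 <= e, which bounds the oscillation on a
   cell by [pker_lipschitz]. *)
pose N := (Num.truncn (2 * T / y ^+ 2 / e)).+1.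
pose h := 2 * T / N%:R.
have N0 : 0 < N%:R :> R by [].
have h0 : 0 < h by rewrite !divr_gt0// mulr_gt0.
have he : h / y ^+ 2 <= e.
  have := ltW (truncnS_gt (2 * T / y ^+ 2 / e)); rewrite -/N ler_pdivrMr// => hN.
  by rewrite /h mulrAC ler_pdivrMr// [e * _]mulrC.
have hN : h * N%:R = 2 * T by rewrite /h divfK// gt_eqF.
pose a (k : nat) := x - T + h * k%:R.
have aS k : a k.+1 = a k + h by rewrite /a -addn1 natrD mulrDr mulr1 addrA.
have a0 : a 0%N = x - T by rewrite /a mulr0 addr0.
have aN : a N = x + T by rewrite /a hN; ring.
exists N, a; split.
- by move=> i j ij; rewrite lerD2l ler_pM2l// ler_nat.
- move=> k t kN /andP[t1 t2]; apply: (le_trans (pker_lipschitz _ _ _ y0)).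
  apply: le_trans he; rewrite ler_pM2r ?invr_gt0 ?exprn_gt0//.
  by rewrite ger0_norm ?subr_ge0 ?(ltW t1)// lerBlDl -aS.
- move=> t nt; apply: far; rewrite leNgt; apply/negP => tT; apply: nt.
  by move: tT; rewrite a0 aN ltr_distl => /andP[-> /ltW].
- split; apply: far; rewrite ?a0 ?aN.
    by rewrite addrAC subrr add0r normrN ler_norm.
  by rewrite addrAC subrr add0r ler_norm.
- by move=> k; rewrite aS ltrDl.
Qed.

End PoissonKernelPartition.

Lemma cvg_sum_seq (T : Type) (U : set_system T) (FU : Filter U) (R : realType)
  (I : Type) (r : seq I) (f : I -> T -> R) (l : I -> R) :
  (forall k, f k @ U --> l k) ->
  (fun e => \sum_(k <- r) f k e) @ U --> \sum_(k <- r) l k.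
Proof.
move=> h; elim: r => [|k r IH].
  rewrite big_nil; under eq_fun do rewrite big_nil; exact: cvg_cst.
rewrite big_cons; under eq_fun do rewrite big_cons.
exact: (cvgD (h k) IH).
Qed.

(** * Poisson integrals of the limit measure *)

Section StieltjesInversion.
Variable R : realType.
Local Notation C := R[i].
Local Notation mu := (@lebesgue_measure R).
Variables (F : C -> C) (c : R).
Hypothesis nF : nevanlinna c F.

Let c0 : 0 <= c. Proof. by case: nF. Qed.

Lemma dens_poisson e x y : 0 < e -> 0 < y ->
  (\int[mu]_t (dens F e t * (y * pker x y t))%:E =
   (complex.Im (F (Complex x (e + y))))%:E)%E.
Proof.
move=> e0 y0; case: nF => _ Fd Fc F0.
have Uz (z : C) : e <= complex.Im z -> UHP z by apply: lt_le_trans.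
have FB (z : C) : e <= complex.Im z -> nc (F z) <= c / e.
  move=> ez; rewrite ler_pdivlMr// (le_trans _ (Fc z (Uz z ez)))//.
  by rewrite ler_wpM2l ?nc_ge0.
have [_ IFc] := @path_continuous R F (fun t => Complex t e)
  (fun s t => nc_hor e s t) (fun t => cdiff_cont (Fd (Complex t e) e0)).
have pi0 : 0 < pi :> R := pi_gt0 R.
rewrite (_ : complex.Im _ = pi^-1 * (pi * complex.Im (F (Complex x (e + y))))); last first.
  by rewrite mulKf// gt_eqF.
rewrite EFinM -(poisson (B := c / e) _ e0 y0) //; last 2 first.
- by move=> z ez; apply: Fd; exact: Uz.
- by move=> z ez; apply: F0; exact: Uz.
rewrite -ge0_integralZl//.
- by apply: eq_integral => t _; rewrite -EFinM /dens mulrAC mulrC.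
- apply/measurable_EFinP; apply: continuous_measurable_fun => t.
  by apply: cvgM; [exact: IFc|apply: cvgM; [exact: cvg_cst|exact: pker_continuous]].
- move=> t _; rewrite lee_fin mulr_ge0// ?F0//.
  by rewrite mulr_ge0 ?ltW// pker_gt0.
- by rewrite lee_fin invr_ge0 ltW.
Qed.

Lemma dens_pker_integrable e x y : 0 < e -> 0 < y ->
  mu.-integrable setT (EFin \o (fun t => y * pker x y t * dens F e t)).
Proof.
move=> e0 y0; apply/integrableP; split.
  apply/measurable_EFinP; apply: continuous_measurable_fun => t.
  apply: cvgM; last exact: dens_continuous nF _ e0 _.
  by apply: cvgM; [exact: cvg_cst|exact: pker_continuous].
rewrite (_ : (\int[mu]_x0 _)%E = (\int[mu]_t (dens F e t * (y * pker x y t))%:E)%E).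
  by rewrite dens_poisson// ltry.
apply: eq_integral => t _; rewrite /= ger0_norm 1?mulrC//.
by rewrite mulr_ge0 ?pker_weight_ge0// (dens_ge0 nF).
Qed.

(** No weak convergence theorem is invoked. For each e both sides are compared with step sums over
    one finite partition, on which the ultralimit acts termwise. *)
Theorem stieltjes_inversion : exists s : {measure set R -> \bar R},
  [/\ forall a b, a <= b -> s `]a, b]%classic = (gplus F b - gplus F a)%:E,
      (s setT <= c%:E)%E &
      forall x y, 0 < y -> \int[s]_t (y * pker x y t) = complex.Im (F (Complex x y))].
Proof.
have [s sE] := lebesgue_stieltjes_exists (gplus_nd nF) (gplus_rc nF).
have sT : (s setT <= c%:E)%E.
  pose A (n : nat) : set R := `]- n%:R, n%:R]%classic.
  have AT : \bigcup_n A n = setT.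
    rewrite -subTset => t _; exists (Num.truncn `|t|).+1 => //=.
    rewrite /A/= in_itv/=; have := truncnS_gt `|t|.
    by rewrite ltr_norml => /andP[-> /ltW].
  have : (s \o A) n @[n --> \oo] --> s (\bigcup_n A n).
    apply: nondecreasing_cvg_mu => //.
    - by move=> n; exact: measurable_itv.
    - by apply: bigcup_measurable => n _; exact: measurable_itv.
    - move=> m n mn; rewrite subsetEset; apply: subset_itv; rewrite bnd_simp.
        by rewrite lerN2 ler_nat.
      by rewrite ler_nat.
  rewrite AT => cv; rewrite -(cvg_lim _ cv)//; apply: lime_le; first by apply/cvg_ex; exists (s setT).
  apply: nearW => n; rewrite /= sE; last by rewrite (@le_trans _ _ 0)// oppr_le0.
  rewrite lee_fin lerBlDr; have /andP[_ h1] := gplus_bounds nF n%:R.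
  by have /andP[h2 _] := gplus_bounds nF (- n%:R); rewrite ler_wpDr.
exists s; split => // x y y0.
set I := \int[s]_t _; set J := complex.Im _.
have sfin : (s setT < +oo)%E by rewrite (le_lt_trans sT)// ltry.
pose phi t := y * pker x y t.
have phi_c : continuous phi by move=> t; apply: cvgM; [exact: cvg_cst|exact: pker_continuous].
have phi_m : measurable_fun [set: R] phi by exact: continuous_measurable_fun.
have one_int : s.-integrable setT (EFin \o (fun _ : R => 1 : R)).
  apply: measurable_bounded_integrable => //; exists 1; split; first exact: num_real.
  by move=> M M1 t _; rewrite /= normr1 ltW.
have phi_int : s.-integrable setT (EFin \o (fun t => phi t * 1)).
  under eq_fun do rewrite mulr1.
  apply: measurable_bounded_integrable => //.
  exists y^-1; split; first exact: num_real.
  move=> M M1 t _ /=.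
  rewrite ger0_norm ?pker_weight_ge0//.
  exact: le_trans (pker_bound x t y0) (ltW M1).
(* The errors are e c for the limit measure, 3 e c for passing from [gplus] to [glim], and e c for
   the ultralimit of the densities. *)
have key e : 0 < e -> `|I - J| <= 5 * (e * c).
  move=> e0; have [N [a [a_homo a_osc a_out [a_0 a_N] a_lt]]] := pker_partition x y0 e0.
  pose A k : set R := `]a k, a k.+1]%classic.
  pose B n : set R := `]a 0%N, a n]%classic.
  have B0 : B 0%N = set0 by rewrite /B set_itv_ge// bnd_simp ltxx.
  have BS k : B k.+1 = B k `|` A k.
    rewrite /B /A; apply/seteqP; split=> t /=; rewrite !in_itv/=.
      move=> /andP[t0 t1]; case: (leP t (a k)) => tk; [left|right]; first by rewrite t0.
      by rewrite t1.
    case=> /andP[t0 t1]; first by rewrite t0 (le_trans t1)// ltW.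
    by rewrite t1 andbT (le_lt_trans _ t0)// a_homo.
  have dBA k : [disjoint B k & A k].
    apply/disj_setPS => t; rewrite /B /A/= !in_itv/= => -[/andP[_ t1] /andP[t2 _]].
    by move: (lt_le_trans t2 t1); rewrite ltxx.
  have oscA k t : (k < N)%N -> A k t -> `|phi t - phi (a k)| <= e.
    by move=> kN; rewrite /A/= in_itv/= => tk; exact: a_osc.
  have outB t : ~ B N t -> `|phi t| <= e.
    by rewrite /B/= in_itv/= => tB; exact: a_out.
  have mA k : measurable (A k) by exact: measurable_itv.
  have mB k : measurable (B k) by exact: measurable_itv.
  have mA' k : measurable (A k : set (measurableTypeR R)) by exact: measurable_itv.
  have mB' k : measurable (B k : set (measurableTypeR R)) by exact: measurable_itv.
  pose SP := \sum_(k < N) phi (a k) * (gplus F (a k.+1) - gplus F (a k)).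
  pose SL := \sum_(k < N) phi (a k) * (glim F (a k.+1) - glim F (a k)).
  have H1 : `|I - SP| <= e * c.
    have := step_approx (fun=> ler01) one_int phi_int mA mB B0 BS dBA oscA outB.
    under eq_Rintegral do rewrite mulr1.
    under eq_bigr => k _.
      rewrite Rintegral_cst//.
      rewrite (_ : fine (s (A k)) = gplus F (a k.+1) - gplus F (a k)); last first.
        by rewrite /A sE// ltW.
      rewrite mul1r.
      over.
    move=> h; apply: (le_trans h); rewrite ler_wpM2l ?(ltW e0)//.
    rewrite Rintegral_cst// mul1r -lee_fin fineK//.
    by rewrite ge0_fin_numE.
  (* The jump of [glim] at a k is at most [glim] (a (k+1)) - [glim] (a k), so the jumps telescope to
     at most c; hence the appeal to [abel_jump_bound]. *)
  have H2 : `|SP - SL| <= 3 * (e * c).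
    have -> : SP - SL = \sum_(k < N) phi (a k) *
        ((gplus F (a k.+1) - glim F (a k.+1)) - (gplus F (a k) - glim F (a k))).
      by rewrite /SP /SL -sumrB; apply: eq_bigr => k _; ring.
    apply: (@abel_jump_bound R e c N (fun k => phi (a k))
      (fun k => gplus F (a k) - glim F (a k))) => //.
    - by move=> k; rewrite subr_ge0; exact: (glim_le_gplus nF).
    - apply: (@le_trans _ _ (\sum_(k < N.+1) (glim F (a k.+1) - glim F (a k)))).
        by apply: ler_sum => k _; rewrite lerD2r; exact: (gplus_le_glim nF).
      rewrite -(big_mkord xpredT (fun k => glim F (a k.+1) - glim F (a k))).
      rewrite telescope_sumr//.
      have /andP[_ h1] := glim_bounds nF (a N.+1).
      have /andP[h2 _] := glim_bounds nF (a 0%N).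
      by rewrite lerBlDr ler_wpDr.
    - exact: ltW.
    - by move=> k kN; apply: a_osc => //; rewrite a_lt lexx.
  (* At height d > 0 the Poisson integral of the density is exactly Im F(x + i (d + y)). The step
     estimate holds there with a bound independent of d, and both of its sides converge along
     [ultra0]. *)
  have H3 : `|J - SL| <= e * c.
    pose Jd d := complex.Im (F (Complex x (d + y))).
    pose Sd d := \sum_(k < N) phi (a k) * (gdist F d (a k.+1) - gdist F d (a k)).
    have J_cvg : Jd @ (@ultra0 R) --> J.
      apply: ultra0_cvg_sub; apply/cvgrPdist_lt => r r0.
      have zU : UHP (Complex x y : C) by [].
      have [_ Fd _ _] := nF; have [r' r'0 hr] := cdiff_cont (Fd _ zU) r0.
      near=> d; have d0 : 0 < d by near: d; exact: nbhs_right_gt.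
      rewrite distrC /Jd /J -cImN -cImD; apply: (le_lt_trans (Im_le_nc _)); apply: hr.
      apply: (le_lt_trans (nc_le _)); rewrite cReD cImD cReN cImN /= subrr normr0 add0r addrK.
      rewrite ger0_norm ?ltW//; near: d; exact: nbhs_right_lt.
    have S_cvg : Sd @ (@ultra0 R) --> SL.
      apply: (@cvg_sum_seq _ _ _ R _ (index_enum 'I_N)
        (fun (k : 'I_N) d => phi (a k) * (gdist F d (a k.+1) - gdist F d (a k)))
        (fun k : 'I_N => phi (a k) * (glim F (a k.+1) - glim F (a k)))) => k; apply: cvgM; first exact: cvg_cst.
      by apply: cvgB; exact: (glim_cvg nF).
    have D_cvg : (fun d => `|Jd d - Sd d|) @ (@ultra0 R) --> `|J - SL|.
      by apply: cvg_norm; exact: (cvgB J_cvg S_cvg).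
    have ec : (fun=> e * c) @ (@ultra0 R) --> e * c by exact: cvg_cst.
    apply: (ler_cvg_to D_cvg ec).
    have := @ultra0_gt0 R; apply: filterS => d d0.
    have p0 t : 0 <= dens F d t by exact: (dens_ge0 nF).
    have := @step_approx _ (measurableTypeR R) R mu (dens F d) phi e p0
      (dens_integrable nF d0) (dens_pker_integrable x d0 y0) N A B
      (fun k => phi (a k)) mA' mB' B0 BS dBA oscA outB.
    rewrite (_ : \int[mu]_t (y * pker x y t * dens F d t) = Jd d); last first.
      rewrite /Rintegral; under eq_integral do rewrite mulrC.
      by rewrite dens_poisson.
    under eq_bigr => k _.
      rewrite (gdist_incr nF d0 (ltW (a_lt k))).
      over.
    move=> h; apply: (le_trans h); rewrite ler_wpM2l ?(ltW e0)//.
    by have /andP[] := dens_Rmass nF d0.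
  have -> : I - J = (I - SP) + ((SP - SL) - (J - SL)) by ring.
  apply: (le_trans (ler_normD _ _)); apply: (le_trans (lerD H1 (ler_normB _ _))).
  apply: (le_trans (lerD (lexx _) (lerD H2 H3))).
  by rewrite le_eqVlt; apply/orP; left; apply/eqP; ring.
apply/eqP; rewrite -subr_eq0 -normr_eq0; apply/eqP/le_anti.
rewrite normr_ge0 andbT; apply/ler_addgt0Pr => e e0; rewrite add0r.
have d0 : 0 < 5 * (c + 1) by rewrite mulr_gt0// ltr_wpDl.
apply: (le_trans (key (e / (5 * (c + 1))) _)); first by rewrite divr_gt0.
have c1 : 0 < c + 1 by rewrite ltr_wpDl.
have -> : 5 * (e / (5 * (c + 1)) * c) = e * (c / (c + 1)) by field; rewrite gt_eqF.
by rewrite ler_piMr ?(ltW e0)// ler_pdivrMr// mul1r lerDl.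
Unshelve. all: end_near. Qed.

End StieltjesInversion.

(** * Stieltjes transforms on a half-line *)

Section ComplexIntegral.
Variable R : realType.
Local Notation C := R[i].
Variables (m : {measure set R -> \bar R}) (A : set R).
Hypothesis mA : measurable A.
Implicit Types (f g : R -> C).

Definition cint f : C := Complex (\int[m]_(t in A) complex.Re (f t))
                                 (\int[m]_(t in A) complex.Im (f t)).

Definition cmeasurable f := measurable_fun A (fun t => complex.Re (f t)) /\
                            measurable_fun A (fun t => complex.Im (f t)).

Lemma cmeasurableM f g : cmeasurable f -> cmeasurable g ->
  cmeasurable (fun t => f t * g t).
Proof.
move=> [f1 f2] [g1 g2]; split.
  under eq_fun do rewrite cReM.
  by apply: measurable_funB; apply: measurable_funM.
under eq_fun do rewrite cImM.
by apply: measurable_funD; apply: measurable_funM.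
Qed.

Lemma cmeasurable_cst (c : C) : cmeasurable (fun=> c).
Proof. by split; exact: measurable_cst. Qed.

Lemma eq_cint f g : (forall t, A t -> f t = g t) -> cint f = cint g.
Proof. by move=> h; congr Complex; apply: eq_Rintegral => t /set_mem /h ->. Qed.

Lemma cintegrableD f g : cintegrable m A f -> cintegrable m A g ->
  cintegrable m A (fun t => f t + g t).
Proof.
move=> [f1 f2] [g1 g2]; split.
  have := integrableD mA f1 g1; apply: eq_integrable => // t _.
  by rewrite cReD EFinD.
have := integrableD mA f2 g2; apply: eq_integrable => // t _.
by rewrite cImD EFinD.
Qed.

Lemma integrableZR (h : R -> R) (k : R) : m.-integrable A (EFin \o h) ->
  m.-integrable A (EFin \o (fun t => k * h t)).
Proof. by move=> /(integrableZl mA k); apply: eq_integrable. Qed.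

Lemma cintegrableZ (k : C) f : cintegrable m A f -> cintegrable m A (fun t => k * f t).
Proof.
move=> [f1 f2]; split.
  have := integrableB mA (integrableZR (complex.Re k) f1) (integrableZR (complex.Im k) f2).
  by apply: eq_integrable => // t _; rewrite cReM.
have := integrableD mA (integrableZR (complex.Re k) f2) (integrableZR (complex.Im k) f1).
by apply: eq_integrable => // t _; rewrite cImM.
Qed.

Lemma cintegrableN f : cintegrable m A f -> cintegrable m A (fun t => - f t).
Proof. by move=> /(cintegrableZ (- 1)); under eq_fun do rewrite mulN1r. Qed.

Lemma cintegrableB f g : cintegrable m A f -> cintegrable m A g ->
  cintegrable m A (fun t => f t - g t).
Proof. by move=> hf hg; apply: cintegrableD => //; exact: cintegrableN. Qed.

Lemma cintD f g : cintegrable m A f -> cintegrable m A g ->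
  cint (fun t => f t + g t) = cint f + cint g.
Proof.
move=> [f1 f2] [g1 g2]; apply: complex_eq; rewrite /= ?(cReD, cImD)/= -RintegralD//;
  by apply: eq_Rintegral => t _; rewrite ?(cReD, cImD).
Qed.

Lemma cintZ (k : C) f : cintegrable m A f -> cint (fun t => k * f t) = k * cint f.
Proof.
move=> [f1 f2]; apply: complex_eq; rewrite /= ?(cReM, cImM)/= -!RintegralZl//.
  rewrite -RintegralB//; first by apply: eq_Rintegral => t _; rewrite cReM.
    exact: integrableZR.
  exact: integrableZR.
rewrite -RintegralD//; first by apply: eq_Rintegral => t _; rewrite cImM.
  exact: integrableZR.
exact: integrableZR.
Qed.

Lemma cintN f : cintegrable m A f -> cint (fun t => - f t) = - cint f.
Proof.
by move=> hf; rewrite -[RHS]mulN1r -cintZ//; apply: eq_cint => t _; rewrite mulN1r.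
Qed.

Lemma cintB f g : cintegrable m A f -> cintegrable m A g ->
  cint (fun t => f t - g t) = cint f - cint g.
Proof. by move=> hf hg; rewrite cintD ?cintN//; exact: cintegrableN. Qed.

Hypothesis mAfin : (m A < +oo)%E.

Lemma cintegrable_bounded f (M : R) : cmeasurable f ->
  (forall t, A t -> nc (f t) <= M) -> cintegrable m A f.
Proof.
move=> [f1 f2] fM; split; apply: measurable_bounded_integrable => //;
  exists M; split; rewrite ?num_real// => M' MM' t At /=;
  apply: (le_trans _ (ltW MM')); apply: (le_trans _ (fM t At)).
  exact: Re_le_nc.
exact: Im_le_nc.
Qed.

Lemma cint_norm f (M : R) : cintegrable m A f ->
  (forall t, A t -> nc (f t) <= M) -> nc (cint f) <= 2 * M * fine (m A).
Proof.
move=> [f1 f2] fM.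
have K (h : R -> R) : m.-integrable A (EFin \o h) ->
    (forall t, A t -> `|h t| <= M) -> `|\int[m]_(t in A) h t| <= M * fine (m A).
  move=> hi hM; apply: (le_trans (le_normr_Rintegral mA hi)).
  rewrite -Rintegral_cst//; apply: le_Rintegral => //.
    exact: integrable_norm hi.
  apply: measurable_bounded_integrable => //.
  by exists `|M|; split; rewrite ?num_real// => M' MM' t _ /=; exact: ltW.
apply: (le_trans (nc_le _)) => /=.
rewrite -mulrA mulr_natl mulr2n lerD// K// => t /fM; apply: le_trans.
  exact: Re_le_nc.
exact: Im_le_nc.
Qed.

End ComplexIntegral.

Section StieltjesTransform.
Variable R : realType.
Local Notation C := R[i].
Implicit Types (z w : C) (alpha t : R).

Definition cauchy_ker z t : C := (t%:C%C - z)^-1.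

Lemma cauchy_ker_Re z t : complex.Re (cauchy_ker z t) =
  (t - complex.Re z) * pker (complex.Re z) (complex.Im z) t.
Proof. by rewrite cReV nc_sqr cReD cImD cReN cImN /= sub0r sqrrN. Qed.

Lemma cauchy_ker_Im z t : complex.Im (cauchy_ker z t) =
  complex.Im z * pker (complex.Re z) (complex.Im z) t.
Proof. by rewrite cImV nc_sqr cReD cImD cReN cImN /= sub0r sqrrN mulNr opprK. Qed.

Lemma real_sub_neq z t : UHP z -> t%:C%C - z != 0.
Proof.
move=> zU; apply/eqP => /(congr1 (@complex.Im R)); rewrite cImD cImN/= sub0r => /eqP.
by rewrite oppr_eq0 gt_eqF.
Qed.

Lemma halfline_gap alpha z : ~ on_halfline alpha z ->
  exists2 d, 0 < d & forall t, alpha <= t -> d <= nc (t%:C%C - z).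
Proof.
move=> nz; have [z0|z0] := eqVneq (complex.Im z) 0.
  have az : complex.Re z < alpha.
    by rewrite ltNge; apply/negP => az; apply: nz; split.
  exists (alpha - complex.Re z); first by rewrite subr_gt0.
  move=> t at_; apply: (le_trans _ (Re_le_nc _)); rewrite cReD cReN /=.
  by rewrite (le_trans _ (ler_norm _))// lerD2r.
exists `|complex.Im z|; first by rewrite normr_gt0.
move=> t _; apply: (le_trans _ (Im_le_nc _)).
by rewrite cImD cImN /= sub0r normrN.
Qed.

(** For real z the kernel is discontinuous at t = z. That point lies left of alpha, so continuity is
    used on the open half-line beyond z only. *)
Lemma cauchy_ker_measurable alpha z : ~ on_halfline alpha z ->
  cmeasurable (halfline alpha) (cauchy_ker z).
Proof.
move=> nz.
have path (s t : R) : nc (s%:C%C - t%:C%C) <= `|s - t|.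
  by rewrite -rmorphB nc_real.
have cont t : t%:C%C != z ->
    {for t, continuous (fun t => complex.Re (cauchy_ker z t))} /\
    {for t, continuous (fun t => complex.Im (cauchy_ker z t))}.
  move=> tz; have hc : ccont (fun w => (w - z)^-1) t%:C%C.
    apply: cdiff_cont; apply: cdiffV; first by rewrite subr_eq0.
    by apply: cdiffB; [exact: cdiff_id|exact: cdiff_cst].
  have K e : 0 < e -> \forall s \near t, nc (cauchy_ker z s - cauchy_ker z t) < e.
    move=> /hc[r r0 hr]; near=> s; apply: hr; apply: (le_lt_trans (path _ _)).
    rewrite distrC; near: s; exact: (@cvgr_dist_lt _ _ _ (nbhs t) _ id).
  split; apply/cvgrPdist_lt => e e0; have := K e e0; apply: filterS => s;
    apply: le_lt_trans.
    by rewrite distrC -cReN -cReD Re_le_nc.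
  by rewrite distrC -cImN -cImD Im_le_nc.
have [z0|z0] := eqVneq (complex.Im z) 0.
  have az : complex.Re z < alpha.
    by rewrite ltNge; apply/negP => az; apply: nz; split.
  have sub : halfline alpha `<=` `]complex.Re z, +oo[%classic.
    by move=> t; rewrite /halfline/= in_itv/= andbT; exact: lt_le_trans.
  have tz t : t \in `]complex.Re z, +oo[%classic -> t%:C%C != z.
    rewrite inE/= in_itv/= andbT => zt; apply/eqP => tz.
    by move: zt; rewrite -tz /= ltxx.
  split; apply: (@measurable_funS _ _ _ _ `]complex.Re z, +oo[%classic) => //;
    apply: open_continuous_measurable_fun => //;
    by move=> t /tz /cont[].
have tz t : t%:C%C != z by apply/eqP => tz; move: z0; rewrite -tz /= eqxx.
by split; apply: measurable_funTS; apply: continuous_measurable_fun => t;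
  have [] := cont t (tz t).
Unshelve. all: end_near. Qed.

Variables (alpha : R) (s : {measure set R -> \bar R}).
Hypothesis sfin : (s (halfline alpha) < +oo)%E.
Let mH : measurable (halfline alpha).
Proof.
rewrite (_ : halfline alpha = `[alpha, +oo[%classic); first exact: measurable_itv.
by apply/seteqP; split=> t; rewrite /halfline/= in_itv/= andbT.
Qed.

Lemma measurable_halfline : measurable (halfline alpha). Proof. exact: mH. Qed.

Definition stieltjes_transform z : C := cint s (halfline alpha) (cauchy_ker z).

Lemma cauchy_ker_nc z t : nc (cauchy_ker z t) = (nc (t%:C%C - z))^-1.
Proof. by rewrite ncV. Qed.

Lemma cauchy_ker_integrable z : ~ on_halfline alpha z ->
  cintegrable s (halfline alpha) (cauchy_ker z).
Proof.
move=> nz; have [d d0 hd] := halfline_gap nz.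
apply: (@cintegrable_bounded _ _ _ mH sfin _ d^-1); first exact: cauchy_ker_measurable.
move=> t at_; rewrite cauchy_ker_nc lef_pV2 ?posrE//; first exact: hd.
exact: lt_le_trans (hd _ at_).
Qed.

Lemma stieltjes_transform_cdiff z : ~ on_halfline alpha z -> cdiff stieltjes_transform z.
Proof.
move=> nz; have [d d0 hd] := halfline_gap nz.
pose D := cint s (halfline alpha) (fun t => cauchy_ker z t * cauchy_ker z t).
exists D => e e0; pose K := 2 * (2 / d * (1 / d ^+ 2)) * fine (s (halfline alpha)).
have K0 : 0 <= K.
  by rewrite !mulr_ge0 ?invr_ge0 ?exprn_ge0 ?(ltW d0)// fine_ge0.
exists (Num.min (d / 2) (e / (K + 1))).
  by rewrite lt_min !divr_gt0// ltr_wpDl.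
move=> w; rewrite lt_min => /andP[wd wK].
have d2 : 0 < d / 2 by rewrite divr_gt0.
have hw t : alpha <= t -> d / 2 <= nc (t%:C%C - w).
  move=> /hd dt; have := nc_le_dist (t%:C%C - z) (t%:C%C - w).
  rewrite (_ : t%:C%C - z - (t%:C%C - w) = w - z); last by ring.
  by move: wd dt; move: (nc _) (nc _) (nc _) => a b c; lra.
have nw : ~ on_halfline alpha w.
  move=> [w0 aw]; have := hw _ aw.
  rewrite (_ : (complex.Re w)%:C%C - w = 0) ?nc0 ?leNgt ?d2//.
  by apply: complex_eq; rewrite /= ?(cReD, cImD, cReN, cImN)/= ?w0 ?subrr// oppr0 addr0.
have kz := cauchy_ker_integrable nz; have kw := cauchy_ker_integrable nw.
have mz := cauchy_ker_measurable nz; have mw := cauchy_ker_measurable nw.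
have bz t : alpha <= t -> nc (cauchy_ker z t) <= d^-1.
  move=> at_; rewrite cauchy_ker_nc lef_pV2 ?posrE//; first exact: hd.
  exact: lt_le_trans (hd _ at_).
have bw t : alpha <= t -> nc (cauchy_ker w t) <= 2 / d.
  move=> at_; rewrite cauchy_ker_nc -[2 / d]invrK invf_div lef_pV2 ?posrE//.
    exact: hw.
  exact: lt_le_trans (hw _ at_).
have kzz : cintegrable s (halfline alpha) (fun t => cauchy_ker z t * cauchy_ker z t).
  apply: (@cintegrable_bounded _ _ _ mH sfin _ (d^-1 * d^-1)).
    exact: cmeasurableM.
  by move=> t at_; rewrite ncM ler_pM ?nc_ge0 ?bz.
(* With D the integral of (t - z)^-2 the remainder is (w - z)^2 times the integral of (t - w)^-1 (t
   - z)^-2. For |w - z| < d / 2 that kernel is at most (2 / d) / d^2, which is where [K] comes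
   from. *)
have E : stieltjes_transform w - stieltjes_transform z - D * (w - z) =
    cint s (halfline alpha) (fun t =>
      (w - z) ^+ 2 * (cauchy_ker w t * (cauchy_ker z t * cauchy_ker z t))).
  rewrite /stieltjes_transform /D mulrC -cintZ// -!cintB//; last 2 first.
  - by apply: cintegrableB.
  - by apply: cintegrableZ.
  apply: eq_cint => t at_; rewrite /cauchy_ker.
  have z0 : t%:C%C - z != 0 by rewrite -nc_gt0 (lt_le_trans d0)// hd.
  have w0 : t%:C%C - w != 0 by rewrite -nc_gt0 (lt_le_trans d2)// hw.
  by field; rewrite z0 w0.
have M3 t : alpha <= t ->
    nc (cauchy_ker w t * (cauchy_ker z t * cauchy_ker z t)) <= 2 / d * (1 / d ^+ 2).
  move=> at_; rewrite !ncM (_ : 1 / d ^+ 2 = d^-1 * d^-1); last first.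
    by rewrite mul1r expr2 invfM.
  by rewrite !ler_pM ?mulr_ge0 ?nc_ge0 ?bz ?bw.
have k3 : cintegrable s (halfline alpha)
    (fun t => cauchy_ker w t * (cauchy_ker z t * cauchy_ker z t)).
  apply: (@cintegrable_bounded _ _ _ mH sfin _ _ _ M3).
  by apply: cmeasurableM => //; exact: cmeasurableM.
rewrite E cintZ// ncM ncX expr2 -mulrA mulrC -mulrA mulrC.
rewrite ler_wpM2r ?nc_ge0//.
apply: (@le_trans _ _ (K * nc (w - z))).
  by rewrite ler_wpM2r ?nc_ge0//; exact: (cint_norm mH sfin k3 M3).
have K1 : 0 < K + 1 by rewrite ltr_wpDl.
move: wK; rewrite ltr_pdivlMr// mulrC => /ltW; apply: le_trans.
by rewrite ler_wpM2r ?nc_ge0// lerDl.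
Qed.

Lemma stieltjes_transform_bound z (d : R) : 0 < d ->
  (forall t, alpha <= t -> d <= nc (t%:C%C - z)) ->
  ~ on_halfline alpha z ->
  nc (stieltjes_transform z) <= 2 * d^-1 * fine (s (halfline alpha)).
Proof.
move=> d0 hd nz; apply: (cint_norm mH sfin (cauchy_ker_integrable nz)) => t at_.
rewrite cauchy_ker_nc lef_pV2 ?posrE//; first exact: hd.
exact: lt_le_trans (hd _ at_).
Qed.

End StieltjesTransform.

(** * Representation by a measure on the half-line *)

Section StieltjesRepresentation.
Variable R : realType.
Local Notation C := R[i].
Local Notation mu := (@lebesgue_measure R).
Implicit Types (x y : R) (z : C).

(** The information extracted from the Potapov matrices of orders 0 and -1 for a scalar function.
    The third clause is the determinant inequality for the form of order 0 multiplied by (Im z)^2 /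
    Im z. *)
Definition stieltjes_bound (alpha c : R) (F : C -> C) := [/\ 0 <= c,
  forall z, ~ on_halfline alpha z -> cdiff F z,
  forall z, UHP z -> nc (F z) ^+ 2 * complex.Im z <= c * complex.Im (F z),
  forall z, UHP z -> 0 <= complex.Im (F z) &
  forall z, UHP z -> 0 <= complex.Im ((z - alpha%:C%C) * F z)].

Lemma UHP_off_halfline (alpha : R) z : UHP z -> ~ on_halfline alpha z.
Proof. by move=> zU [z0 _]; move: zU; rewrite /UHP z0 ltxx. Qed.

Variables (alpha c : R) (F : C -> C).
Hypothesis hF : stieltjes_bound alpha c F.

Lemma stieltjes_bound_nc z : UHP z -> nc (F z) * complex.Im z <= c.
Proof.
case: hF => c0 _ Fc _ _ zU; have [->|Fz0] := eqVneq (F z) 0; first by rewrite nc0 mul0r.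
have n0 : 0 < nc (F z) by rewrite nc_gt0.
rewrite -(ler_pM2l n0) mulrA -expr2 (le_trans (Fc z zU))// mulrC ler_wpM2r//.
by rewrite (le_trans (ler_norm _))// Im_le_nc.
Qed.

Lemma stieltjes_nevanlinna : nevanlinna c F.
Proof.
case: hF => c0 Fd Fc F0 _; split => //; last exact: stieltjes_bound_nc.
by move=> z zU; apply: Fd; exact: UHP_off_halfline.
Qed.

Let nF := stieltjes_nevanlinna.
Let c0 : 0 <= c. Proof. by case: hF. Qed.

(** The Poisson formula for the constant function i. *)
Lemma integral_pker_line x : (\int[mu]_t (pker x 1 t)%:E = pi%:E)%E.
Proof.
have := @poisson R (fun=> 'i%C) 1 1 x 1 ltr01 ltr01 (fun z _ => cdiff_cst 'i%C z).
move=> /(_ (fun z _ => _)); have n1 : nc ('i%C : C) <= 1 by rewrite nc_i.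
move=> /(_ n1 (fun _ _ => ler01)); rewrite /= mulr1 => <-.
by apply: eq_integral => t _; rewrite !mul1r.
Qed.

(** At z = t + i e the condition Im((z - alpha) F) >= 0 gives (alpha - t) Im F <= e Re F <= e |F|.
    Squaring and inserting e |F|^2 <= c Im F leaves (alpha - t)^2 Im F <= e c. *)
Lemma dens_left_bound (e t : R) : 0 < e -> t < alpha ->
  dens F e t <= e * c / pi / (alpha - t) ^+ 2.
Proof.
move=> e0 ta; case: hF => _ _ Fc F0 Fa.
set z : C := Complex t e; have zU : UHP z by [].
have a0 : 0 < alpha - t by rewrite subr_gt0.
have pi0 : 0 < pi :> R := pi_gt0 R.
have h1 := Fc z zU; have h2 := F0 z zU; have h3 := Fa z zU.
move: h3; rewrite cImM cReD cImD cReN cImN /= oppr0 addr0 => h3.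
have h4 := le_trans (ler_norm _) (Re_le_nc (F z)).
have h5 : (alpha - t) * complex.Im (F z) <= e * nc (F z).
  have : e * complex.Re (F z) <= e * nc (F z) by rewrite ler_pM2l.
  by move: h3; rewrite /z /=; move: (complex.Im _) (complex.Re _) (nc _) => u v w; lra.
rewrite /dens -/z ler_pdivlMr ?exprn_gt0// mulrAC ler_pM2r ?invr_gt0//.
have [->|u0] := eqVneq (complex.Im (F z)) 0; first by rewrite mul0r mulr_ge0// ltW.
have u1 : 0 < complex.Im (F z) by rewrite lt_def u0.
rewrite -(ler_pM2l u1).
have h6 : ((alpha - t) * complex.Im (F z)) ^+ 2 <= (e * nc (F z)) ^+ 2.
  by apply: lerXn2r; rewrite ?nnegrE ?mulr_ge0 ?nc_ge0// ltW.
have h7 : e * (nc (F z) ^+ 2 * e) <= e * (c * complex.Im (F z)) by rewrite ler_pM2l.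
rewrite (_ : _ * (_ * _) = ((alpha - t) * complex.Im (F z)) ^+ 2); last by ring.
apply: (le_trans h6); rewrite (_ : _ ^+ 2 = e * (nc (F z) ^+ 2 * e)); last by ring.
by apply: (le_trans h7); rewrite le_eqVlt; apply/orP; left; apply/eqP; ring.
Qed.

Lemma gdist_left_bound (e x : R) : 0 < e -> x < alpha ->
  gdist F e x <= e * (c * (1 + (alpha - x) ^- 2)).
Proof.
move=> e0 xa; have pi0 : 0 < pi :> R := pi_gt0 R.
have ax : 0 < alpha - x by rewrite subr_gt0.
(* With this K one has (alpha - t)^-2 <= K / ((t - alpha)^2 + 1) for all t <= x, and the majorant
   has integral K pi. *)
set K := 1 + _; have K0 : 0 < K by rewrite ltr_pwDl// invr_ge0 exprn_ge0// ltW.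
have pt t : t <= x -> dens F e t <= e * c / pi * K * pker alpha 1 t.
  move=> tx; have ta : t < alpha by apply: le_lt_trans xa.
  have at0 : 0 < alpha - t by rewrite subr_gt0.
  apply: (le_trans (dens_left_bound e0 ta)); rewrite -!mulrA !ler_wpM2l ?invr_ge0 ?(ltW e0) ?(ltW pi0)//.
  rewrite ler_pdivlMr ?pker_den_gt0// ler_pdivrMl ?exprn_gt0//.
  rewrite expr1n -[(t - alpha) ^+ 2]sqrrN opprB /K mulrDr mulr1 lerD2l.
  rewrite ler_pdivlMr ?exprn_gt0// mul1r; apply: lerXn2r; rewrite ?nnegrE ?(ltW ax) ?(ltW at0)//.
  by rewrite lerD2l lerN2.
have k0 : 0 <= e * c / pi * K.
  by rewrite mulr_ge0 ?(ltW K0)// mulr_ge0 ?invr_ge0 ?(ltW pi0)// mulr_ge0 ?(ltW e0).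
have ik : mu.-integrable setT (EFin \o (fun t => e * c / pi * K * pker alpha 1 t)).
  apply/integrableP; split.
    apply/measurable_EFinP; apply: continuous_measurable_fun => t.
    by apply: cvgM; [exact: cvg_cst|exact: pker_continuous].
  rewrite (_ : (\int[mu]_x0 _)%E = ((e * c / pi * K)%:E * \int[mu]_t (pker alpha 1 t)%:E)%E).
    by rewrite integral_pker_line -EFinM ltry.
  rewrite -ge0_integralZl//; last 2 first.
  - apply/measurable_EFinP; apply: continuous_measurable_fun; exact: pker_continuous.
  - by move=> t _; rewrite lee_fin ltW// pker_gt0.
  apply: eq_integral => t _ /=; rewrite ger0_norm ?EFinM//.
  by rewrite mulr_ge0// ltW// pker_gt0.
have -> : e * (c * K) = \int[mu]_t (e * c / pi * K * pker alpha 1 t).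
  rewrite RintegralZl//; last first.
    apply/integrableP; split.
      by apply/measurable_EFinP; apply: continuous_measurable_fun; exact: pker_continuous.
    rewrite (_ : (\int[mu]_x0 _)%E = (\int[mu]_t (pker alpha 1 t)%:E)%E).
      by rewrite integral_pker_line ltry.
    by apply: eq_integral => t _ /=; rewrite ger0_norm// ltW// pker_gt0.
  rewrite /Rintegral integral_pker_line /=; move: (K) => k.
  move: pi0; move: (pi : R) => p p0; field; exact: lt0r_neq0.
rewrite /gdist Rintegral_mkcond; apply: le_Rintegral => //.
  rewrite -restrict_EFin; apply/integrable_restrict => //.
  by rewrite setTI; apply: (integrableS _ _ _ (dens_integrable nF e0)).
move=> t _; rewrite patchE; case: ifPn => [|_].
  by rewrite inE/= in_itv/=; exact: pt.
by rewrite mulr_ge0// ltW// pker_gt0.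
Qed.

Lemma gplus_left x : x < alpha -> gplus F x = 0.
Proof.
have L y : y < alpha -> glim F y = 0.
  move=> ya; apply/eqP; rewrite eq_le; apply/andP; split; last first.
    by have /andP[] := glim_bounds nF y.
  have hy := @glim_cvg R F c nF y.
  have h0 : (fun e => e * (c * (1 + (alpha - y) ^- 2))) @ (@ultra0 R) --> (0 : R).
    apply: ultra0_cvg_sub; rewrite -[X in _ --> X](mul0r (c * (1 + (alpha - y) ^- 2))).
    apply: cvgM; last exact: cvg_cst.
    exact: (@cvg_at_right_filter _ _ id).
  apply: (ler_cvg_to hy h0); have := @ultra0_gt0 R; apply: filterS => e e0.
  exact: gdist_left_bound.
move=> xa; apply/eqP; rewrite eq_le; apply/andP; split; last first.
  by have /andP[] := gplus_bounds nF x.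
rewrite -(L ((x + alpha) / 2)); last by lra.
by apply: (gplus_le_glim nF); lra.
Qed.

(** Cauchy-Riemann in increments: horizontal increments of Im E vanish, so the derivative d has Im d
    = 0, and the vertical derivative of Re E is - Im d. Vertical lines suffice because the decay
    used afterwards is at x + i Y for large Y. *)
Lemma Im0_vertical_constant (E : C -> C) x :
  (forall z, UHP z -> cdiff E z) -> (forall z, UHP z -> complex.Im (E z) = 0) ->
  forall a b, 0 < a -> a <= b -> E (Complex x a) = E (Complex x b).
Proof.
move=> Ed E0; pose g y := complex.Re (E (Complex x y)).
have dg y : 0 < y -> is_derive y 1 g 0.
  move=> y0; have zU : UHP (Complex x y : C) by [].
  have [d hd] := Ed _ zU.
  have small e : 0 < e -> exists2 r, 0 < r & forall h : R, `|h| < r ->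
      `|complex.Im d * h| <= e * `|h| /\ `|g (y + h) - g y + complex.Im d * h| <= e * `|h|.
    move=> e0; have [r r0 hr] := hd e e0.
    exists (Num.min r y); first by rewrite lt_min r0.
    move=> h; rewrite lt_min => /andP[hr' hy].
    have h1 := hr (Complex (x + h) y); have h2 := hr (Complex x (y + h)).
    have w1 : Complex (x + h) y - Complex x y = h%:C%C :> C.
      by apply: complex_eq; rewrite /= ?(cReD, cImD, cReN, cImN)/=; ring.
    have w2 : Complex x (y + h) - Complex x y = 'i%C * h%:C%C :> C.
      by apply: complex_eq; rewrite /= ?(cReD, cImD, cReN, cImN, cReM, cImM)/=; ring.
    rewrite w1 nc_real in h1; rewrite w2 ncM nc_i mul1r nc_real in h2.
    have U2 : UHP (Complex x (y + h) : C).
      by rewrite /UHP /=; move: hy; rewrite ltr_norml => /andP[]; lra.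
    split.
      apply: le_trans (h1 hr'); apply: (le_trans _ (Im_le_nc _)).
      rewrite !(cImD, cImN, cImM) !E0 //= oppr0 addr0 add0r mulr0 add0r normrN.
      by [].
    apply: le_trans (h2 hr'); apply: (le_trans _ (Re_le_nc _)).
    rewrite !(cReD, cReN, cReM) /= ?(cReM, cImM) /= /g.
    by rewrite le_eqVlt; apply/orP; left; apply/eqP; congr (`|_|); ring.
  have gd : (fun h => h^-1 *: (g (h *: 1 + y) - g y)) @ (0 : R)^' --> (0 : R).
    apply/cvgrPdist_le => e e0; have [r r0 hr] := small (e / 2) (divr_gt0 e0 (ltr0Sn _ 1)).
    near=> h; have h0 : h != 0 by near: h; exact: nbhs_dnbhs_neq.
    have /hr[k1 k2] : `|h| < r by near: h; exact: dnbhs0_lt.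
    rewrite sub0r normrN /GRing.scale/= mulr1 [h + y]addrC normrM normfV.
    rewrite ler_pdivrMl ?normr_gt0// mulrC.
    move: k1 k2; set p := complex.Im d * h; set q := g _ - _ => k1 k2.
    have := ler_normB (q + p) p; rewrite addrK => k3.
    by move: k1 k2 k3; move: (`|p|) (`|q|) (`|q + p|) (`|h|) => u v w t; lra.
  apply: DeriveDef; first by apply/cvg_ex; exists 0.
  exact: (cvg_lim (@norm_hausdorff _ _) gd).
move=> a b a0 ab; apply: complex_eq; last by rewrite !E0 // /UHP /= (lt_le_trans a0).
have [] := @MVT_segment R g (fun=> 0) a b ab.
- by move=> y; rewrite in_itv/= => /andP[ay _]; apply: dg; exact: lt_trans ay.
- apply: derivable_within_continuous => y; rewrite in_itv/= => /andP[ay _].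
  by have /@ex_derive := dg y (lt_le_trans a0 ay).
- by move=> y _; rewrite mul0r /g => /eqP; rewrite subr_eq0 => /eqP.
Unshelve. all: end_near. Qed.

(** By inversion F and the transform have equal imaginary parts in the upper half-plane. Their
    difference is constant on vertical lines and decays there, so it is 0, and [slit_identity]
    extends this to the slit plane. *)
Theorem stieltjes_representation : exists s : {measure set R -> \bar R},
  [/\ forall a b, a <= b -> s `]a, b]%classic = (gplus F b - gplus F a)%:E,
      (s setT <= c%:E)%E,
      s (~` halfline alpha) = 0%E &
      forall z, ~ on_halfline alpha z -> F z = stieltjes_transform alpha s z].
Proof.
have [s [sE sT sI]] := stieltjes_inversion nF.
have mH := @measurable_halfline R alpha.
have s0 : s (~` halfline alpha) = 0%E.
  pose A (n : nat) : set R := `]- n%:R, alpha - n.+1%:R^-1]%classic.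
  have An n : s (A n) = 0%E.
    rewrite /A; case: (leP (- n%:R) (alpha - n.+1%:R^-1)) => h.
      rewrite sE// !gplus_left ?subrr//.
        by apply: (le_lt_trans h); rewrite gtrBl invr_gt0.
      by rewrite gtrBl invr_gt0.
    by rewrite set_itv_ge ?measure0// bnd_simp -leNgt ltW.
  have sub : ~` halfline alpha `<=` \bigcup_n A n.
    move=> t; rewrite /halfline/= => /negP; rewrite -ltNge => ta.
    have ta0 : 0 < alpha - t by rewrite subr_gt0.
    pose n := maxn (Num.truncn `|t|).+1 (Num.truncn (alpha - t)^-1).+1.
    exists n => //; rewrite /A/= in_itv/=; apply/andP; split.
      rewrite ltrNl; apply: (le_lt_trans (ler_norm _)); rewrite normrN.
      by apply: (lt_le_trans (truncnS_gt _)); rewrite ler_nat leq_maxl.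
    rewrite lerBrDl addrC -lerBrDl -[leRHS]invrK lef_pV2 ?posrE ?invr_gt0//.
    apply: (le_trans (ltW (truncnS_gt _))); rewrite ler_nat.
    by rewrite (leq_trans (leq_maxr _ _) (leqnSn _)).
  have mA n : measurable (A n) by exact: measurable_itv.
  have : s.-negligible (~` halfline alpha).
    apply: negligibleS sub _; apply: negligible_bigcup => n.
    by exists (A n); split.
  case=> B [mB B0 sB]; apply/eqP; rewrite eq_le measure_ge0 andbT -B0.
  by rewrite le_measure ?inE//; exact: measurableC.
have sfin : (s (halfline alpha) < +oo)%E.
  by rewrite (le_lt_trans _ (le_lt_trans sT (ltry _)))// le_measure ?inE.
exists s; split => //.
pose E z := F z - stieltjes_transform alpha s z.
suff E0 : forall z, ~ on_halfline alpha z -> E z = 0.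
  by move=> z /E0 /eqP; rewrite subr_eq0 => /eqP.
have Ed z : ~ on_halfline alpha z -> cdiff E z.
  move=> nz; apply: cdiffB; first by case: hF => _ Fd _ _ _; exact: Fd.
  exact: stieltjes_transform_cdiff.
apply: slit_identity => // z zU.
have EI w : UHP w -> complex.Im (E w) = 0.
  case: w => x y; rewrite /UHP /= => y0; rewrite /E cImD cImN -(sI x y y0).
  apply/eqP; rewrite subr_eq0; apply/eqP.
  rewrite -[RHS]/(\int[s]_(t in halfline alpha) complex.Im (cauchy_ker (Complex x y) t)).
  have kc : continuous (fun t => y * pker x y t).
    by move=> t; apply: cvgM; [exact: cvg_cst|exact: pker_continuous].
  have ki : s.-integrable setT (EFin \o (fun t => y * pker x y t)).
    apply: measurable_bounded_integrable => //.
    - by rewrite (le_lt_trans sT)// ltry.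
    - exact: continuous_measurable_fun.
    - exists y^-1; split; first exact: num_real.
      move=> M M1 t _ /=; rewrite ger0_norm ?pker_weight_ge0//.
      exact: le_trans (pker_bound x t y0) (ltW M1).
  rewrite -(setUv (halfline alpha)) Rintegral_setU//; last 3 first.
  - exact: measurableC.
  - by rewrite setUv.
  - by apply/disj_setPS; rewrite setICr.
  rewrite [X in _ + X](_ : _ = 0) ?addr0; last first.
    rewrite /Rintegral null_set_integral//; first exact: measurableC.
    apply/measurable_EFinP; apply: measurable_funTS.
    exact: continuous_measurable_fun.
  by apply: eq_Rintegral => t _; rewrite cauchy_ker_Im.
apply/eqP; rewrite -[_ == 0]negbK -nc_gt0 -leNgt.
apply/ler_addgt0Pr => e e0; rewrite add0r.
case: z zU => x y zU; have y0 : 0 < y by [].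
set m := fine (s (halfline alpha)).
have m0 : 0 <= m by exact: fine_ge0.
(* At height Y the two functions are bounded by c / Y and 2 m / Y, together at most e. *)
pose Y := Num.max y ((c + 2 * m) / e).
have yY : y <= Y by rewrite le_max lexx.
have Y0 : 0 < Y by exact: lt_le_trans yY.
have YU : UHP (Complex x Y : C) by [].
have EdU w : UHP w -> cdiff E w by move=> wU; apply: Ed; exact: UHP_off_halfline.
rewrite (Im0_vertical_constant x EdU EI y0 yY).
apply: (le_trans (ncB _ _)).
have b1 : nc (F (Complex x Y)) <= c / Y.
  by rewrite ler_pdivlMr//; exact: (stieltjes_bound_nc YU).
have b2 : nc (stieltjes_transform alpha s (Complex x Y)) <= 2 * Y^-1 * m.
  apply: stieltjes_transform_bound => //; last exact: UHP_off_halfline.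
  move=> t _; apply: (le_trans _ (Im_le_nc _)); rewrite cImD cImN /= sub0r normrN.
  by rewrite ler_norm.
apply: (le_trans (lerD b1 b2)); rewrite mulrAC -mulrDl ler_pdivrMr//.
by rewrite [e * Y]mulrC -ler_pdivrMr// le_max lexx orbT.
Qed.

End StieltjesRepresentation.

(** * Scalar Potapov forms and moments *)

Section PotapovForm.
Variable R : realType.
Local Notation C := R[i].
Implicit Types (F : C -> C) (s : nat -> R) (x y : nat -> C) (w z : C).

Fixpoint potapov_col F s (z : C) (j : nat) : C :=
  if j is j'.+1 then z * potapov_col F s z j' + (s j')%:C%C else F z.

(** The quadratic form of P_2n(z) for q = 1 and a real sequence, at the vector (x_0, ..., x_n, w);
    [potapov_col] solves the recursion that multiplication by the resolvent of T encodes. *)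
Definition potapov_form n F s x w z : C :=
  \sum_(j < n.+1) \sum_(k < n.+1) (x j)^* * x k * (s (j + k)%N)%:C%C +
  \sum_(j < n.+1) ((x j)^* * potapov_col F s z j * w +
                   w^* * (potapov_col F s z j)^* * x j) +
  w^* * w * ((F z - (F z)^*) / (z - z^*)).

Definition potapov_psd n F s :=
  forall z, UHP z -> forall x w, 0 <= potapov_form n F s x w z.

Lemma conj_real (r : R) : (r%:C%C)^* = r%:C%C.
Proof. by apply: complex_eq; rewrite ?(cReJ, cImJ)//= oppr0. Qed.

(** By t^2 / (t - z) = z^2 / (t - z) + z + t this is the transform of t^2 m whenever F is the
    transform of m and s_0, s_1 are its first moments. *)
Definition shift_transform F s z : C := z ^+ 2 * F z + z * (s 0%N)%:C%C + (s 1%N)%:C%C.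

Lemma potapov_col_shift F s z j :
  potapov_col (shift_transform F s) (fun i => s i.+2) z j = potapov_col F s z j.+2.
Proof. by elim: j => [|j IH] /=; [rewrite /shift_transform; ring|rewrite IH]. Qed.

Lemma UHP_conj_neq z : UHP z -> z - z^* != 0.
Proof.
move=> zU; apply/eqP => /(congr1 (@complex.Im R)); rewrite cImD cImN cImJ /= opprK.
by move: zU; rewrite /UHP => zU h; move: (addr_gt0 zU zU); rewrite h ltxx.
Qed.

Lemma big_ord_recl2 n (f : nat -> nat -> C) :
  \sum_(j < n.+1) \sum_(k < n.+1) f j k =
  f 0%N 0%N + \sum_(k < n) f 0%N k.+1 +
  (\sum_(j < n) f j.+1 0%N + \sum_(j < n) \sum_(k < n) f j.+1 k.+1).
Proof.
rewrite big_ord_recl big_ord_recl -big_split; congr (_ + _).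
by apply: eq_bigr => j _; rewrite big_ord_recl.
Qed.

(* The substitution x_0 = om, x_(j+1) = y_j, w = z om turns the form of order n + 1
   into the form of order n for the transform z^2 F + z s_0 + s_1. *)
Lemma potapov_form_step n F s y om z : UHP z ->
  potapov_form n.+1 F s (fun j => if j is j'.+1 then y j' else om) (z * om) z =
  potapov_form n (shift_transform F s) (fun i => s i.+2) y om z.
Proof.
move=> zU; have zz := UHP_conj_neq zU.
pose X j := if j is j'.+1 then y j' else om.
rewrite /potapov_form (big_ord_recl2 n.+1 (fun j k => (X j)^* * X k * (s (j + k)%N)%:C%C)).
rewrite [\sum_(j < n.+2) (_ + _)]big_ord_recl /=.
under [X in _ = _ + X + _]eq_bigr => j _ do rewrite potapov_col_shift /=.
have -> : \sum_(j < n.+1) \sum_(k < n.+1) (y j)^* * y k * (s (j.+1 + k.+1)%N)%:C%C =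
    \sum_(j < n.+1) \sum_(k < n.+1) (y j)^* * y k * (s (j + k).+2)%:C%C.
  by apply: eq_bigr => j _; apply: eq_bigr => k _; rewrite addSn addnS.
set SS := \sum_(j < n.+1) \sum_(k < n.+1) _.
under [X in _ + (X + SS) + _]eq_bigr => j _ do rewrite addn0.
set S1 := \sum_(k < n.+1) om^* * _ * _; set S2 := \sum_(j < n.+1) (y j)^* * om * _.
rewrite (eq_bigr (fun j : 'I_n.+1 =>
   ((y j)^* * (z * (z * potapov_col F s z j + (s j)%:C%C) + (s j.+1)%:C%C) * om +
    om^* * (z * (z * potapov_col F s z j + (s j)%:C%C) + (s j.+1)%:C%C)^* * y j)
   - (om^* * y j * (s j.+1)%:C%C) - (y j)^* * om * (s j.+1)%:C%C)); last first.
  by move=> j _; rewrite !(rmorphM, rmorphD) /= !conj_real; ring.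
rewrite !sumrB -/S1 -/S2; set T := \sum_(j < n.+1) (_ + _).
have -> : (shift_transform F s z - (shift_transform F s z)^*) / (z - z^*) =
    (s 0%N)%:C%C + z * F z + z^* * (F z)^* + z^* * z * ((F z - (F z)^*) / (z - z^*)).
  rewrite /shift_transform !(rmorphM, rmorphD, rmorphXn) /= !conj_real.
  by field.
rewrite !(rmorphM, rmorphD) /=.
by ring.
Qed.

Lemma potapov_psd_shift n F s : potapov_psd n.+1 F s ->
  potapov_psd n (shift_transform F s) (fun i => s i.+2).
Proof. by move=> h z zU y om; rewrite -potapov_form_step//; exact: h. Qed.

Lemma im_quotient F z : UHP z ->
  (F z - (F z)^*) / (z - z^*) = (complex.Im (F z) / complex.Im z)%:C%C.
Proof.
move=> zU; have z0 : complex.Im z != 0 by rewrite gt_eqF.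
have E u : u - u^* = 'i%C * (2 * complex.Im u)%:C%C :> C.
  by apply: complex_eq; rewrite !(cReD, cImD, cReN, cImN, cReJ, cImJ, cReM, cImM)/=; ring.
have i0 : 'i%C != 0 :> C by rewrite -nc_gt0 nc_i.
have zc : (complex.Im z)%:C%C != 0 :> C by rewrite -nc_gt0 nc_real normr_gt0.
rewrite !E !rmorphM /= fmorphV /=; field.
by apply/andP; split.
Qed.

Lemma potapov_form_head n F s a w z : UHP z ->
  potapov_form n F s (fun j => if j is 0 then a else 0) w z =
  a^* * a * (s 0%N)%:C%C + (a^* * F z * w + w^* * (F z)^* * a) +
  w^* * w * (complex.Im (F z) / complex.Im z)%:C%C.
Proof.
move=> zU; rewrite /potapov_form im_quotient// big_ord_recl big_ord_recl /=.
rewrite big1; last by move=> k _; rewrite mulr0 mul0r.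
rewrite big1; last first.
  by move=> j _; rewrite big1// => k _; rewrite rmorph0 !mul0r.
rewrite [\sum_(j < n.+1) _]big_ord_recl /= [\sum_(i < n) _]big1; last first.
  by move=> j _; rewrite rmorph0 !mul0r mulr0 addr0.
by rewrite !addr0 !addn0.
Qed.

Lemma real_psd2 (S D : R) (G : C) :
  (forall a w, 0 <= a^* * a * S%:C%C + (a^* * G * w + w^* * G^* * a) + w^* * w * D%:C%C) ->
  [/\ 0 <= S, 0 <= D & nc G ^+ 2 <= S * D].
Proof.
move=> h; have S0 : 0 <= S.
  by have := h 1 0; rewrite rmorph1 rmorph0 !(mul1r, mul0r, mulr0, addr0) -(lecR 0 S).
have D0 : 0 <= D.
  by have := h 0 1; rewrite rmorph1 rmorph0 !(mul1r, mul0r, mulr0, add0r) -(lecR 0 D).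
split => //; apply/ler_addgt0Pr => e e0.
have [d d0 de] : exists2 d, 0 < d & S * d <= e.
  exists (e / (S + 1)); first by rewrite divr_gt0// ltr_wpDl.
  by rewrite mulrA ler_pdivrMr ?ltr_wpDl// mulrC ler_pM2l// lerDl.
(* The usual test vector (D, - conj G) says nothing when D = 0; with D + d the form gives |G|^2 (D +
   2 d) <= S (D + d)^2, and d tends to 0. *)
have := h (D + d)%:C%C (- G^*).
have -> : (- G^*)^* = - G.
  by apply: complex_eq; rewrite !(cReJ, cImJ, cReN, cImN) ?opprK.
rewrite conj_real.
rewrite (_ : _ + _ = ((D + d) ^+ 2 * S - nc G ^+ 2 * (D + 2 * d))%:C%C); last first.
  by apply: complex_eq;
    rewrite !(cReD, cImD, cReM, cImM, cReN, cImN, cReJ, cImJ)/= ?nc_sqr; ring.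
rewrite (lecR 0) subr_ge0 => H.
have D2 : 0 < D + 2 * d by rewrite ltr_wpDl// mulr_gt0.
have : nc G ^+ 2 * (D + 2 * d) <= (S * D + e) * (D + 2 * d).
  apply: (le_trans H); apply: (@le_trans _ _ ((S * D + S * d) * (D + 2 * d))).
    rewrite -subr_ge0 (_ : _ - _ = S * (D + d) * d); last by ring.
    by rewrite mulr_ge0 ?(ltW d0)// mulr_ge0// addr_ge0// ltW.
  by rewrite ler_pM2r// lerD2l.
by rewrite ler_pM2r.
Qed.

Lemma potapov_bound n F s z : potapov_psd n F s -> UHP z ->
  [/\ 0 <= s 0%N, 0 <= complex.Im (F z) &
      nc (F z) ^+ 2 * complex.Im z <= s 0%N * complex.Im (F z)].
Proof.
move=> h zU; have [S0 D0 B] : [/\ 0 <= s 0%N, 0 <= complex.Im (F z) / complex.Im z &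
    nc (F z) ^+ 2 <= s 0%N * (complex.Im (F z) / complex.Im z)].
  by apply: real_psd2 => a w; rewrite -(potapov_form_head n)//; exact: h.
split => //; last by rewrite -ler_pdivlMr// -mulrA.
by move: D0; rewrite pmulr_lge0 ?invr_gt0.
Qed.

Lemma potapov_decay n F s z : potapov_psd n F s -> UHP z ->
  nc (F z) * complex.Im z <= s 0%N.
Proof.
move=> h zU; have [s0 I0 B] := potapov_bound h zU.
have [->|Fz0] := eqVneq (F z) 0; first by rewrite nc0 mul0r.
have n0 : 0 < nc (F z) by rewrite nc_gt0.
rewrite -(ler_pM2l n0) mulrA -expr2 (le_trans B)// mulrC ler_wpM2r//.
by rewrite (le_trans (ler_norm _))// Im_le_nc.
Qed.

End PotapovForm.

(** * Moments of weighted measures along the imaginary axis *)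

Section WeightedMoments.
Variable R : realType.
Local Notation C := R[i].
Variables (m : {measure set R -> \bar R}) (alpha : R).
Implicit Types (g h : R -> R) (z : C) (F : C -> C) (s : nat -> R).

Local Notation A := (halfline alpha).
Local Notation integrable h := (m.-integrable A (EFin \o h)).
Let mA : measurable A := measurable_halfline alpha.

Lemma integrable_measurable h : integrable h -> measurable_fun A h.
Proof. by move=> ih; apply/measurable_EFinP; exact: measurable_int ih. Qed.

Lemma integrable_dominated h (k : R -> R) : measurable_fun A h -> integrable k ->
  (forall t, A t -> `|h t| <= k t) -> integrable h.
Proof.
move=> mh ik hk; apply: (le_integrable mA _ _ ik); first exact/measurable_EFinP.
by move=> t At; rewrite /= lee_fin (le_trans (hk t At))// ler_norm.
Qed.

Lemma integrable_mul_bounded g h (M : R) : measurable_fun A h ->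
  (forall t, A t -> `|h t| <= M) -> integrable g -> integrable (fun t => h t * g t).
Proof.
move=> mh hM ig; have mg := integrable_measurable ig.
apply: (@integrable_dominated _ (fun t => M * `|g t|)).
- exact: measurable_funM.
- by apply: integrableZR => //; have := integrable_norm ig; apply: eq_integrable.
by move=> t At; rewrite normrM ler_wpM2r// hM.
Qed.

Lemma Rintegral_fatou h (f : nat -> R -> R) (c : R) :
  (forall n, integrable (f n)) -> (forall n t, A t -> 0 <= f n t) ->
  (forall t, A t -> f n t @[n --> \oo] --> h t) -> measurable_fun A h ->
  (forall t, A t -> 0 <= h t) -> (forall n, \int[m]_(t in A) f n t <= c) ->
  integrable h /\ \int[m]_(t in A) h t <= c.
Proof.
move=> fi f0 fh mh h0 fc.
have H : (\int[m]_(t in A) (h t)%:E <= c%:E)%E.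
  apply: (@fatou_le _ _ _ m A (fun n t => (f n t)%:E)) => //.
  - by move=> n; exact: measurable_int (fi n).
  - by move=> t At; apply: cvg_EFin; [near=> n|exact: fh].
  - near=> n; rewrite -[X in (X <= _)%E](fineK (integrable_fin_num mA (fi n))) lee_fin.
    exact: fc.
have ih : integrable h.
  apply/integrableP; split; first exact/measurable_EFinP.
  rewrite (_ : (\int[m]_(x in A) _)%E = (\int[m]_(t in A) (h t)%:E)%E).
    by rewrite (le_lt_trans H)// ltry.
  by apply: eq_integral => t /set_mem At; rewrite /= ger0_norm// h0.
by split => //; rewrite -lee_fin /Rintegral fineK//; exact: integrable_fin_num ih.
Unshelve. all: end_near. Qed.

Lemma Rintegral_dct h (f : nat -> R -> R) (k : R -> R) :
  (forall n, measurable_fun A (f n)) ->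
  (forall t, A t -> f n t @[n --> \oo] --> h t) ->
  integrable k -> (forall n t, A t -> `|f n t| <= k t) ->
  \int[m]_(t in A) f n t @[n --> \oo] --> \int[m]_(t in A) h t.
Proof.
move=> mf fh ik fk.
have mh : measurable_fun A h.
  exact: (@measurable_fun_cvg _ _ _ A f h).
have ih : integrable h.
  apply: (@integrable_dominated _ k) => // t At.
  apply: (ler_cvg_to (cvg_norm (fh t At)) (cvg_cst (k t))).
  by near=> n; exact: fk.
apply: fine_cvg; rewrite fineK; last exact: integrable_fin_num ih.
apply: (@dominated_cvg _ _ _ m A mA (fun n => EFin \o f n) _ (EFin \o k)) => //.
- by move=> n; exact/measurable_EFinP.
- by move=> t At; apply: cvg_EFin; [near=> n|exact: fh].
Unshelve. all: end_near. Qed.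

(** With N = n + 1 this is N^2 / (t^2 + N^2), the cutoff produced by evaluating a transform at i N:
    N Im of 1 / (t - i N). It lies in [0, 1] and tends to 1. *)
Definition kap (n : nat) (t : R) : R := n.+1%:R ^+ 2 * pker 0 n.+1%:R t.

Lemma pker0_mul (y t : R) : 0 < y -> pker 0 y t * (t ^+ 2 + y ^+ 2) = 1.
Proof.
by move=> y0; rewrite /pker subr0 mulVf// gt_eqF// -[t]subr0 pker_den_gt0.
Qed.

Lemma kap_ge0 n t : 0 <= kap n t.
Proof. by rewrite mulr_ge0 ?exprn_ge0// ltW// pker_gt0. Qed.

Lemma kapE n t : 1 - kap n t = t ^+ 2 * pker 0 n.+1%:R t.
Proof.
have := @pker0_mul n.+1%:R t (ltr0Sn _ _); rewrite /kap.
by move: (pker 0 n.+1%:R t) (n.+1%:R ^+ 2 : R) (t ^+ 2) => p y u E; rewrite -E; ring.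
Qed.

Lemma kap_le1 n t : kap n t <= 1.
Proof. by rewrite -subr_ge0 kapE mulr_ge0 ?sqr_ge0// ltW// pker_gt0. Qed.

Lemma kap_norm n t : `|kap n t| <= 1.
Proof. by rewrite ger0_norm ?kap_ge0// kap_le1. Qed.

Lemma kap_cvg t : kap n t @[n --> \oo] --> (1 : R).
Proof.
have -> : (fun n => kap n t) = (fun n => 1 - (1 - kap n t)).
  by apply/funext => n; rewrite subKr.
rewrite -[X in _ --> X]subr0; apply: cvgB; first exact: cvg_cst.
apply: (@squeeze_cvgr _ _ _ _ (fun=> 0) (fun n => t ^+ 2 * n.+1%:R^-1)).
- near=> n; rewrite subr_ge0 kap_le1 kapE/= ler_wpM2l ?sqr_ge0//.
  rewrite lef_pV2 ?posrE ?pker_den_gt0// (@le_trans _ _ (n.+1%:R ^+ 2))//.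
    by rewrite expr2 ler_peMr// ler1n.
  by rewrite lerDr sqr_ge0.
- exact: cvg_cst.
- rewrite -(mulr0 (t ^+ 2)); apply: cvgM; first exact: cvg_cst.
  exact: (@cvg_harmonic R).
Unshelve. all: end_near. Qed.

Lemma kap_measurable n : measurable_fun A (kap n).
Proof.
apply: measurable_funM; first exact: measurable_cst.
by apply: measurable_funTS; apply: continuous_measurable_fun; exact: pker_continuous.
Qed.

Lemma kap_integral_cvg h : integrable h ->
  \int[m]_(t in A) (h t * kap n t) @[n --> \oo] --> \int[m]_(t in A) h t.
Proof.
move=> ih; apply: (@Rintegral_dct h _ (fun t => `|h t|)).
- move=> n; apply: measurable_funM; first exact: integrable_measurable.
  exact: kap_measurable.
- move=> t _; rewrite -[X in _ --> X]mulr1; apply: cvgM; first exact: cvg_cst.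
  exact: kap_cvg.
- by have := integrable_norm ih; apply: eq_integrable.
- by move=> n t _; rewrite normrM ler_piMr// kap_norm.
Qed.

Lemma kap_integrable n h : integrable h -> integrable (fun t => h t * kap n t).
Proof.
move=> ih; have := integrable_mul_bounded (kap_measurable n) (fun t _ => kap_norm n t) ih.
by apply: eq_integrable => // t _; rewrite /= mulrC.
Qed.

Lemma kap_fatou h (c : R) : measurable_fun A h -> (forall t, A t -> 0 <= h t) ->
  (forall n, integrable (fun t => h t * kap n t)) ->
  (forall n, \int[m]_(t in A) (h t * kap n t) <= c) ->
  integrable h /\ \int[m]_(t in A) h t <= c.
Proof.
move=> mh h0 ih hc; apply: (@Rintegral_fatou h (fun n t => h t * kap n t)) => //.
- by move=> n t At; rewrite mulr_ge0 ?h0// kap_ge0.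
- move=> t _; rewrite -[X in _ --> X]mulr1; apply: cvgM; first exact: cvg_cst.
  exact: kap_cvg.
Qed.

Lemma cvg_rate (u : nat -> R) (l a c : R) : u @ \oo --> l ->
  (forall n, `|a - u n| * n.+1%:R <= c) -> l = a.
Proof.
move=> ul ub; apply/esym/eqP; rewrite -subr_eq0 -normr_le0.
have h1 : `|a - u n| @[n --> \oo] --> `|a - l|.
  by apply: cvg_norm; apply: cvgB => //; exact: cvg_cst.
have h2 : c * n.+1%:R^-1 @[n --> \oo] --> (0 : R).
  by rewrite -(mulr0 c); apply: cvgM; [exact: cvg_cst|exact: (@cvg_harmonic R)].
by apply: (ler_cvg_to h1 h2); near=> n; rewrite ler_pdivlMr.
Unshelve. all: end_near. Qed.

Lemma weighted_ker_integrable g z : integrable g -> UHP z ->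
  cintegrable m A (fun t => (g t)%:C%C * cauchy_ker z t).
Proof.
move=> ig zU; have [mr mi] := cauchy_ker_measurable (@UHP_off_halfline _ alpha _ zU).
have b t : nc (cauchy_ker z t) <= (complex.Im z)^-1.
  rewrite cauchy_ker_nc lef_pV2 ?posrE//; last first.
    by rewrite (lt_le_trans _ (Im_le_nc _))// cImD cImN/= sub0r normrN normr_gt0 gt_eqF.
  by rewrite (le_trans _ (Im_le_nc _))// cImD cImN/= sub0r normrN ler_norm.
split.
  have := integrable_mul_bounded mr (fun t _ => le_trans (Re_le_nc _) (b t)) ig.
  by apply: eq_integrable => // t _; rewrite /= cReM/= mul0r subr0 mulrC.
have := integrable_mul_bounded mi (fun t _ => le_trans (Im_le_nc _) (b t)) ig.
by apply: eq_integrable => // t _; rewrite /= cImM/= mul0r addr0 mulrC.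
Qed.

Lemma weighted_iy g n :
  let w := cint m A (fun t => (g t)%:C%C * cauchy_ker (Complex 0 n.+1%:R) t) in
  integrable g ->
  n.+1%:R * complex.Im w = \int[m]_(t in A) (g t * kap n t) /\
  n.+1%:R ^+ 2 * complex.Re w = \int[m]_(t in A) (t * g t * kap n t).
Proof.
move=> w ig; have U : UHP (Complex 0 (n.+1%:R : R)) by exact: ltr0Sn.
have [i1 i2] := weighted_ker_integrable ig U.
set ck := cauchy_ker _ in i1 i2 *.
have E1 t : complex.Im ((g t)%:C%C * ck t) = g t * (n.+1%:R * pker 0 n.+1%:R t).
  by rewrite cImM [complex.Im _%:C%C]/= [complex.Re _%:C%C]/= mul0r addr0 cauchy_ker_Im.
have E2 t : complex.Re ((g t)%:C%C * ck t) = g t * (t * pker 0 n.+1%:R t).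
  rewrite cReM [complex.Im _%:C%C]/= [complex.Re _%:C%C]/= mul0r subr0 cauchy_ker_Re.
  by rewrite subr0.
have -> : complex.Im w = \int[m]_(t in A) complex.Im ((g t)%:C%C * ck t) by [].
have -> : complex.Re w = \int[m]_(t in A) complex.Re ((g t)%:C%C * ck t) by [].
by split; rewrite -RintegralZl//; apply: eq_Rintegral => t _; rewrite ?E1 ?E2 /kap; ring.
Qed.

(* At iy the bounds |s_0 - int g kap| y^2 <= s_2 and |s_1 - int t g kap| y <= s_2
   come from the decay of the shifted transform. *)
Lemma square_moments g F s n : integrable g -> (forall t, A t -> 0 <= g t) ->
  (forall z, UHP z -> F z = cint m A (fun t => (g t)%:C%C * cauchy_ker z t)) ->
  potapov_psd n.+1 F s ->
  [/\ \int[m]_(t in A) g t = s 0%N,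
      integrable (fun t => t * g t), \int[m]_(t in A) (t * g t) = s 1%N,
      integrable (fun t => t ^+ 2 * g t) &
      forall z, UHP z -> shift_transform F s z =
        cint m A (fun t => (t ^+ 2 * g t)%:C%C * cauchy_ker z t)].
Proof.
move=> ig g0 Fz h; have h1 := potapov_psd_shift h.
have mg := integrable_measurable ig.
have mid : measurable_fun A (fun t : R => t) by exact: measurable_id.
have UN k : UHP (Complex 0 (k.+1%:R : R)) by exact: ltr0Sn.
have dec k : nc (shift_transform F s (Complex 0 k.+1%:R)) * k.+1%:R <= s 2%N.
  exact: (potapov_decay h1 (UN k)).
(* At z = i N one has z^2 F = - N^2 F, so the imaginary part measures the defect in the zeroth
   moment and the real part that in the first. *)
have shE k : complex.Im (shift_transform F s (Complex 0 k.+1%:R)) =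
    k.+1%:R * (s 0%N - \int[m]_(t in A) (g t * kap k t)) /\
    complex.Re (shift_transform F s (Complex 0 k.+1%:R)) =
    s 1%N - \int[m]_(t in A) (t * g t * kap k t).
  have [<- <-] := weighted_iy k ig.
  rewrite /shift_transform -Fz//.
  by split; rewrite expr2 !(cImD, cImM, cReD, cReM)/=; ring.
have b0 k : `|s 0%N - \int[m]_(t in A) (g t * kap k t)| * k.+1%:R ^+ 2 <= s 2%N.
  have := dec k; apply: le_trans.
  rewrite expr2 mulrA ler_wpM2r//; apply: le_trans (Im_le_nc _).
  by rewrite (shE k).1 normrM mulrC ger0_norm.
have b1 k : `|s 1%N - \int[m]_(t in A) (t * g t * kap k t)| * k.+1%:R <= s 2%N.
  have := dec k; apply: le_trans.
  by rewrite ler_wpM2r//; apply: le_trans (Re_le_nc _); rewrite (shE k).2.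
have e0 : \int[m]_(t in A) g t = s 0%N.
  apply: (cvg_rate (kap_integral_cvg ig) (c := s 2%N)) => k.
  by apply: le_trans (b0 k); rewrite ler_wpM2l// expr2 ler_peMr// ler1n.
(* Since t^2 [kap] = N^2 (1 - [kap]), the truncated second moment equals N^2 times the defect of the
   zeroth moment, which [b0] bounds by s_2; Fatou's lemma then makes t^2 g integrable. *)
have kk k t : t ^+ 2 * g t * kap k t = k.+1%:R ^+ 2 * (g t - g t * kap k t).
  have := kapE k t; rewrite -[X in X - g t * _]mulr1 -mulrBr => ->.
  by rewrite /kap; ring.
have ikk k : integrable (fun t => g t - g t * kap k t).
  by have := integrableB mA ig (kap_integrable k ig); apply: eq_integrable.
have [i2 _] : integrable (fun t => t ^+ 2 * g t) /\
    \int[m]_(t in A) (t ^+ 2 * g t) <= s 2%N.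
  apply: kap_fatou.
  - by apply: measurable_funM => //; exact: measurable_funX.
  - by move=> t At; rewrite mulr_ge0 ?sqr_ge0 ?g0.
  - move=> k; have := integrableZR mA (k.+1%:R ^+ 2) (ikk k).
    by apply: eq_integrable => // t _; rewrite /= kk.
  - move=> k; apply: le_trans (b0 k).
    rewrite (_ : \int[m]_(t in A) _ =
        k.+1%:R ^+ 2 * (s 0%N - \int[m]_(t in A) (g t * kap k t))).
      by rewrite mulrC ler_wpM2r ?exprn_ge0// ler_norm.
    rewrite -e0 -RintegralB//; last exact: kap_integrable.
    by rewrite -RintegralZl//; apply: eq_Rintegral => t _; rewrite kk.
have i1 : integrable (fun t => t * g t).
  have i02 := integrableD mA ig i2.
  apply: (@integrable_dominated _ (fun t => g t + t ^+ 2 * g t)).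
  - exact: measurable_funM.
  - by move: i02; apply: eq_integrable.
  - move=> t At; rewrite normrM (ger0_norm (g0 t At)).
    rewrite -[X in _ <= X + _]mul1r -mulrDl ler_wpM2r ?g0//.
    by rewrite -[t ^+ 2]real_normK ?num_real//; move: `|t| => a; nra.
have e1 : \int[m]_(t in A) (t * g t) = s 1%N.
  exact: (cvg_rate (kap_integral_cvg i1) b1).
split => // z zU.
have ic := weighted_ker_integrable ig zU.
have id1 : cintegrable m A (fun t => (t * g t)%:C%C).
  by split => //=; rewrite (_ : (fun=> 0%:E) = cst 0%E)//; exact: integrable0.
have id0 : cintegrable m A (fun t => (g t)%:C%C).
  by split => //=; rewrite (_ : (fun=> 0%:E) = cst 0%E)//; exact: integrable0.
have cR f : integrable f -> cint m A (fun t => (f t)%:C%C) =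
    (\int[m]_(t in A) f t)%:C%C.
  by move=> _; apply: complex_eq => //=; rewrite Rintegral_cst// mul0r.
rewrite /shift_transform Fz// -e0 -e1 -!cR// -!cintZ// -!cintD//; last 3 first.
- by apply: cintegrableD => //; apply: cintegrableZ.
- by apply: cintegrableZ.
- by apply: cintegrableZ.
apply: eq_cint => t _; have tz := real_sub_neq t zU.
by rewrite /cauchy_ker !(rmorphM, rmorphXn) /=; field.
Qed.

(** The weight g keeps the measure fixed in the induction: a step replaces g by t^2 g and F by
    [shift_transform F s]. Only the last moment is left as an inequality, since the base case has
    nothing but decay and Fatou's lemma. *)
Lemma potapov_moments n g F s : integrable g -> (forall t, A t -> 0 <= g t) ->
  (forall z, UHP z -> F z = cint m A (fun t => (g t)%:C%C * cauchy_ker z t)) ->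
  potapov_psd n F s ->
  [/\ forall j, (j <= 2 * n)%N -> integrable (fun t => t ^+ j * g t),
      forall j, (j < 2 * n)%N -> \int[m]_(t in A) (t ^+ j * g t) = s j &
      \int[m]_(t in A) (t ^+ (2 * n) * g t) <= s (2 * n)%N].
Proof.
elim: n g F s => [|n IH] g F s ig g0 Fz h.
  have z0 : (fun t => t ^+ 0 * g t) = g by apply/funext => t; rewrite mul1r.
  rewrite muln0; split => //; first by case=> // _; rewrite z0.
  rewrite z0; apply: (kap_fatou (integrable_measurable ig) g0 _ _).2.
    by move=> k; exact: kap_integrable.
  move=> k; have [<- _] := weighted_iy k ig.
  have U : UHP (Complex 0 (k.+1%:R : R)) by exact: ltr0Sn.
  rewrite -Fz//; apply: le_trans (potapov_decay h U) => /=.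
  by rewrite mulrC ler_wpM2r// (le_trans (ler_norm _))// Im_le_nc.
have [e0 i1 e1 i2 F2] := square_moments ig g0 Fz h.
have [t At|Hi Hl He] := IH _ _ _ i2 _ F2 (potapov_psd_shift h).
  by rewrite mulr_ge0 ?sqr_ge0 ?g0.
have sh j : (fun t => t ^+ j * (t ^+ 2 * g t)) = (fun t => t ^+ j.+2 * g t).
  by apply/funext => t; rewrite mulrA -exprD addn2.
rewrite mulnS; split.
- case=> [|[|j]].
  + by move=> _; rewrite (_ : (fun _ => _) = g)//; apply/funext => t; rewrite mul1r.
  + by move=> _; rewrite (_ : (fun _ => _) = (fun t => t * g t))//.
  + by rewrite !ltnS => /Hi; rewrite sh.
- case=> [|[|j]].
  + by move=> _; rewrite -e0; apply: eq_Rintegral => t _; rewrite mul1r.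
  + by move=> _; rewrite -e1; apply: eq_Rintegral => t _; rewrite expr1.
  + by rewrite !ltnS => /Hl; rewrite sh.
- by move: He; rewrite sh.
Qed.

Lemma pow_step j (t : R) : t ^+ j.+1 = t ^+ j * (t - alpha) + alpha * t ^+ j.
Proof. by rewrite exprS; ring. Qed.

Hypothesis mfin : (m A < +oo)%E.

Lemma integrable_one : integrable (fun=> 1).
Proof.
have [] := @cintegrable_bounded _ _ _ mA mfin (fun=> 1) 1 (cmeasurable_cst _ _) => //.
by move=> t _; rewrite nc1.
Qed.

Section OddMoments.
Variables (n : nat) (F : C -> C) (s : nat -> R).
Hypothesis FE : forall z, UHP z -> F z = stieltjes_transform alpha m z.
Let G z := (z - alpha%:C%C) * F z + (s 0%N)%:C%C.
Hypothesis psd : potapov_psd n G (fun j => s j.+1 - alpha * s j).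

Lemma shifted_ker z t : UHP z ->
  (t - alpha)%:C%C * cauchy_ker z t = 1 + (z - alpha%:C%C) * cauchy_ker z t.
Proof.
move=> zU; have tz := real_sub_neq t zU.
by rewrite /cauchy_ker rmorphB /=; field.
Qed.

Lemma shifted_ker_integrable z : UHP z ->
  cintegrable m A (fun t => (t - alpha)%:C%C * cauchy_ker z t).
Proof.
move=> zU; have nz := @UHP_off_halfline _ alpha _ zU.
under eq_fun do rewrite shifted_ker//.
apply: cintegrableD => //.
  by apply: (@cintegrable_bounded _ _ _ mA mfin _ 1 (cmeasurable_cst _ _)) => t _; rewrite nc1.
by apply: cintegrableZ => //; exact: cauchy_ker_integrable.
Qed.

(** Here s_0 is not yet known to be the total mass, so G is the transform of (t - alpha) m only up
    to the real constant s_0 - m(A). *)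
Lemma shifted_transform z : UHP z ->
  G z = (s 0%N - fine (m A))%:C%C + cint m A (fun t => (t - alpha)%:C%C * cauchy_ker z t).
Proof.
move=> zU; have nz := @UHP_off_halfline _ alpha _ zU.
have i1 : cintegrable m A (fun=> 1).
  by apply: (@cintegrable_bounded _ _ _ mA mfin _ 1 (cmeasurable_cst _ _)) => t _; rewrite nc1.
have ik := cauchy_ker_integrable mfin nz.
rewrite (@eq_cint _ _ _ _ (fun t => 1 + (z - alpha%:C%C) * cauchy_ker z t)); last first.
  by move=> t _; exact: shifted_ker.
rewrite cintD//; last exact: cintegrableZ.
rewrite cintZ// /G FE// rmorphB/=.
have -> : cint m A (fun=> 1) = (fine (m A))%:C%C.
  by apply: complex_eq; rewrite /= !Rintegral_cst// ?mul0r ?mul1r.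
by rewrite /stieltjes_transform; ring.
Qed.

(** The real constant drops out of Im G. Thus the decay of G at i N bounds the integral of (t -
    alpha) [kap], and Fatou's lemma applies. *)
Lemma shifted_weight_integrable : integrable (fun t => t - alpha).
Proof.
have mt : measurable_fun A (fun t : R => t - alpha).
  by apply: measurable_funB; [exact: measurable_id|exact: measurable_cst].
have At0 t : A t -> 0 <= t - alpha by rewrite subr_ge0.
have U k : UHP (Complex 0 (k.+1%:R : R)) by exact: ltr0Sn.
have E k t : k.+1%:R * complex.Im ((t - alpha)%:C%C * cauchy_ker (Complex 0 k.+1%:R) t) =
    (t - alpha) * kap k t.
  rewrite cImM [complex.Im _%:C%C]/= [complex.Re _%:C%C]/= mul0r addr0 cauchy_ker_Im /=.
  by rewrite /kap; ring.
apply: (@kap_fatou _ (s 1%N - alpha * s 0%N) mt At0 _ _).1 => k.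
  have [_ /(integrableZR mA k.+1%:R)] := shifted_ker_integrable (U k).
  by apply: eq_integrable => // t _ /=; rewrite -E.
have := potapov_decay psd (U k); apply: le_trans.
rewrite mulrC /=; apply: (@le_trans _ _ (k.+1%:R * complex.Im (G (Complex 0 k.+1%:R)))).
  rewrite shifted_transform// cImD [complex.Im _%:C%C]/= add0r.
  rewrite [complex.Im (cint _ _ _)]/= -[X in _ <= X]RintegralZl//; last first.
    by have [] := shifted_ker_integrable (U k).
  apply: le_Rintegral => //.
  - have [_ /(integrableZR mA k.+1%:R)] := shifted_ker_integrable (U k).
    by apply: eq_integrable => // t _ /=; rewrite -E.
  - by have [_ /(integrableZR mA k.+1%:R)] := shifted_ker_integrable (U k).
  - by move=> t _; rewrite -E.
by rewrite ler_wpM2l// (le_trans (ler_norm _))// Im_le_nc.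
Qed.

(** At i N both G and the real part of its integral term are O(1 / N), the latter because N |t| <=
    t^2 + N^2. Their difference is the constant s_0 - m(A), which therefore vanishes. *)
Lemma total_mass_eq : fine (m A) = s 0%N.
Proof.
have iw := shifted_weight_integrable.
have U k : UHP (Complex 0 (k.+1%:R : R)) by exact: ltr0Sn.
set w := fun k => cint m A (fun t => (t - alpha)%:C%C * cauchy_ker (Complex 0 k.+1%:R) t).
have wb k : `|complex.Re (w k)| * k.+1%:R <= \int[m]_(t in A) (t - alpha).
  have [i1 _] := shifted_ker_integrable (U k).
  rewrite -[k.+1%:R in X in X <= _]ger0_norm// -normrM mulrC.
  rewrite [complex.Re _]/= -RintegralZl//.
  apply: (le_trans (le_normr_Rintegral mA (integrableZR mA k.+1%:R i1))).
  apply: le_Rintegral => //; first exact: integrable_norm (integrableZR mA k.+1%:R i1).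
  move=> t At; rewrite cReM [complex.Im _%:C%C]/= [complex.Re _%:C%C]/= mul0r subr0.
  rewrite cauchy_ker_Re subr0 mulrCA normrM ger0_norm ?subr_ge0// ler_piMr ?subr_ge0//.
  have p0 := @pker_gt0 R 0 _ t (ltr0Sn R k).
  have := @pker0_mul k.+1%:R t (ltr0Sn _ _).
  rewrite !normrM (gtr0_norm p0) -[t ^+ 2]real_normK ?num_real// [`|k.+1%:R|]ger0_norm//.
  move: p0; move: (pker 0 k.+1%:R t) => p p0; move: (`|t| : R) (k.+1%:R : R) => a y <-.
  rewrite -subr_ge0 (_ : _ - _ = p * (((a - y) ^+ 2 + a ^+ 2 + y ^+ 2) / 2)); last by field.
  by rewrite mulr_ge0 ?(ltW p0)// divr_ge0// !addr_ge0 ?sqr_ge0.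
apply: (@cvg_rate (fun=> fine (m A)) _ _
    (s 1%N - alpha * s 0%N + \int[m]_(t in A) (t - alpha))); first exact: cvg_cst.
move=> k; have dk := potapov_decay psd (U k); have := wb k.
have := le_trans (ler_wpM2r (ler0n _ _) (Re_le_nc _)) dk.
rewrite shifted_transform// cReD [complex.Re _%:C%C]/= -/(w k).
move=> h1 h2; apply: le_trans (lerD h1 h2).
by rewrite -mulrDl ler_wpM2r// -[X in `|X| <= _](addrK (complex.Re (w k))) ler_normB.
Qed.

(** The even case for the weight t - alpha yields the integrals of t^j (t - alpha); t^(j+1) = t^j (t
    - alpha) + alpha t^j recovers the moments starting from the total mass. *)
Lemma potapov_moments_odd :
  [/\ forall j, (j <= (2 * n).+1)%N -> integrable (fun t => t ^+ j),
      forall j, (j < (2 * n).+1)%N -> \int[m]_(t in A) (t ^+ j) = s j &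
      \int[m]_(t in A) (t ^+ (2 * n).+1) <= s (2 * n).+1].
Proof.
have [|z zU|Hi Hl He] := potapov_moments shifted_weight_integrable _ _ psd.
- by move=> t; rewrite subr_ge0.
- by rewrite -/(G z) shifted_transform// total_mass_eq subrr add0r.
have J j : (j <= 2 * n)%N -> integrable (fun t => t ^+ j) /\ \int[m]_(t in A) (t ^+ j) = s j.
  elim: j => [|j IH] jn.
    split; first by under eq_fun do rewrite expr0; exact: integrable_one.
    by under eq_Rintegral do rewrite expr0; rewrite Rintegral_cst// mul1r total_mass_eq.
  have [i1 e1] := IH (ltnW jn); have i2 := Hi j (ltnW jn); have i3 := integrableZR mA alpha i1.
  under eq_fun do rewrite pow_step; split.
    by have := integrableD mA i2 i3; apply: eq_integrable.
    by rewrite RintegralD// RintegralZl// Hl// e1 subrK.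
have [i1 e1] := J _ (leqnn _); have i2 := Hi _ (leqnn _); have i3 := integrableZR mA alpha i1.
split.
- move=> j; rewrite leq_eqVlt => /orP[/eqP ->|/J[]//].
  under eq_fun do rewrite pow_step.
  by have := integrableD mA i2 i3; apply: eq_integrable.
- by move=> j /J[].
- under eq_Rintegral do rewrite pow_step.
  by rewrite RintegralD// RintegralZl// e1 -lerBrDr.
Qed.

End OddMoments.
End WeightedMoments.

(** * Hermitian families of measures *)

Section IntegralForm.
Variable R : realType.
Variables (I : finType) (m : I -> {measure set R -> \bar R}) (phi : I -> R -> R) (alpha : R).
Local Notation A := (halfline alpha).
Hypothesis mfin : forall k, (m k A < +oo)%E.
Hypothesis phi_cont : forall k, continuous (phi k).
Hypothesis phi_int : forall k, (m k).-integrable A (EFin \o phi k).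
Hypothesis form_ge0 : forall t B, A t -> measurable B -> B `<=` A ->
  0 <= \sum_k phi k t * fine (m k B).

Let mA : measurable A := measurable_halfline alpha.
Let J x y : set R := `[x, y[.

Lemma itv_halfline x y : alpha <= x -> J x y `<=` A.
Proof. by move=> ax t; rewrite /J/= in_itv/= => /andP[/(le_trans ax)]. Qed.

Lemma itv_split x y z : alpha <= x -> x <= y -> y <= z ->
  (forall k, \int[m k]_(t in J x z) phi k t =
     \int[m k]_(t in J x y) phi k t + \int[m k]_(t in J y z) phi k t) /\
  (forall k, fine (m k (J x z)) = fine (m k (J x y)) + fine (m k (J y z))).
Proof.
move=> ax xy yz; have E : J x z = J x y `|` J y z.
  apply/seteqP; split=> t; rewrite /J/= !in_itv/=.
    by move=> /andP[-> ->]; rewrite andbT; case: ltP => h; [left|right].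
  by case=> /andP[h1 h2]; rewrite ?h1 ?h2 ?(lt_le_trans h2 yz) ?(le_trans xy h1).
have D : [disjoint J x y & J y z].
  apply/disj_setPS => t; rewrite /J/= !in_itv/= => -[/andP[_ h1] /andP[h2 _]].
  by move: (lt_le_trans h1 h2); rewrite ltxx.
have ay := le_trans ax xy.
have mJ u v : measurable (J u v) by exact: measurable_itv.
split => k; rewrite E.
  rewrite Rintegral_setU//; apply: integrableS (phi_int k) => //.
    exact: measurableU.
  by rewrite -E; exact: itv_halfline.
have fJ u v : alpha <= u -> m k (J u v) \is a fin_num.
  move=> au; rewrite ge0_fin_numE// (le_lt_trans _ (mfin k))// le_measure ?inE//.
  exact: itv_halfline.
rewrite measureU//; last exact/disj_set2P.
by rewrite fineD// fJ.
Qed.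

(** Positivity on [x, y) up to an error proportional to mass; in this form it is additive over
    adjacent intervals. *)
Let Q e x y := - e * (\sum_k fine (m k (J x y))) <= \sum_k \int[m k]_(t in J x y) phi k t.

Lemma form_split e x y z : alpha <= x -> x <= y -> y <= z -> Q e x y -> Q e y z -> Q e x z.
Proof.
move=> ax xy yz; have [h1 h2] := itv_split ax xy yz; rewrite /Q => q1 q2.
under eq_bigr => k _ do rewrite h2.
under [X in _ <= X]eq_bigr => k _ do rewrite h1.
by rewrite !big_split/= mulrDr; exact: lerD.
Qed.

(** Freezing all phi_k at b makes the sum nonnegative by [form_ge0]; near b the replacement costs at
    most e per unit of mass. *)
Lemma form_local (e b : R) : 0 < e -> alpha <= b -> exists2 d : R, 0 < d &
  forall x y, alpha <= x -> b - d < x -> y < b + d -> Q e x y.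
Proof.
move=> e0 ab; have : \forall t \near b, forall k, `|phi k b - phi k t| < e.
  have H k : \forall t \near b, `|phi k b - phi k t| < e.
    by have /cvgrPdist_lt := @phi_cont k b; apply.
  exact: (@filter_forall _ _ _ (nbhs b) (nbhs_filter b) H).
move=> /nbhs_ballP[d /= d0 hd]; exists d => // x y ax bx yb; rewrite /Q.
have sub := @itv_halfline x y ax.
have mJ : measurable (J x y) by exact: measurable_itv.
have fJ k : (m k (J x y) < +oo)%E.
  by rewrite (le_lt_trans _ (mfin k))// le_measure ?inE.
have cJ k (c : R) : (m k).-integrable (J x y) (EFin \o cst c).
  apply: measurable_bounded_integrable => //.
  by exists `|c|; split; rewrite ?num_real// => M cM t _ /=; exact: ltW.
apply: (@le_trans _ _ (\sum_k (phi k b - e) * fine (m k (J x y)))).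
  under [X in _ <= X]eq_bigr => k _ do rewrite mulrBl -mulNr.
  rewrite big_split/= -mulr_sumr lerDr; exact: form_ge0.
apply: ler_sum => k _; rewrite -Rintegral_cst//; apply: le_Rintegral => //.
- exact: cJ.
- by apply: integrableS (phi_int k).
move=> t; rewrite /J/= in_itv/= => /andP[xt ty].
rewrite lerBlDl -lerBlDr; apply: (le_trans (ler_norm _)); apply/ltW.
by apply: hd; rewrite /ball/= ltr_norml; apply/andP; split; lra.
Qed.

Lemma form_interval e y : 0 < e -> alpha <= y -> Q e alpha y.
Proof.
move=> e0 ay.
have Qaa : Q e alpha alpha.
  by have [d d0] := form_local e0 (lexx alpha); apply; rewrite ?lexx ?ltrBlDr ?ltrDl.
pose X := [set x | alpha <= x <= y /\ Q e alpha x].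
have Xa : X alpha by split => //; rewrite lexx.
have Xy : ubound X y by move=> x [/andP[]].
have Xs : has_sup X by split; [exists alpha|exists y].
(* From some x in X close to b, [form_local] reaches z = min y (b + d / 2), so z is in X. As b + d /
   2 would exceed the supremum, z = y. *)
pose b := sup X.
have ab : alpha <= b by apply: ub_le_sup => //; exists y.
have by_ : b <= y by apply: ge_sup => //; exists alpha.
have [d d0 hd] := form_local e0 ab.
have [x [/andP[ax xy] Qx] bx] : exists2 x, X x & b - d < x by exact: sup_adherent.
have xb : x <= b by apply: ub_le_sup; [exists y|split => //; apply/andP].
pose z := Num.min y (b + d / 2).
have zd : z < b + d by rewrite gt_min; apply/orP; right; lra.
have bz : b <= z by rewrite le_min by_/=; lra.
have Qz : Q e alpha z.
  by apply: (form_split (y := x)) => //; [exact: le_trans bz|exact: hd].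
have Xz : X z.
  by split => //; rewrite (le_trans ab bz)/= ge_min lexx.
have zb : z <= b by apply: ub_le_sup => //; exists y.
move: Qz zb; rewrite /z /Num.min; case: ltP => // _ _; lra.
Qed.

(** The measures m_k are unrelated, so no common density is at hand; positivity is proved on [alpha,
    alpha + n) with an arbitrarily small error and passes to the half-line by dominated
    convergence. *)
Lemma integral_form_ge0 : 0 <= \sum_k \int[m k]_(t in A) phi k t.
Proof.
have fin k n : m k (J alpha n) \is a fin_num.
  rewrite ge0_fin_numE// (le_lt_trans _ (mfin k))// le_measure ?inE//.
    exact: measurable_itv.
  exact: itv_halfline.
have S n : alpha <= n -> 0 <= \sum_k \int[m k]_(t in J alpha n) phi k t.
  move=> an; set s := \sum_k fine (m k (J alpha n)).
  have s0 : 0 <= s by apply: sumr_ge0 => k _; exact: fine_ge0.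
  apply/ler_addgt0Pr => e e0; have e1 : 0 < e / (s + 1) by rewrite divr_gt0// ltr_wpDl.
  have := form_interval e1 an; rewrite /Q -/s -lerBlDr => /(le_trans _); apply.
  by rewrite sub0r mulNr lerN2 mulrAC ler_pdivrMr ?ltr_wpDl// ler_pM2l// lerDl.
have C k : \int[m k]_(t in J alpha (alpha + n%:R)) phi k t @[n --> \oo] -->
    \int[m k]_(t in A) phi k t.
  have E n : \int[m k]_(t in J alpha (alpha + n%:R)) phi k t =
      \int[m k]_(t in A) (phi k t * \1_(J alpha (alpha + n%:R)) t).
    rewrite -[in LHS](setIidr (@itv_halfline alpha (alpha + n%:R) (lexx _))).
    rewrite Rintegral_mkcondr; apply: eq_Rintegral => t _.
    by rewrite patchE indicE; case: ifPn => _; rewrite ?mulr1 ?mulr0.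
  under eq_fun do rewrite E.
  have mphi : measurable_fun A (phi k).
    by apply: measurable_funTS; exact: continuous_measurable_fun.
  apply: (@Rintegral_dct _ (m k) alpha _ _ (fun t => `|phi k t|)).
  - move=> n; apply: measurable_funM => //.
    by apply: measurable_indic; exact: measurable_itv.
  - move=> t At; rewrite -[X in _ --> X]mulr1; apply: cvgM; first exact: cvg_cst.
    apply: cvg_near_cst; near=> n; rewrite indicE mem_set//= /J/= in_itv/=.
    apply/andP; split => //; rewrite -ltrBlDl.
    by near: n; exact: nbhs_infty_gtr.
  - by have := integrable_norm (phi_int k); apply: eq_integrable.
  - by move=> n t _; rewrite normrM ler_piMr// indicE; case: (_ \in _); rewrite ?normr1 ?normr0.
have cs : \sum_k \int[m k]_(t in J alpha (alpha + n%:R)) phi k t @[n --> \oo] -->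
    \sum_k \int[m k]_(t in A) phi k t.
  by apply: cvg_sum_seq => k; exact: C.
apply: (ler_cvg_to (cvg_cst 0) cs); near=> n; apply: S.
by rewrite lerDl.
Unshelve. all: end_near. Qed.

End IntegralForm.

Lemma Rintegral_sum_seq d (T : measurableType d) (R : realType)
  (mu : {measure set T -> \bar R}) (D : set T) (mD : measurable D) (I : Type)
  (r : seq I) (a : I -> R) (f : I -> T -> R) :
  (forall k, mu.-integrable D (EFin \o f k)) ->
  mu.-integrable D (EFin \o (fun t => \sum_(k <- r) a k * f k t)) /\
  \int[mu]_(t in D) (\sum_(k <- r) a k * f k t) = \sum_(k <- r) a k * \int[mu]_(t in D) f k t.
Proof.
move=> fi; have ai k : mu.-integrable D (EFin \o (fun t => a k * f k t)).
  by have := integrableZl mD (a k) (fi k); apply: eq_integrable.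
elim: r => [|k r [IH1 IH2]].
  split; last first.
    rewrite big_nil; under eq_Rintegral do rewrite big_nil.
    by rewrite /Rintegral integral0.
  by apply: (eq_integrable mD (cst 0%E)); [move=> t _ /=; rewrite big_nil|exact: integrable0].
have E t : \sum_(j <- k :: r) a j * f j t = a k * f k t + \sum_(j <- r) a j * f j t.
  by rewrite big_cons.
split.
  by have := integrableD mD (ai k) IH1; apply: eq_integrable => // t _ /=; rewrite E.
rewrite big_cons -IH2 -RintegralZl// -RintegralD//.
by apply: eq_Rintegral => t _; rewrite E.
Qed.

Lemma cvg_eq_near (T : Type) (U : set_system T) (PU : ProperFilter U) (R : realType)
  (f : T -> R) (l c : R) : f @ U --> l -> (\forall x \near U, f x = c) -> l = c.
Proof.
move=> fl fc; apply: (@norm_cvg_unique _ _ (f @ U)) => //.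
by apply: cvg_near_cst; apply: filterS fc => x ->.
Qed.

(** * Linear relations pass from functions to measures *)

Section RelationTransfer.
Variable R : realType.
Local Notation C := R[i].
Variables (I : finType) (G : I -> C -> C) (c a : I -> R).
Variable s : I -> {measure set R -> \bar R}.
Hypothesis nG : forall k, nevanlinna (c k) (G k).
Hypothesis sE : forall k x y, x <= y ->
  s k `]x, y]%classic = (gplus (G k) y - gplus (G k) x)%:E.
Hypothesis sT : forall k, (s k setT <= (c k)%:E)%E.
Hypothesis relation : forall z, UHP z -> \sum_k a k * complex.Im (G k z) = 0.

Lemma relation_gdist e x : 0 < e -> \sum_k a k * gdist (G k) e x = 0.
Proof.
move=> e0; rewrite /gdist.
have mx : measurable (`]-oo, x]%classic : set (measurableTypeR R)) by exact: measurable_itv.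
have fi k : (@lebesgue_measure R).-integrable `]-oo, x] (EFin \o dens (G k) e).
  by apply: integrableS (dens_integrable (nG k) e0).
have [_ <-] := Rintegral_sum_seq mx (index_enum I) a fi.
under eq_Rintegral => t _.
  under eq_bigr do rewrite /dens mulrA.
  rewrite -mulr_suml relation// mul0r; over.
by rewrite /Rintegral integral0.
Qed.

Lemma relation_glim x : \sum_k a k * glim (G k) x = 0.
Proof.
apply: (@cvg_eq_near _ (@ultra0 R) _ _ (fun e => \sum_k a k * gdist (G k) e x)).
  apply: cvg_sum_seq => k; apply: cvgM; first exact: cvg_cst.
  exact: (glim_cvg (nG k)).
by apply: filterS (@ultra0_gt0 R) => e; exact: relation_gdist.
Qed.

Lemma relation_gplus x : \sum_k a k * gplus (G k) x = 0.
Proof.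
apply: (@cvg_eq_near _ (x^'+) _ _ (fun y => \sum_k a k * glim (G k) y)).
  apply: cvg_sum_seq => k; apply: cvgM; first exact: cvg_cst.
  exact: (gplus_cvg (nG k)).
by near=> y; exact: relation_glim.
Unshelve. all: end_near. Qed.

Lemma relation_fin k B : measurable B -> s k B \is a fin_num.
Proof.
move=> mB; rewrite ge0_fin_numE// (le_lt_trans _ (ltry (c k)))//.
by rewrite (le_trans _ (sT k))// le_measure ?inE.
Qed.

Lemma relation_cvg (F : nat -> set R) B : (forall n, \sum_k a k * fine (s k (F n)) = 0) ->
  measurable B -> (forall k, s k (F n) @[n --> \oo] --> s k B) ->
  \sum_k a k * fine (s k B) = 0.
Proof.
move=> F0 mB FB; apply: (@cvg_eq_near _ \oo _ _ (fun n => \sum_k a k * fine (s k (F n)))).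
  apply: cvg_sum_seq => k; apply: cvgM; first exact: cvg_cst.
  by apply: fine_cvg; rewrite fineK ?relation_fin//; exact: FB.
by near=> n.
Unshelve. all: end_near. Qed.

Lemma relation_itv x y : \sum_k a k * fine (s k `]x, y]%classic) = 0.
Proof.
have [xy|yx] := leP x y; last first.
  by rewrite set_itv_ge ?bnd_simp -?leNgt ?ltW// big1// => k _; rewrite measure0 mulr0.
under eq_bigr => k _ do rewrite sE//= mulrBr.
by rewrite sumrB !relation_gplus subrr.
Qed.

Lemma relation_setT : \sum_k a k * fine (s k setT) = 0.
Proof.
pose F (n : nat) : set R := `]- n%:R, n%:R]%classic.
  have mF n : measurable (F n) by exact: measurable_itv.
have FT : \bigcup_n F n = setT.
  rewrite -subTset => t _; exists (Num.truncn `|t|).+1 => //=; rewrite /F/= in_itv/=.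
  have := truncnS_gt `|t|; rewrite ltr_norml => /andP[-> /ltW ->//].
apply: (@relation_cvg F) => //; first by move=> n; exact: relation_itv.
move=> k; rewrite -FT; apply: nondecreasing_cvg_mu => //; first by rewrite FT.
move=> n m nm; apply/subsetPset => t; rewrite /F/= !in_itv/= => /andP[h1 h2].
rewrite (le_trans h2) ?ler_nat// andbT (le_lt_trans _ h1)//.
by rewrite lerN2 ler_nat.
Qed.

(** Dynkin's theorem for the intervals ]x, y], on which the measures are increments of [gplus].
    Finiteness of all [s k] allows complements and countable unions inside the linear
    combination. *)
Theorem relation_transfer B : measurable B -> \sum_k a k * fine (s k B) = 0.
Proof.
move: B; apply: (@dynkin_induction _ R (@ocitv R)) => //.
- by move=> X Y /ocitvI; apply.
- exact: relation_setT.
- move=> X /ocitvP[->|[[x y] _ ->]]; last exact: relation_itv.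
  by rewrite big1// => k _; rewrite measure0 mulr0.
- move=> S mS S0.
  have sC k : fine (s k (~` S)) = fine (s k setT) - fine (s k S).
    have mC : measurable (~` S) by exact: measurableC.
    by rewrite -(setUv S) measureU ?setICr// fineD ?relation_fin// addrC addKr.
  under eq_bigr do rewrite sC mulrBr.
  by rewrite sumrB relation_setT S0 subrr.
- move=> F mF tF F0.
  have mU : measurable (\bigcup_k F k) by exact: bigcup_measurable.
  apply: (@cvg_eq_near _ \oo _ _ (fun n => \sum_k a k * \sum_(0 <= i < n) fine (s k (F i)))).
    apply: cvg_sum_seq => k; apply: cvgM; first exact: cvg_cst.
    rewrite (_ : (fun n => _) = fine \o (fun n => (\sum_(0 <= i < n) s k (F i))%E)); last first.
      by apply/funext => n /=; rewrite sum_fine// => i _; rewrite relation_fin.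
    apply: fine_cvg; rewrite fineK ?relation_fin//.
    exact: measure_sigma_additive.
  near=> n; under eq_bigr do rewrite mulr_sumr.
  by rewrite exchange_big big1.
Unshelve. all: end_near. Qed.

End RelationTransfer.

(** * Hermitian forms and polarization *)

Section QuadraticForm.
Variable R : realType.
Local Notation C := R[i].
Variable q : nat.
Implicit Types (M N : 'M[C]_q) (u v : 'cV[C]_q).

Definition qform M u : C := (adjmx u *m M *m u) 0 0.

Lemma qformE M u :
  qform M u = \sum_i \sum_j (u i 0)^* * u j 0 * M i j.
Proof.
rewrite /qform mxE exchange_big; apply: eq_bigr => j _; rewrite mxE mulr_suml.
by apply: eq_bigr => i _; rewrite !mxE; ring.
Qed.

Lemma qformD M N u : qform (M + N) u = qform M u + qform N u.
Proof. by rewrite /qform mulmxDr mulmxDl mxE. Qed.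

Lemma qformZ (a : C) M u : qform (a *: M) u = a * qform M u.
Proof. by rewrite /qform -scalemxAr -scalemxAl mxE. Qed.

Lemma qformB M N u : qform (M - N) u = qform M u - qform N u.
Proof. by rewrite qformD -scaleN1r qformZ mulN1r. Qed.

Lemma qform_adj M u : qform (adjmx M) u = (qform M u)^*.
Proof.
rewrite !qformE exchange_big rmorph_sum; apply: eq_bigr => i _.
rewrite rmorph_sum; apply: eq_bigr => j _; rewrite !mxE !rmorphM /= conjCK.
by ring.
Qed.

Definition proot (k : 'I_4) : C := [:: 1; -1; - 'i%C; 'i%C]`_k.

Definition pvec (i j : 'I_q) (k : 'I_4) : 'cV[C]_q :=
  2^-1 *: (delta_mx i 0 + proot k *: delta_mx j 0).

(* With w_k = 1, -1, -i, i the weights conj w_k recover M i j from the values of the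
   form at (e_i + w_k e_j) / 2, in the order of [cmeasure_integral]. *)
Lemma polarization M i j : M i j = \sum_(k < 4) (proot k)^* * qform M (pvec i j k).
Proof.
have dC (a : 'I_q) : adjmx (delta_mx a 0 : 'cV[C]_q) = delta_mx 0 a.
  by apply/matrixP => x y; rewrite !mxE andbC; case: (_ && _); rewrite ?rmorph1 ?rmorph0.
have qd (a b : 'I_q) : (adjmx (delta_mx a 0 : 'cV[C]_q) *m M *m (delta_mx b 0 : 'cV[C]_q)) 0 0 = M a b.
  rewrite dC -mulmxA -rowE mxE mxE (bigD1 b)//= big1 => [|c cb].
    by rewrite mxE !eqxx mulr1 addr0.
  by rewrite mxE (negbTE cb) mulr0.
have E k : qform M (pvec i j k) = 2^-1 * 2^-1 * (M i i + proot k * M i j +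
    (proot k)^* * M j i + (proot k)^* * proot k * M j j).
  have aE : adjmx (pvec i j k) =
      2^-1 *: (adjmx (delta_mx i 0) + (proot k)^* *: adjmx (delta_mx j 0)).
    apply/matrixP => x y; rewrite !mxE rmorphM rmorphD rmorphM /=.
    by congr (_ * _); rewrite fmorphV /= rmorph_nat.
  rewrite /qform aE /pvec -scalemxAr -!scalemxAl !(mulmxDl, mulmxDr).
  rewrite -!scalemxAl -!scalemxAr.
  move: (qd i i) (qd i j) (qd j i) (qd j j).
  move: (_ *m _ *m delta_mx i 0) (adjmx (delta_mx j 0) *m M *m delta_mx i 0) => X1 X2.
  move: (_ *m _ *m delta_mx j 0) (adjmx (delta_mx j 0) *m M *m delta_mx j 0) => X3 X4.
  move=> <- <- <- <-; rewrite !mxE.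
  by move: (2^-1 : C) (proot k) ((proot k)^*) (X1 0 0) (X2 0 0) (X3 0 0) (X4 0 0) => *; ring.
have cN : (- 'i%C)^* = 'i%C :> C by apply: complex_eq; rewrite ?cReJ ?cImJ /= ?oppr0 ?opprK.
have ci : ('i%C)^* = - 'i%C :> C by apply: complex_eq; rewrite ?cReJ ?cImJ /= ?oppr0 ?opprK.
have ii : 'i%C * 'i%C = -1 :> C.
  by apply: complex_eq; rewrite ?cReM ?cImM /=; ring.
under eq_bigr do rewrite E.
have cM : (- 1)^* = - 1 :> C by apply: complex_eq; rewrite ?cReJ ?cImJ /= ?oppr0.
have c1 : 1^* = 1 :> C by apply: complex_eq; rewrite ?cReJ ?cImJ /= ?oppr0.
rewrite !big_ord_recl big_ord0 /proot /= cM c1 cN ci.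
move: (M i i) (M i j) (M j i) (M j j) ('i%C : C) ii => x1 x2 x3 x4 I II.
apply: (@mulfI _ (4 : C)); first by rewrite pnatr_eq0.
transitivity (x2 * (2 - 2 * (I * I)) + x3 * (2 + 2 * (I * I))); first by rewrite II; ring.
by field.
Qed.

(** The Hermitian half of [psdmx] is automatic over the complex numbers: real values of the form
    make M and its adjoint agree under polarization. *)
Lemma psdmxP M : psdmx M <-> forall u, 0 <= qform M u.
Proof.
split=> [[]//|h]; split => //.
apply/matrixP => i j; apply/eqP; rewrite -subr_eq0; apply/eqP.
have -> : M i j - adjmx M i j = (M - adjmx M) i j by rewrite !mxE.
rewrite polarization big1// => k _; rewrite qformB qform_adj.
by rewrite (CrealP (ger0_real (h _))) subrr mulr0.
Qed.

End QuadraticForm.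

Lemma big_ord4 (V : nmodType) (f : 'I_4 -> V) : \sum_(k < 4) f k =
  f (@Ordinal 4 0 isT) + f (@Ordinal 4 1 isT) + f (@Ordinal 4 2 isT) + f (@Ordinal 4 3 isT).
Proof.
rewrite !big_ord_recr big_ord0 /= add0r.
by congr (f _ + f _ + f _ + f _); exact: val_inj.
Qed.

Lemma cRe_sum (R : realType) (I : Type) (r : seq I) (f : I -> R[i]) :
  complex.Re (\sum_(k <- r) f k) = \sum_(k <- r) complex.Re (f k).
Proof. by elim: r => [|k r IH]; rewrite ?big_nil// !big_cons cReD IH. Qed.

Lemma cIm_sum (R : realType) (I : Type) (r : seq I) (f : I -> R[i]) :
  complex.Im (\sum_(k <- r) f k) = \sum_(k <- r) complex.Im (f k).
Proof. by elim: r => [|k r IH]; rewrite ?big_nil// !big_cons cImD IH. Qed.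

(** The right-hand side is the combination of four integrals prescribed in [cmeasure_integral]. *)
Lemma proot_sum (R : realType) (w : 'I_4 -> R[i]) :
  let o k (h : (k < 4)%N) := w (Ordinal h) in
  let w0 := o 0%N isT in let w1 := o 1%N isT in
  let w2 := o 2%N isT in let w3 := o 3%N isT in
  \sum_(k < 4) (proot R k)^* * w k =
  Complex (complex.Re w0 - complex.Re w1 - complex.Im w2 + complex.Im w3)
          (complex.Im w0 - complex.Im w1 + complex.Re w2 - complex.Re w3).
Proof.
rewrite /= big_ord4 /proot /=.
move: (w _) (w (@Ordinal 4 1 isT)) (w (@Ordinal 4 2 isT)) (w (@Ordinal 4 3 isT)).
move=> w0 w1 w2 w3; apply: complex_eq;
  rewrite !(cReD, cImD) !(cReM, cImM) !(cReJ, cImJ) !(cReN, cImN) /=; ring.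
Qed.

(** * Families of measures indexed by vectors *)

Section RealForm.
Variable R : realType.
Local Notation C := R[i].
Variable q : nat.
Implicit Types (u v : 'cV[C]_q) (p : 'cV[C]_q -> R).

(** Indexes the terms of the relation expressing p u through the values of p at the polarization
    vectors; the left summand stands for the term - p u. *)
Definition fidx := (unit + ('I_q * 'I_q) * 'I_4)%type.

Definition fcoef u (k : fidx) : C :=
  match k with inl _ => -1 | inr (i, j, k) => (u i 0)^* * u j 0 * (proot R k)^* end.

Definition fvec u (k : fidx) : 'cV[C]_q :=
  match k with inl _ => u | inr (i, j, k) => pvec R i j k end.

(* [p] is the restriction of a Hermitian form, expressed as a family of linear
   relations between values of [p], hence stable under linear limits. *)
Definition realform p := forall u, \sum_k fcoef u k * (p (fvec u k))%:C%C = 0.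

Definition polmx p : 'M[C]_q :=
  \matrix_(i, j) \sum_(k < 4) (proot R k)^* * (p (pvec R i j k))%:C%C.

Lemma realform_polmx p : realform p <-> forall u, qform (polmx p) u = (p u)%:C%C.
Proof.
have E u : \sum_k fcoef u k * (p (fvec u k))%:C%C = qform (polmx p) u - (p u)%:C%C.
  rewrite big_sumType (big_pred1 tt) /=; last by case.
  rewrite mulN1r addrC; congr (_ - _); rewrite qformE pair_bigA /=.
  transitivity (\sum_ij \sum_k fcoef u (inr (ij, k)) * (p (fvec u (inr (ij, k))))%:C%C).
    by rewrite pair_bigA; apply: eq_bigr => -[[i j] k] _.
  apply: eq_bigr => -[i j] _ /=; rewrite mxE mulr_sumr.
  by apply: eq_bigr => k _; rewrite mulrA.
split=> h u; first by apply/eqP; rewrite -subr_eq0 -E h.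
by rewrite E h subrr.
Qed.

Lemma polmx_qform (M : 'M[C]_q) p : (forall u, qform M u = (p u)%:C%C) -> polmx p = M.
Proof.
move=> h; apply/matrixP => i j; rewrite mxE [RHS]polarization.
by apply: eq_bigr => k _; rewrite h.
Qed.

Lemma qform_realform (M : 'M[C]_q) p : (forall u, qform M u = (p u)%:C%C) -> realform p.
Proof. by move=> h; apply/realform_polmx; rewrite (polmx_qform h). Qed.

(** Splits the complex relations into real ones, the only kind that can be transferred to measures
    and integrals by a positivity argument. *)
Lemma realformP p : realform p <-> forall u,
  \sum_k complex.Re (fcoef u k) * p (fvec u k) = 0 /\
  \sum_k complex.Im (fcoef u k) * p (fvec u k) = 0.
Proof.
have E u : \sum_k fcoef u k * (p (fvec u k))%:C%C =
    Complex (\sum_k complex.Re (fcoef u k) * p (fvec u k))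
            (\sum_k complex.Im (fcoef u k) * p (fvec u k)).
  have big0 (r : seq fidx) : \sum_(k <- r) fcoef u k * (p (fvec u k))%:C%C =
      Complex (\sum_(k <- r) complex.Re (fcoef u k) * p (fvec u k))
              (\sum_(k <- r) complex.Im (fcoef u k) * p (fvec u k)).
    elim: r => [|k r IH]; first by rewrite !big_nil.
    rewrite !big_cons IH; apply: complex_eq;
      by rewrite ?cReD ?cImD ?cReM ?cImM /= mulr0 ?subr0 ?add0r.
  exact: big0.
split=> h u; first by have := h u; rewrite E => -[-> ->].
by rewrite E; have [-> ->] := h u.
Qed.

Lemma polmxE p i j : polmx p i j =
  Complex (p (pvec R i j (@Ordinal 4 0 isT)) - p (pvec R i j (@Ordinal 4 1 isT)))
          (p (pvec R i j (@Ordinal 4 2 isT)) - p (pvec R i j (@Ordinal 4 3 isT))).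
Proof.
by rewrite mxE proot_sum /= subr0 addr0 subr0 add0r.
Qed.

Section FormMeasure.
Variables (sg : 'cV[C]_q -> {measure set R -> \bar R}).

Lemma realform_measure (F : 'cV[C]_q -> C -> C) (c : 'cV[C]_q -> R) :
  (forall u, nevanlinna (c u) (F u)) ->
  (forall u x y, x <= y -> sg u `]x, y]%classic = (gplus (F u) y - gplus (F u) x)%:E) ->
  (forall u, (sg u setT <= (c u)%:E)%E) ->
  (forall z, UHP z -> realform (fun u => complex.Im (F u z))) ->
  forall B, measurable B -> realform (fun u => fine (sg u B)).
Proof.
move=> nF sE sT h B mB; apply/realformP => u.
have K (a : fidx -> R) :
    (forall z, UHP z -> \sum_k a k * complex.Im (F (fvec u k) z) = 0) ->
    \sum_k a k * fine (sg (fvec u k) B) = 0.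
  move=> a0; apply: (@relation_transfer _ _ (fun k => F (fvec u k)) (fun k => c (fvec u k)) a
    (fun k => sg (fvec u k))) => //.
  by move=> k x y; exact: sE.
by split; apply: K => z /h /realformP/(_ u)[].
Qed.

Variable alpha : R.
Local Notation A := (halfline alpha).
Hypothesis sfin : forall u, (sg u A < +oo)%E.
Hypothesis sform : forall B, measurable B -> B `<=` A -> realform (fun u => fine (sg u B)).

(** A relation valid on all Borel sets is transferred to integrals by applying [integral_form_ge0]
    to its coefficients and to their negatives. *)
Lemma realform_integral (f : R -> R) : continuous f ->
  (forall u, (sg u).-integrable A (EFin \o f)) ->
  realform (fun u => \int[sg u]_(t in A) f t).
Proof.
move=> fc fi; apply/realformP => u.
have mA := measurable_halfline alpha.
have K (a : fidx -> R) :
    (forall B, measurable B -> B `<=` A -> \sum_k a k * fine (sg (fvec u k) B) = 0) ->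
    0 <= \sum_k a k * \int[sg (fvec u k)]_(t in A) f t.
  move=> a0; under eq_bigr => k _ do rewrite -RintegralZl//.
  apply: (@integral_form_ge0 _ _ (fun k => sg (fvec u k)) (fun k t => a k * f t)) => //.
  - by move=> k t; apply: cvgM; [exact: cvg_cst|exact: fc].
  - by move=> k; exact: integrableZR.
  - move=> t B At mB BA; under eq_bigr => k _ do rewrite mulrAC.
    by rewrite -mulr_suml a0// mul0r.
have K0 (a : fidx -> R) :
    (forall B, measurable B -> B `<=` A -> \sum_k a k * fine (sg (fvec u k) B) = 0) ->
    \sum_k a k * \int[sg (fvec u k)]_(t in A) f t = 0.
  move=> a0; apply/eqP; rewrite eq_le K// andbT -oppr_ge0 -sumrN.
  under eq_bigr do rewrite -mulNr; apply: K => B mB BA.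
  by under eq_bigr do rewrite mulNr; rewrite sumrN a0// oppr0.
by split; apply: K0 => B mB BA; have /realformP/(_ u)[] := sform mB BA.
Qed.

Definition form_measure (B : set R) := polmx (fun u => fine (sg u B)).

(** The measures at the four polarization vectors of (i, j) serve as the quadruple for that
    entry. *)
Lemma form_measure_integral (f : R -> C) :
  (forall u, cintegrable (sg u) A f) ->
  mx_integral A form_measure f
    (\matrix_(i, j) \sum_(k < 4) (proot R k)^* * cint (sg (pvec R i j k)) A f).
Proof.
move=> fi i j; pose o k (h : (k < 4)%N) := pvec R i j (Ordinal h).
exists (sg (o 0%N isT)), (sg (o 1%N isT)), (sg (o 2%N isT)), (sg (o 3%N isT)).
do 4 (split; first exact: sfin).
split; first by move=> B mB BA; rewrite /form_measure polmxE.
do 4 (split; first exact: fi).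
by rewrite mxE proot_sum.
Qed.

Lemma form_measure_herm : herm_measure A form_measure.
Proof.
have mA := measurable_halfline alpha.
split; [|split].
- apply/matrixP => i j; rewrite mxE big1 ?mxE// => k _.
  by rewrite measure0 mulr0.
- move=> B mB BA; apply/psdmxP => u; have /realform_polmx -> := sform mB BA.
  by rewrite (lecR 0) fine_ge0.
- move=> F mF FA tF i j.
  have mU : measurable (\bigcup_k F k) by exact: bigcup_measurable.
  have UA : \bigcup_k F k `<=` A by move=> t [n _ /FA].
  have fin u B : measurable B -> B `<=` A -> sg u B \is a fin_num.
    move=> mB BA; rewrite ge0_fin_numE// (le_lt_trans _ (sfin u))//.
    by rewrite le_measure ?inE.
  have cv u : \sum_(n < N) fine (sg u (F n)) @[N --> \oo] --> fine (sg u (\bigcup_k F k)).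
    rewrite (_ : (fun n => _) = fine \o (fun n => (\sum_(0 <= i < n) sg u (F i))%E)).
      apply: fine_cvg; rewrite fineK ?fin//.
      exact: measure_sigma_additive.
    apply/funext => n /=; rewrite -sum_fine ?big_mkord// => k _.
    exact: fin.
  pose o k (h : (k < 4)%N) := pvec R i j (Ordinal h).
  pose sum v N := \sum_(n < N) fine (sg v (F n)).
  split.
    rewrite (_ : (fun N => _) = (fun N => sum (o 0%N isT) N - sum (o 1%N isT) N)).
      by rewrite /form_measure polmxE /=; apply: cvgB; exact: cv.
    apply/funext => N; rewrite cRe_sum -sumrB.
    by apply: eq_bigr => n _; rewrite /form_measure polmxE.
  rewrite (_ : (fun N => _) = (fun N => sum (o 2%N isT) N - sum (o 3%N isT) N)).
    by rewrite /form_measure polmxE /=; apply: cvgB; exact: cv.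
  apply/funext => N; rewrite cIm_sum -sumrB.
  by apply: eq_bigr => n _; rewrite /form_measure polmxE.
Qed.

End FormMeasure.
End RealForm.

(** * Positivity of real-linear functionals under integration *)

Section RealLinearFunctional.
Variable R : realType.
Local Notation C := R[i].
Variables (q N : nat).
Implicit Types (Phi : (nat -> 'M[C]_q) -> C) (d : nat -> 'M[C]_q).

Definition entry_sum (l : nat -> 'M[C]_q) d : C :=
  \sum_(a < N) \sum_i \sum_j l a i j * d a i j.

(** Real-linear, not complex-linear: the Potapov form involves both S(z) and its adjoint, hence the
    conjugated second part. [d] lists the data, of which the first [N] matrices enter. *)
Definition rlin Phi := exists l m : nat -> 'M[C]_q, forall d,
  Phi d = entry_sum l d + (entry_sum m d)^*.

Lemma entry_sumD l l' d :
  entry_sum (fun a => l a + l' a) d = entry_sum l d + entry_sum l' d.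
Proof.
rewrite /entry_sum -big_split; apply: eq_bigr => a _ /=.
rewrite -big_split; apply: eq_bigr => i _ /=; rewrite -big_split.
by apply: eq_bigr => j _ /=; rewrite mxE mulrDl.
Qed.

Lemma entry_sumZ c l d : entry_sum (fun a => c *: l a) d = c * entry_sum l d.
Proof.
rewrite /entry_sum mulr_sumr; apply: eq_bigr => a _ /=.
rewrite mulr_sumr; apply: eq_bigr => i _ /=; rewrite mulr_sumr.
by apply: eq_bigr => j _ /=; rewrite mxE mulrA.
Qed.

Lemma rlinD Phi Psi : rlin Phi -> rlin Psi -> rlin (fun d => Phi d + Psi d).
Proof.
move=> [l [m h]] [l' [m' h']].
exists (fun a => l a + l' a), (fun a => m a + m' a) => d.
by rewrite h h' !entry_sumD rmorphD /= addrACA.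
Qed.

Lemma rlinZ (c : C) Phi : rlin Phi -> rlin (fun d => c * Phi d).
Proof.
move=> [l [m h]]; exists (fun a => c *: l a), (fun a => c^* *: m a) => d.
by rewrite h !entry_sumZ rmorphM /= conjCK mulrDr.
Qed.

Lemma rlinN Phi : rlin Phi -> rlin (fun d => - Phi d).
Proof. by move=> /(rlinZ (-1)); under eq_fun do rewrite mulN1r. Qed.

Lemma rlin_conj Phi : rlin Phi -> rlin (fun d => (Phi d)^*).
Proof.
by move=> [l [m h]]; exists m, l => d; rewrite h rmorphD /= conjCK addrC.
Qed.

Lemma rlin0 : rlin (fun=> 0).
Proof.
exists (fun=> 0), (fun=> 0) => d; rewrite /entry_sum.
by rewrite big1 ?rmorph0 ?addr0// => a _; rewrite big1// => i _; rewrite big1// => j _;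
  rewrite mxE mul0r.
Qed.

Lemma rlin_sum (I : Type) (r : seq I) (Phi : I -> (nat -> 'M[C]_q) -> C) :
  (forall k, rlin (Phi k)) -> rlin (fun d => \sum_(k <- r) Phi k d).
Proof.
move=> h; elim: r => [|k r IH].
  by under eq_fun do rewrite big_nil; exact: rlin0.
by under eq_fun do rewrite big_cons; exact: rlinD.
Qed.

Lemma rlin_form (u v : 'cV[C]_q) a : (a < N)%N ->
  rlin (fun d => (adjmx u *m d a *m v) 0 0).
Proof.
move=> aN; exists (fun b => if b == a then \matrix_(i, j) ((u i 0)^* * v j 0) else 0), (fun=> 0).
move=> d; rewrite [X in _ + X^*](_ : _ = 0); last first.
  rewrite /entry_sum big1// => b _; rewrite big1// => i _; rewrite big1// => j _.
  by rewrite mxE mul0r.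
rewrite rmorph0 addr0 /entry_sum (bigD1 (Ordinal aN))//= eqxx [X in _ = _ + X]big1 ?addr0.
  rewrite mxE exchange_big; apply: eq_bigr => j _; rewrite mxE mulr_suml.
  by apply: eq_bigr => i _; rewrite !mxE; ring.
move=> b; rewrite -val_eqE /= => /negbTE ->; rewrite big1// => i _; rewrite big1// => j _.
by rewrite mxE mul0r.
Qed.

Section Integral.
Variables (alpha : R) (sigma : set R -> 'M[C]_q) (f : nat -> R -> C) (M : nat -> 'M[C]_q).
Local Notation A := (halfline alpha).
Hypothesis fR : forall a, continuous (fun t => complex.Re (f a t)).
Hypothesis fI : forall a, continuous (fun t => complex.Im (f a t)).
Hypothesis fM : forall a, (a < N)%N -> mx_integral A sigma (f a) (M a).

Lemma cmeasure_integral4 (nu : set R -> C) (g : R -> C) c :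
  cmeasure_integral A nu g c -> exists m : 'I_4 -> {measure set R -> \bar R},
  [/\ forall k, (m k A < +oo)%E,
      forall B, measurable B -> B `<=` A ->
        nu B = \sum_(k < 4) (proot R k)^* * (fine (m k B))%:C%C,
      forall k, cintegrable (m k) A g &
      c = \sum_(k < 4) (proot R k)^* * cint (m k) A g].
Proof.
move=> [m0 [m1 [m2 [m3 [h0 [h1 [h2 [h3 [hB [i0 [i1 [i2 [i3 hc]]]]]]]]]]]]].
exists (fun k : 'I_4 => nth m0 [:: m0; m1; m2; m3] k); split.
- by case=> [[|[|[|[|k]]]]].
- by move=> B mB BA; rewrite hB// proot_sum /= subr0 addr0 subr0 add0r.
- by case=> [[|[|[|[|k]]]]].
- by rewrite proot_sum.
Qed.

Lemma sum4E (V : nmodType) (F : 'I_N * 'I_q * 'I_q * 'I_4 -> V) :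
  \sum_p F p = \sum_a \sum_i \sum_j \sum_k F (a, i, j, k).
Proof.
by rewrite pair_bigA pair_bigA pair_bigA /=; apply: eq_bigr => -[[[]]].
Qed.

(** The quadruples behind [mx_integral] depend on the entry and on the integrand. Expanding Re Phi
    into real integrals indexed by (a, i, j, k) gives every measure its own integrand, the setting
    of [integral_form_ge0]. *)
Theorem rlin_integral_ge0 Phi : rlin Phi ->
  (forall t B, A t -> measurable B -> B `<=` A ->
    0 <= complex.Re (Phi (fun a => f a t *: sigma B))) ->
  0 <= complex.Re (Phi M).
Proof.
(* Conjugation does not change real parts, so for Re Phi the two coefficient families merge into
   one. *)
move=> [l [m h]]; pose L a := l a + m a.
have ReP d : complex.Re (Phi d) = complex.Re (entry_sum L d).
  by rewrite h cReD cReJ -cReD -entry_sumD.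
have /choice[mu hmu] (p : 'I_N * 'I_q * 'I_q) : exists m : 'I_4 -> {measure set R -> \bar R},
  [/\ forall k, (m k A < +oo)%E,
      forall B, measurable B -> B `<=` A ->
        sigma B p.1.2 p.2 = \sum_(k < 4) (proot R k)^* * (fine (m k B))%:C%C,
      forall k, cintegrable (m k) A (f p.1.1) &
      M p.1.1 p.1.2 p.2 = \sum_(k < 4) (proot R k)^* * cint (m k) A (f p.1.1)].
  exact: cmeasure_integral4 (fM (ltn_ord _) _ _).
pose phi (p : 'I_N * 'I_q * 'I_q * 'I_4) t :=
  complex.Re (L p.1.1.1 p.1.1.2 p.1.2 * (proot R p.2)^* * f p.1.1.1 t).
have mA := measurable_halfline alpha.
have E : complex.Re (Phi M) = \sum_p \int[mu p.1 p.2]_(t in A) phi p t.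
  rewrite ReP /entry_sum cRe_sum sum4E; apply: eq_bigr => a _.
  rewrite cRe_sum; apply: eq_bigr => i _; rewrite cRe_sum; apply: eq_bigr => j _.
  have [_ _ ic ->] := hmu (a, i, j); rewrite mulr_sumr cRe_sum; apply: eq_bigr => k _.
  by rewrite mulrA -(cintZ mA _ (ic k)).
rewrite E => ge0; apply: (@integral_form_ge0 _ _ (fun p => mu p.1 p.2)).
- by move=> p; have [] := hmu p.1.
- move=> [[[a i] j] k]; rewrite /phi /=; under eq_fun do rewrite cReM.
  move=> t; apply: cvgB; apply: cvgM; try exact: cvg_cst.
    exact: fR.
  exact: fI.
- move=> [[[a i] j] k]; have [_ _ /(_ k) ic _] := hmu (a, i, j).
  by have [] := cintegrableZ mA (L a i j * (proot R k)^*) ic.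
- move=> t B At mB BA; have := ge0 t B At mB BA; congr (0 <= _).
  rewrite ReP /entry_sum cRe_sum sum4E; apply: eq_bigr => a _.
  rewrite cRe_sum; apply: eq_bigr => i _; rewrite cRe_sum; apply: eq_bigr => j _.
  have [_ /(_ B mB BA) /= sB _ _] := hmu (a, i, j); rewrite [X in complex.Re (_ * X)](_ : _ = f a t * sigma B i j); last by rewrite mxE.
  rewrite sB.
  rewrite mulrA mulr_sumr cRe_sum; apply: eq_bigr => k _.
  rewrite /phi /= mulrA [X in _ = X](_ : _ = complex.Re
    (L a i j * (proot R k)^* * f a t * (fine (mu (a, i, j) k B))%:C%C)); last first.
    by rewrite cReM /= mulr0 subr0.
  by rewrite [X in complex.Re (X * _)]mulrAC.
Qed.

End Integral.
End RealLinearFunctional.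

(** * Potapov matrices *)

Section PotapovBlock.
Variable R : realType.
Local Notation C := R[i].
Variable q : nat.
Implicit Types (s : nat -> 'M[C]_q) (F : 'M[C]_q) (u v w : 'cV[C]_q) (x : nat -> 'cV[C]_q) (z : C).

Definition bform u (M : 'M[C]_q) v : C := (adjmx u *m M *m v) 0 0.

Fixpoint mcol s F z (j : nat) : 'M[C]_q :=
  if j is j'.+1 then z *: mcol s F z j' + s j' else F.

(** Common form of both kinds of Potapov matrix; the odd one arises from [salpha] and F = (z -
    alpha) S(z) + s_0. *)
Definition potapov_mx n s F z :=
  let B := \mxcol_(j < n.+1) mcol s F z j in
  block_mx (Hmx s n) B (adjmx B) ((z - z^*)^-1 *: (F - adjmx F)).

Definition mform n s F x w z : C :=
  \sum_(j < n.+1) \sum_(k < n.+1) bform (x j) (s (j + k)%N) (x k) +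
  \sum_(j < n.+1) (bform (x j) (mcol s F z j) w + (bform (x j) (mcol s F z j) w)^*) +
  (z - z^*)^-1 * (bform w F w - (bform w F w)^*).

Lemma adjmxM m n p (A : 'M[C]_(m, n)) (B : 'M[C]_(n, p)) :
  adjmx (A *m B) = adjmx B *m adjmx A.
Proof. by rewrite /adjmx map_mxM trmx_mul. Qed.

Lemma adjmxK m n (A : 'M[C]_(m, n)) : adjmx (adjmx A) = A.
Proof. by apply/matrixP => i j; rewrite !mxE conjCK. Qed.

Lemma adjmxD m n (A B : 'M[C]_(m, n)) : adjmx (A + B) = adjmx A + adjmx B.
Proof. by apply/matrixP => i j; rewrite !mxE rmorphD. Qed.

Lemma adjmxZ m n (a : C) (A : 'M[C]_(m, n)) : adjmx (a *: A) = a^* *: adjmx A.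
Proof. by apply/matrixP => i j; rewrite !mxE rmorphM. Qed.

Lemma adjmx11 (A : 'M[C]_1) : (adjmx A) 0 0 = (A 0 0)^*.
Proof. by rewrite !mxE. Qed.

Lemma bform_adj u M v : bform v (adjmx M) u = (bform u M v)^*.
Proof.
by rewrite /bform -[in LHS](adjmxK u) -adjmxM -adjmxM adjmx11 mulmxA.
Qed.

Lemma adj_mxcol m (n : nat) (x : nat -> 'M[C]_(q, m)) :
  adjmx (\mxcol_(j < n) x j) = \mxrow_(j < n) adjmx (x j).
Proof.
rewrite /adjmx -tr_mxcol; congr trmx.
by apply/matrixP => i j; rewrite !mxE.
Qed.

Lemma qform_potapov n s F x w z :
  qform (potapov_mx n s F z) (col_mx (\mxcol_(j < n.+1) x j) w) = mform n s F x w z.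
Proof.
rewrite /qform /potapov_mx.
set X := \mxcol_(j < n.+1) x j; set B := \mxcol_(j < n.+1) mcol s F z j.
have -> : adjmx (col_mx X w) = row_mx (adjmx X) (adjmx w).
  by rewrite /adjmx map_col_mx tr_col_mx.
rewrite mul_row_block mul_row_col !mulmxDl.
have aD (Y Z : 'M[C]_1) : (Y + Z) 0 0 = Y 0 0 + Z 0 0 by rewrite mxE.
rewrite !aD.
have -> : (adjmx X *m Hmx s n *m X) 0 0 =
    \sum_(j < n.+1) \sum_(k < n.+1) bform (x j) (s (j + k)%N) (x k).
  rewrite /X adj_mxcol /Hmx mul_mxrow_mxblock mul_mxrow_mxcol summxE exchange_big.
  apply: eq_bigr => k _; rewrite mulmx_suml summxE.
  by apply: eq_bigr => j _.
have E1 : (adjmx X *m B *m w) 0 0 = \sum_(j < n.+1) bform (x j) (mcol s F z j) w.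
  rewrite /X adj_mxcol /B mul_mxrow_mxcol mulmx_suml summxE.
  by apply: eq_bigr.
have -> : (adjmx w *m adjmx B *m X) 0 0 = ((adjmx X *m B *m w) 0 0)^*.
  by rewrite -[in LHS](adjmxK X) -adjmxM -adjmxM adjmx11 mulmxA.
rewrite E1 rmorph_sum /= /mform big_split /=.
have -> : (adjmx w *m ((z - z^*)^-1 *: (F - adjmx F)) *m w) 0 0 =
    (z - z^*)^-1 * (bform w F w - (bform w F w)^*).
  rewrite -scalemxAr -scalemxAl mxE mulmxBr mulmxBl mxE; congr (_ * _).
  by rewrite [X in _ + X]mxE -bform_adj.
ring.
Qed.

Lemma potapov_psdP n s F z :
  psdmx (potapov_mx n s F z) <-> forall x w, 0 <= mform n s F x w z.
Proof.
split=> [/psdmxP h x w|h]; first by rewrite -qform_potapov.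
apply/psdmxP => U; rewrite -[U]vsubmxK.
pose x (j : nat) := submxcol (usubmx U : 'cV[C]_(\sum_(i < n.+1) q)) (inord j).
have -> : usubmx U = \mxcol_(j < n.+1) x j.
  by rewrite -[LHS]submxcolK; apply: eq_mxcol => j; rewrite /x inord_val.
by rewrite qform_potapov.
Qed.

(** The matrix is lower triangular with unit diagonal. Without invertibility [invmx] in [RTmx] would
    return its argument. *)
Lemma Tmx_unit n z : 1%:M - z *: Tmx R q n \in unitmx.
Proof.
have T0 (i j : 'I_(\sum_(k < n.+1) q)) : (i <= j)%N -> Tmx R q n i j = 0.
  rewrite leq_eqVlt => /orP[/eqP/val_inj ->|].
    by rewrite /Tmx mxE ltn_eqF// mxE.
  apply/is_trig_mxP/is_trig_mxblockP; split=> [a b ab|a].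
    by rewrite ltn_eqF// (ltn_trans ab).
  by rewrite ltn_eqF//; apply/is_trig_mxP => *; rewrite mxE.
have E (i j : 'I_(\sum_(k < n.+1) q)) : (i <= j)%N -> (1%:M - z *: Tmx R q n) i j = (i == j)%:R.
  by move=> ij; rewrite mxE [X in _ + X]mxE [X in - X]mxE T0// mulr0 subr0 mxE.
rewrite unitmxE det_trig; first by rewrite big1 ?unitr1// => i _; rewrite E// eqxx.
by apply/is_trig_mxP => i j ij; rewrite E ?(ltnW ij)// -val_eqE ltn_eqF.
Qed.

(** T moves block rows down by one, so (1 - z T) B = Y is the stated recursion. *)
Lemma RTmx_col n z (Y B : nat -> 'M[C]_q) : Y 0%N = B 0%N ->
  (forall j, Y j.+1 = B j.+1 - z *: B j) ->
  RTmx q n z *m (\mxcol_(j < n.+1) Y j) = \mxcol_(j < n.+1) B j.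
Proof.
move=> Y0 YS; rewrite -[RHS](mulKmx (Tmx_unit n z)); congr (_ *m _).
rewrite mulmxBl mul1mx -scalemxAl /Tmx mul_mxblock_mxrow.
have -> : z *: \mxcol_(i < n.+1) \sum_(j < n.+1) (if (i : nat) == j.+1 then 1%:M else 0) *m B j
   = \mxcol_(i < n.+1) (z *: \sum_(j < n.+1) (if (i : nat) == j.+1 then 1%:M else 0) *m B j).
  by apply/matrixP => i j; rewrite !mxE.
rewrite -mxcolB; apply: eq_mxcol => -[[|j] jn] /=.
  rewrite Y0 big1 ?scaler0 ?subr0// => k _; exact: mul0mx.
rewrite YS (bigD1 (Ordinal (ltnW jn)))//= eqxx mul1mx big1 ?addr0// => k.
by rewrite -val_eqE /= eqSS eq_sym => /negbTE ->; rewrite mul0mx.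
Qed.

Lemma Peven_potapov s (f : C -> 'M[C]_q) n z : Peven s f n z = potapov_mx n s (f z) z.
Proof.
have E : RTmx q n z *m (vmx R q n *m f z - umx s n) = \mxcol_(j < n.+1) mcol s (f z) z j.
  rewrite /vmx /umx mxcol_mul opprK -mxcolD.
  rewrite (@RTmx_col n z (fun j => (if j == 0%N then 1%:M else 0) *m f z + sm1 s j) (mcol s (f z) z))//.
    by rewrite /= mul1mx addr0.
  by move=> j /=; rewrite mul0mx add0r addrC addKr.
by rewrite /Peven /potapov_mx /= E.
Qed.

(** Adding s_0 leaves the lower right block unchanged exactly because s_0 is Hermitian. *)
Lemma Podd_potapov (alpha : R) s (f : C -> 'M[C]_q) n z : s 0%N = adjmx (s 0%N) ->
  Podd alpha s f n z =
  potapov_mx n (salpha alpha s) ((z - alpha%:C%C) *: f z + s 0%N) z.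
Proof.
move=> s0; set G := _ *: f z.
have E : RTmx q n z *m (vmx R q n *m G + alpha%:C%C *: umx s n + ymx s n) =
    \mxcol_(j < n.+1) mcol (salpha alpha s) (G + s 0%N) z j.
  rewrite /vmx /umx /ymx mxcol_mul scalerN.
  have -> : alpha%:C%C *: \mxcol_(j < n.+1) sm1 s j = \mxcol_(j < n.+1) (alpha%:C%C *: sm1 s j).
    by apply/matrixP => i j; rewrite !mxE.
  rewrite -mxcolB -mxcolD.
  rewrite (@RTmx_col n z (fun j => (if j == 0%N then 1%:M else 0) *m G - alpha%:C%C *: sm1 s j + s j)
     (mcol (salpha alpha s) (G + s 0%N) z))//.
    by rewrite /= mul1mx scaler0 subr0.
  by move=> j /=; rewrite mul0mx add0r [RHS]addrC addKr.
have A : G + s 0%N - adjmx (G + s 0%N) = G - adjmx G.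
  by rewrite adjmxD -s0 opprD addrACA subrr addr0.
by rewrite /Podd /potapov_mx /= -/G E A.
Qed.

End PotapovBlock.

(** * The Potapov form of a point mass *)

Section NecessaryCondition.
Variable R : realType.
Local Notation C := R[i].
Variable q : nat.
Implicit Types (N : 'M[C]_q) (u v w : 'cV[C]_q) (x : nat -> 'cV[C]_q) (z : C).

Lemma bformD u (M N : 'M[C]_q) v : bform u (M + N) v = bform u M v + bform u N v.
Proof. by rewrite /bform mulmxDr mulmxDl mxE. Qed.

Lemma bformZ u (a : C) (M : 'M[C]_q) v : bform u (a *: M) v = a * bform u M v.
Proof. by rewrite /bform -scalemxAr -scalemxAl mxE. Qed.

Lemma bformDr u M v w : bform u M (v + w) = bform u M v + bform u M w.
Proof. by rewrite /bform mulmxDr mxE. Qed.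

Lemma bformZr u M (a : C) v : bform u M (a *: v) = a * bform u M v.
Proof. by rewrite /bform -scalemxAr mxE. Qed.

Lemma bformDl u M v w : bform (u + v) M w = bform u M w + bform v M w.
Proof. by rewrite /bform adjmxD !mulmxDl mxE. Qed.

Lemma bformZl (a : C) u M v : bform (a *: u) M v = a^* * bform u M v.
Proof. by rewrite /bform adjmxZ -!scalemxAl mxE. Qed.

Lemma bform_sumr n u M (y : 'I_n -> 'cV[C]_q) :
  bform u M (\sum_j y j) = \sum_j bform u M (y j).
Proof. by rewrite /bform mulmx_sumr summxE. Qed.

Lemma bform_suml n M (y : 'I_n -> 'cV[C]_q) v :
  bform (\sum_j y j) M v = \sum_j bform (y j) M v.
Proof.
rewrite (big_morph (fun u => bform u M v) (id1 := 0) (op1 := +%R))//.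
  by move=> u u'; exact: bformDl.
by rewrite /bform /adjmx map_mx0 trmx0 !mul0mx mxE.
Qed.

(** By z / (t - z) + 1 = t / (t - z) each step of the recursion multiplies by t. *)
Lemma mcol_point (g t : R) N z j : t%:C%C - z != 0 ->
  mcol (fun j => (t ^+ j * g)%:C%C *: N) ((g%:C%C / (t%:C%C - z)) *: N) z j =
  ((t ^+ j * g)%:C%C / (t%:C%C - z)) *: N.
Proof.
move=> tz; elim: j => [|j IH] /=; first by rewrite expr0 mul1r.
rewrite IH scalerA -scalerDl; congr (_ *: _).
by rewrite exprS -mulrA [in RHS]rmorphM /=; move: (_%:C%C : C) => T; field.
Qed.

Lemma cauchy_ker_im_quotient z t : UHP z ->
  (z - z^*)^-1 * ((t%:C%C - z)^-1 - ((t%:C%C - z)^-1)^*) =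
  ((t%:C%C - z)^-1)^* * (t%:C%C - z)^-1.
Proof.
move=> zU; have tz := real_sub_neq t zU.
rewrite fmorphV /= rmorphB /= conj_real; have zz := UHP_conj_neq zU.
have tz' : t%:C%C - z^* != 0 by rewrite -conj_real -rmorphB /= conjC_eq0.
by field; rewrite zz tz tz'.
Qed.

(** The identity for the imaginary part of the Cauchy kernel turns the last block into |c|^2 g N,
    which completes the square. The factor g is 1 in the even and t - alpha in the odd case. *)
Lemma mform_point n (g t : R) N x w z : UHP z -> N = adjmx N ->
  mform n (fun j => (t ^+ j * g)%:C%C *: N) ((g%:C%C / (t%:C%C - z)) *: N) x w z =
  g%:C%C * qform N (\sum_(j < n.+1) (t ^+ j)%:C%C *: x j + (t%:C%C - z)^-1 *: w).
Proof.
move=> zU hN; have tz := real_sub_neq t zU.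
rewrite -[qform _ _]/(bform _ N _); set c := (t%:C%C - z)^-1.
set Y := \sum_(j < n.+1) (t ^+ j)%:C%C *: x j.
have herm u v : (bform u N v)^* = bform v N u by rewrite -bform_adj -hN.
have E1 : \sum_(j < n.+1) \sum_(k < n.+1)
    bform (x j) ((t ^+ (j + k) * g)%:C%C *: N) (x k) = g%:C%C * bform Y N Y.
  rewrite {1}/Y bform_suml mulr_sumr; apply: eq_bigr => j _.
  rewrite /Y bform_sumr mulr_sumr; apply: eq_bigr => k _.
  by rewrite bformZ bformZl bformZr conj_real exprD !rmorphM /=; ring.
have E2 : \sum_(j < n.+1) bform (x j) (((t ^+ j * g)%:C%C * c) *: N) w =
    g%:C%C * c * bform Y N w.
  rewrite /Y bform_suml mulr_sumr; apply: eq_bigr => j _.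
  by rewrite bformZ bformZl conj_real !rmorphM /=; ring.
rewrite /mform E1 big_split /= -rmorph_sum /=.
under eq_bigr do rewrite mcol_point//.
rewrite E2 !rmorphM /= conj_real herm bformZ bformDl !bformDr !bformZl !bformZr.
rewrite !rmorphM /= conj_real herm.
have cc : (z - z^*)^-1 * (c - c^*) = c^* * c := cauchy_ker_im_quotient t zU.
move: cc; clearbody c; move: (bform Y N Y) (bform Y N w) (bform w N Y) (bform w N w).
move: (g%:C%C : C) (c^*) ((z - z^*)^-1) => G d e b1 b2 b3 b4 cc.
transitivity (G * b1 + (G * c * b2 + G * d * b3) + G * b4 * (e * (c - d))); first by ring.
by rewrite cc; ring.
Qed.

(** The index 2 n occurs only in the corner j = k = n of the Hankel block and nowhere in the column,
    so the excess of the last moment adds one nonnegative term in x_n. *)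
Lemma mform_top n (s s' : nat -> 'M[C]_q) F x w z :
  (forall j, (j < 2 * n)%N -> s j = s' j) -> psdmx (s (2 * n)%N - s' (2 * n)%N) ->
  0 <= mform n s' F x w z -> 0 <= mform n s F x w z.
Proof.
move=> ss /psdmxP/(_ (x n)) h0 h.
have mE j : (j <= n)%N -> mcol s F z j = mcol s' F z j.
  elim: j => //= j IH jn; rewrite IH ?(ltnW jn)// ss//.
  by rewrite (leq_trans jn)// leq_pmull.
suff -> : mform n s F x w z = mform n s' F x w z + qform (s (2 * n)%N - s' (2 * n)%N) (x n).
  exact: addr_ge0.
rewrite /mform.
have -> : \sum_(j < n.+1) (bform (x j) (mcol s F z j) w + (bform (x j) (mcol s F z j) w)^*) =
    \sum_(j < n.+1) (bform (x j) (mcol s' F z j) w + (bform (x j) (mcol s' F z j) w)^*).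
  by apply: eq_bigr => j _; rewrite (mE j (ltn_ord j)).
suff -> : \sum_(j < n.+1) \sum_(k < n.+1) bform (x j) (s (j + k)%N) (x k) =
   \sum_(j < n.+1) \sum_(k < n.+1) bform (x j) (s' (j + k)%N) (x k) +
   qform (s (2 * n)%N - s' (2 * n)%N) (x n).
  by rewrite -!addrA; congr (_ + _); rewrite addrC !addrA.
have E (j k : 'I_n.+1) : bform (x j) (s (j + k)%N) (x k) = bform (x j) (s' (j + k)%N) (x k) +
    (if (j == ord_max) && (k == ord_max) then qform (s (2 * n)%N - s' (2 * n)%N) (x n) else 0).
  case: ifPn => [/andP[/eqP -> /eqP ->]|].
    by rewrite -[qform _ _]/(bform _ _ _) /= addnn -mul2n -bformD addrC subrK.
  move=> jk; rewrite addr0 ss//; have := ltn_ord j; have := ltn_ord k.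
  rewrite !ltnS mul2n -addnn => kn jn; rewrite ltn_neqAle leq_add// andbT.
  apply: contra jk => /eqP e; rewrite -!val_eqE /=; apply/andP; split.
    by rewrite eqn_leq jn -(leq_add2r k) e leq_add2l.
  by rewrite eqn_leq kn -(leq_add2l j) e leq_add2r.
under eq_bigr do under eq_bigr do rewrite E.
under eq_bigr do rewrite big_split /=.
rewrite big_split /=; congr (_ + _).
rewrite (bigD1 ord_max)//= [X in _ + X]big1 ?addr0.
  rewrite (bigD1 ord_max)//= eqxx [X in _ + X]big1 ?addr0// => k /negbTE ->.
  by rewrite andbF.
by move=> j /negbTE ->; rewrite big1.
Qed.

End NecessaryCondition.

(** * Potapov forms as real-linear functionals of the data *)

Section MatrixValuedFunctional.
Variable R : realType.
Local Notation C := R[i].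
Variables (q N : nat).
Implicit Types (D E : (nat -> 'M[C]_q) -> 'M[C]_q).

Definition mlin D := forall u v, rlin N (fun d => bform u (D d) v).

Lemma mlin_entry a : (a < N)%N -> mlin (fun d => d a).
Proof. by move=> aN u v; exact: rlin_form. Qed.

Lemma mlinD D E : mlin D -> mlin E -> mlin (fun d => D d + E d).
Proof.
by move=> hD hE u v; under eq_fun do rewrite bformD; apply: rlinD.
Qed.

Lemma mlinZ (c : C) D : mlin D -> mlin (fun d => c *: D d).
Proof. by move=> hD u v; under eq_fun do rewrite bformZ; apply: rlinZ. Qed.

Lemma rlin_mform n (Sd : nat -> (nat -> 'M[C]_q) -> 'M[C]_q) D x w z :
  (forall j, (j <= 2 * n)%N -> mlin (Sd j)) -> mlin D ->
  rlin N (fun d => mform n (fun j => Sd j d) (D d) x w z).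
Proof.
move=> hS hD.
have hm j : (j <= n)%N -> mlin (fun d => mcol (fun j => Sd j d) (D d) z j).
  elim: j => [//|j IH] jn /=; apply: mlinD; first exact: mlinZ (IH (ltnW jn)).
  by apply: hS; rewrite (leq_trans (ltnW jn))// leq_pmull.
apply: rlinD; [apply: rlinD|].
- apply: rlin_sum => j; apply: rlin_sum => k; apply: hS.
  by rewrite mul2n -addnn leq_add// -ltnS.
- apply: rlin_sum => j; have h := hm j (ltn_ord j) (x j) w.
  by apply: rlinD => //; exact: rlin_conj.
- by apply: rlinZ; apply: rlinD; [exact: hD|apply: rlinN; apply: rlin_conj; exact: hD].
Qed.

End MatrixValuedFunctional.

(** * Positivity for exact integrals *)

Section MomentsToPotapov.
Variable R : realType.
Local Notation C := R[i].
Variables (q : nat) (alpha : R) (sigma : set R -> 'M[C]_q) (z : C).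
Local Notation A := (halfline alpha).
Hypothesis sigma_psd : forall B, measurable B -> B `<=` A -> psdmx (sigma B).
Hypothesis zU : UHP z.

(* Index 0 carries the Cauchy kernel, index j.+1 the monomial of degree j. *)
Definition kernel_family (a : nat) (t : R) : C :=
  if a is j.+1 then (t ^+ j)%:C%C else (t%:C%C - z)^-1.

Variables (N : nat) (M : nat -> 'M[C]_q).
Hypothesis hM : forall a, (a < N)%N -> mx_integral A sigma (kernel_family a) (M a).

Lemma kernel_family_cont a :
  continuous (fun t => complex.Re (kernel_family a t)) /\
  continuous (fun t => complex.Im (kernel_family a t)).
Proof.
case: a => [|j] /=.
  split; [under eq_fun do rewrite -[(_ - _)^-1]/(cauchy_ker z _) cauchy_ker_Re|
          under eq_fun do rewrite -[(_ - _)^-1]/(cauchy_ker z _) cauchy_ker_Im] => t.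
    apply: cvgM; last exact: pker_continuous.
    by apply: cvgB; [exact: cvg_id|exact: cvg_cst].
  by apply: cvgM; [exact: cvg_cst|exact: pker_continuous].
split; first exact: exprn_continuous.
by move=> t; exact: cvg_cst.
Qed.

(** The order on complex numbers also demands a zero imaginary part; the real statement applied to i
    Phi and - i Phi provides it. *)
Lemma rlin_integral_cge0 Phi : rlin N Phi ->
  (forall t B, A t -> measurable B -> B `<=` A ->
    0 <= Phi (fun a => kernel_family a t *: sigma B)) -> 0 <= Phi M.
Proof.
move=> hPhi h0.
have K (c : C) : (forall t B, A t -> measurable B -> B `<=` A ->
    0 <= complex.Re (c * Phi (fun a => kernel_family a t *: sigma B))) ->
    0 <= complex.Re (c * Phi M).
  apply: (@rlin_integral_ge0 _ _ N alpha sigma kernel_family M _ _ hM (fun d => c * Phi d)).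
  - by move=> a; have [] := kernel_family_cont a.
  - by move=> a; have [] := kernel_family_cont a.
  - exact: rlinZ.
have P t B : A t -> measurable B -> B `<=` A ->
    complex.Im (Phi (fun a => kernel_family a t *: sigma B)) = 0 /\
    0 <= complex.Re (Phi (fun a => kernel_family a t *: sigma B)).
  by move=> At mB BA; have := h0 t B At mB BA; rewrite lecE => /andP[/eqP].
have k1 : 0 <= complex.Re (1 * Phi M).
  by apply: K => t B At mB BA; rewrite mul1r; have [] := P t B At mB BA.
have k2 : 0 <= complex.Re ('i%C * Phi M).
  by apply: K => t B At mB BA; rewrite cReM /=; have [-> _] := P t B At mB BA; lra.
have k3 : 0 <= complex.Re (- 'i%C * Phi M).
  by apply: K => t B At mB BA; rewrite cReM /=; have [-> _] := P t B At mB BA; lra.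
move: k1 k2 k3; rewrite mul1r mulNr cReN cReM /= => k1 k2 k3.
by rewrite lecE k1 andbT; apply/eqP => /=; lra.
Qed.

Lemma sigma_point_psd (g : R) B (X : 'cV[C]_q) : 0 <= g -> measurable B -> B `<=` A ->
  0 <= g%:C%C * qform (sigma B) X.
Proof.
move=> g0 mB BA; apply: mulr_ge0; first by rewrite (lecR 0).
by have /psdmxP := sigma_psd mB BA; apply.
Qed.

Lemma even_potapov_psd n : (2 * n + 2 <= N)%N ->
  forall x w, 0 <= mform n (fun j => M j.+1) (M 0%N) x w z.
Proof.
move=> nN x w; have N0 : (0 < N)%N by apply: leq_trans nN; rewrite addn2.
have hS j : (j <= 2 * n)%N -> mlin N (fun d : nat -> 'M[C]_q => d j.+1).
  by move=> jn; apply: mlin_entry; apply: leq_trans nN; rewrite addn2 !ltnS.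
apply: (rlin_integral_cge0 (rlin_mform x w z hS (mlin_entry N0))).
move=> t B At mB BA; have [hB _] := sigma_psd mB BA.
have E1 : (fun j => kernel_family j.+1 t *: sigma B) =
    (fun j => (t ^+ j * 1)%:C%C *: sigma B).
  by apply/funext => j; rewrite mulr1.
have E2 : kernel_family 0 t *: sigma B = ((1 : R)%:C%C / (t%:C%C - z)) *: sigma B.
  by rewrite mul1r.
by rewrite E1 E2 mform_point//; apply: sigma_point_psd.
Qed.

Lemma odd_potapov_psd n : (2 * n + 3 <= N)%N ->
  forall x w, 0 <= mform n (salpha alpha (fun j => M j.+1))
                      ((z - alpha%:C%C) *: M 0%N + M 1%N) x w z.
Proof.
move=> nN x w; have N0 : (1 < N)%N by apply: leq_trans nN; rewrite addn3.
have hS j : (j <= 2 * n)%N -> mlin N (fun d : nat -> 'M[C]_q => salpha alpha (fun j => d j.+1) j).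
  move=> jn; have jN : (j.+2 < N)%N by apply: leq_trans nN; rewrite addn3 !ltnS.
  rewrite /salpha; under eq_fun do rewrite -scaleNr.
  apply: mlinD; last exact: mlin_entry.
  by apply: mlinZ; apply: mlin_entry; exact: ltnW.
have hF : mlin N (fun d : nat -> 'M[C]_q => (z - alpha%:C%C) *: d 0%N + d 1%N).
  by apply: mlinD; [apply: mlinZ; apply: mlin_entry; exact: ltnW|exact: mlin_entry].
apply: (rlin_integral_cge0 (rlin_mform x w z hS hF)).
move=> t B At mB BA; have [hB _] := sigma_psd mB BA.
have tz := real_sub_neq t zU.
have E1 : salpha alpha (fun j => kernel_family j.+1 t *: sigma B) =
    (fun j => (t ^+ j * (t - alpha))%:C%C *: sigma B).
  apply/funext => j; rewrite /salpha /= scalerA -scaleNr -scalerDl; congr (_ *: _).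
  by rewrite exprS !rmorphM rmorphB /=; ring.
have E2 : (z - alpha%:C%C) *: (kernel_family 0 t *: sigma B) + kernel_family 1 t *: sigma B =
    ((t - alpha)%:C%C / (t%:C%C - z)) *: sigma B.
  rewrite /= scalerA -scalerDl; congr (_ *: _).
  by rewrite expr0 rmorphB rmorph1 /=; field.
rewrite -[mform _ _ _ _ _ _]/(mform n (salpha alpha (fun j => kernel_family j.+1 t *: sigma B))
  ((z - alpha%:C%C) *: (kernel_family 0 t *: sigma B) + kernel_family 1 t *: sigma B) x w z).
by rewrite E1 E2 mform_point//; apply: sigma_point_psd => //; rewrite subr_ge0.
Qed.

Lemma moment_psd_even j : (j.*2.+1 < N)%N -> psdmx (M j.*2.+1).
Proof.
move=> jN; apply/psdmxP => u; apply: (rlin_integral_cge0 (mlin_entry jN u u)).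
move=> t B At mB BA; rewrite bformZ; apply: sigma_point_psd => //.
by rewrite -muln2 exprM sqr_ge0.
Qed.

(** By (z - alpha) / (t - z) = (t - alpha) / (t - z) - 1 the subtracted 1 contributes a real
    multiple of the form and cancels, leaving (t - alpha) |t - z|^-2 times a nonnegative value. *)
Lemma shifted_transform_psd w : (0 < N)%N ->
  0 <= (z - z^*)^-1 * (bform w ((z - alpha%:C%C) *: M 0%N) w -
                       (bform w ((z - alpha%:C%C) *: M 0%N) w)^*).
Proof.
move=> N0; have hF : mlin N (fun d : nat -> 'M[C]_q => (z - alpha%:C%C) *: d 0%N).
  by apply: mlinZ; exact: mlin_entry.
have hPhi := rlinZ (z - z^*)^-1 (rlinD (hF w w) (rlinN (rlin_conj (hF w w)))).
apply: (rlin_integral_cge0 hPhi) => t B At mB BA; have [hB _] := sigma_psd mB BA.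
have tz := real_sub_neq t zU.
rewrite /= !bformZ; set b := bform w (sigma B) w; set c := (t%:C%C - z)^-1.
have bc : b^* = b by rewrite /b -bform_adj -hB.
have -> : (z - alpha%:C%C) * (c * b) = ((t - alpha)%:C%C * c - 1) * b.
  by rewrite /c rmorphB /=; field.
rewrite (_ : _ * _ = (t - alpha)%:C%C * qform (sigma B) (c *: w)); last first.
  rewrite -[qform _ _]/(bform _ _ _) bformZl bformZr -/b.
  rewrite !(rmorphM, rmorphB, rmorph1) /= !conj_real bc.
  have := cauchy_ker_im_quotient t zU; rewrite -/c; move: (c^*) => d E.
  transitivity ((t%:C%C - alpha%:C%C) * b * ((z - z^*)^-1 * (c - d))); first by ring.
  by rewrite E; ring.
by apply: sigma_point_psd => //; rewrite subr_ge0.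
Qed.

End MomentsToPotapov.

(** * From the moment class to Potapov matrices *)

Section Necessity.
Variable R : realType.
Local Notation C := R[i].
Variables (q : nat) (alpha : R) (s : nat -> 'M[C]_q) (m : nat) (S : C -> 'M[C]_q) (z : C).
Hypothesis hS : stieltjes_moment_class alpha s m S.
Hypothesis zU : UHP z.

Lemma psdmx0 : psdmx (0 : 'M[C]_q).
Proof. by apply/psdmxP => u; rewrite /qform mulmx0 mul0mx mxE. Qed.

Lemma moment_data : exists sigma M, [/\
  forall B, measurable B -> B `<=` halfline alpha -> psdmx (sigma B),
  forall a, (a < m.+2)%N -> mx_integral (halfline alpha) sigma (kernel_family z a) (M a),
  M 0%N = S z,
  forall j, (j < m)%N -> M j.+1 = s j &
  psdmx (s m - M m.+1)].
Proof.
have [_ [sigma [[[_ [sp _]] sS] [sj [Mm [hMm pMm]]]]]] := hS.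
(* Index m + 1 carries the true m-th integral [Mm], which may be smaller than s_m; all lower moments
   are the prescribed ones. *)
exists sigma, (fun a => if a is j.+1 then if (j < m)%N then s j else Mm else S z).
split; [exact: sp| |by []|by move=> j ->|by rewrite ltnn].
case=> [_|j]; first exact: sS (@UHP_off_halfline _ alpha _ zU).
rewrite !ltnS leq_eqVlt => /orP[/eqP ->|jm]; first by rewrite ltnn.
by rewrite jm; exact: sj.
Qed.

(** The inequality 2 n <= m covers both parts of the theorem: the excess sits in the corner if 2 n =
    m and is 0 if 2 n < m. *)
Lemma moment_class_even n : (2 * n <= m)%N -> psdmx (Peven s S n z).
Proof.
move=> nm; have [sigma [M [sp hM M0 Mj Mm]]] := moment_data.
rewrite Peven_potapov; apply/potapov_psdP => x w.
rewrite -M0; apply: (@mform_top _ _ _ _ (fun j => M j.+1)).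
- by move=> j jn; rewrite Mj// (leq_trans jn).
- move: nm; rewrite leq_eqVlt => /orP[/eqP -> //|nm].
  by rewrite (Mj _ nm) subrr; exact: psdmx0.
- by apply: (even_potapov_psd sp zU hM); rewrite addn2 !ltnS.
Qed.

Lemma moment_class_odd n : (2 * n < m)%N -> psdmx (Podd alpha s S n z).
Proof.
move=> nm; have [sigma [M [sp hM M0 Mj Mm]]] := moment_data.
have m0 : (0 < m)%N by apply: leq_ltn_trans nm.
have [s0 _] : psdmx (s 0%N).
  by rewrite -Mj//; apply: (moment_psd_even sp zU hM (j := 0)).
rewrite Podd_potapov//; apply/potapov_psdP => x w.
rewrite -M0 -(Mj 0%N)//; apply: (@mform_top _ _ _ _ (salpha alpha (fun j => M j.+1))).
- move=> j jn; have jm := ltn_trans jn nm.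
  by rewrite /salpha !Mj// (leq_trans _ nm).
- rewrite /salpha (Mj _ nm) opprD addrACA subrr add0r.
  move: nm; rewrite leq_eqVlt => /orP[/eqP e|nm]; first by rewrite e.
  by rewrite (Mj _ nm) subrr; exact: psdmx0.
- by apply: (odd_potapov_psd sp zU hM); rewrite addn3 !ltnS.
Qed.

Lemma moment_class_Pm1 : psdmx (Pm1 alpha S z).
Proof.
have [sigma [M [sp hM M0 Mj Mm]]] := moment_data.
apply/psdmxP => w; have := shifted_transform_psd sp zU hM w isT; rewrite M0.
by rewrite /Pm1 qformZ qformB qform_adj.
Qed.

End Necessity.

(** * From Potapov matrices to moments *)

Section Sufficiency.
Variable R : realType.
Local Notation C := R[i].
Variables (q : nat) (alpha : R) (s : nat -> 'M[C]_q) (m : nat) (S : C -> 'M[C]_q).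
Local Notation A := (halfline alpha).

Definition scalar_fun u z : C := qform (S z) u.
(** The real part makes the sequence real for every j; for Hermitian s_j it loses nothing. *)
Definition scalar_seq u j : R := complex.Re (qform (s j) u).

Lemma Im_form_E z u : qform ((2 * 'i)%C^-1 *: (S z - adjmx (S z))) u =
  (complex.Im (scalar_fun u z))%:C%C.
Proof.
rewrite qformZ qformB qform_adj -/(scalar_fun u z); move: (scalar_fun u z) => F.
have -> : F - F^* = (2 * 'i)%C * (complex.Im F)%:C%C.
  by apply: complex_eq; rewrite !(cReD, cImD, cReN, cImN, cReJ, cImJ, cReM, cImM) /=; ring.
rewrite mulKf// -nc_gt0 ncM nc_i mulr1 nc_gt0.
by rewrite pnatr_eq0.
Qed.

Lemma scalar_fun_cdiff u : holomorphic_on (fun z => ~ on_halfline alpha z) S ->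
  forall z, ~ on_halfline alpha z -> cdiff (scalar_fun u) z.
Proof.
move=> hS z nz; rewrite /scalar_fun; under eq_fun do rewrite qformE.
apply: cdiff_sum => i; apply: cdiff_sum => j.
by apply: cdiffM; [exact: cdiff_cst|apply/cdiffP; exact: hS].
Qed.

Lemma scalar_entry z i j : S z i j = \sum_(k < 4) (proot R k)^* * scalar_fun (pvec R i j k) z.
Proof. exact: polarization. Qed.

Hypothesis hol : holomorphic_on (fun z => ~ on_halfline alpha z) S.
Hypothesis herm : forall j, (j <= m)%N -> s j = adjmx (s j).
Hypothesis bound : forall u, stieltjes_bound alpha (scalar_seq u 0) (scalar_fun u).
Hypothesis moments : forall u (sg : {measure set R -> \bar R}), (sg A < +oo)%E ->
  (forall z, UHP z -> scalar_fun u z = stieltjes_transform alpha sg z) ->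
  [/\ forall j, (j <= m)%N -> sg.-integrable A (EFin \o (fun t => t ^+ j)),
      forall j, (j < m)%N -> \int[sg]_(t in A) (t ^+ j) = scalar_seq u j &
      \int[sg]_(t in A) (t ^+ m) <= scalar_seq u m].

Lemma scalar_seqE u j : (j <= m)%N -> qform (s j) u = (scalar_seq u j)%:C%C.
Proof.
move=> jm; apply: complex_eq => //=.
have : qform (s j) u = (qform (s j) u)^* by rewrite -qform_adj -herm.
by move/(congr1 (@complex.Im R)); rewrite cImJ; lra.
Qed.

Lemma proot_nc k : nc (proot R k) = 1.
Proof. by case: k => [[|[|[|[|k]]]]] // h; rewrite /proot /= ?ncN ?nc_i ?nc1. Qed.

(** Polarization writes an entry as four scalar functions with unimodular weights, each bounded by
    its mass over y on the imaginary axis. *)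
Lemma growth_bound : exists K : R, forall y : R, 1 <= y -> forall i j,
  `|S (Complex 0 y) i j| * y%:C%C <= K%:C%C.
Proof.
pose c i j := \sum_(k < 4) scalar_seq (pvec R i j k) 0.
have c0 i j : 0 <= c i j by apply: sumr_ge0 => k _; have [] := bound (pvec R i j k).
exists (\sum_i \sum_j c i j) => y y1 i j; have y0 : 0 < y by exact: lt_le_trans y1.
rewrite ncE -rmorphM /= lecR.
apply: (@le_trans _ _ (c i j)); last first.
  rewrite (bigD1 i)//= (bigD1 j)//= -addrA lerDl addr_ge0//; first exact: sumr_ge0.
  by apply: sumr_ge0 => a _; exact: sumr_ge0.
rewrite scalar_entry.
have nc_sum (r : seq 'I_4) (f : 'I_4 -> C) : nc (\sum_(k <- r) f k) <= \sum_(k <- r) nc (f k).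
  elim: r => [|k r IH]; first by rewrite !big_nil nc0.
  by rewrite !big_cons (le_trans (ncD _ _))// lerD2l.
apply: (@le_trans _ _ ((\sum_(k < 4) nc (scalar_fun (pvec R i j k) (Complex 0 y))) * y)).
  rewrite ler_wpM2r ?(ltW y0)// (le_trans (nc_sum _ _))//; apply: ler_sum => k _.
  by rewrite ncM nc_conj proot_nc mul1r.
rewrite mulr_suml; apply: ler_sum => k _.
exact: (@stieltjes_bound_nc _ _ _ _ (bound (pvec R i j k)) (Complex 0 y) y0).
Qed.

(** The even and the odd case share this assembly and differ in how [moments] is proved; that
    hypothesis speaks of every representing measure since the measures are chosen here. *)
Theorem sufficiency : stieltjes_moment_class alpha s m S.
Proof.
have mA := measurable_halfline alpha.
have /choice[sg hsg] u := stieltjes_representation (bound u).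
have sgfin u : (sg u A < +oo)%E.
  have [_ sT _ _] := hsg u; rewrite (le_lt_trans _ (ltry (scalar_seq u 0)))//.
  by rewrite (le_trans _ sT)// le_measure ?inE.
have sgT u z : ~ on_halfline alpha z -> scalar_fun u z = stieltjes_transform alpha (sg u) z.
  by have [_ _ _] := hsg u; apply.
have hmom u := moments (sgfin u) (fun z zU => sgT u z (@UHP_off_halfline _ alpha _ zU)).
have sform B : measurable B -> B `<=` A -> realform (fun u => fine (sg u B)).
  move=> mB _; apply: (@realform_measure _ _ sg scalar_fun (fun u => scalar_seq u 0)) => //.
  - by move=> u; exact: stieltjes_nevanlinna (bound u).
  - by move=> u; have [] := hsg u.
  - by move=> u; have [] := hsg u.
  - by move=> z zU; apply: (qform_realform (M := (2 * 'i)%C^-1 *: (S z - adjmx (S z)))) => u;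
      exact: Im_form_E.
have moment_int j : (j <= m)%N -> mx_integral A (form_measure sg) (fun t => (t ^+ j)%:C%C)
    (polmx (fun u => \int[sg u]_(t in A) t ^+ j)).
  move=> jm; have ic u : cintegrable (sg u) A (fun t => (t ^+ j)%:C%C).
    split => /=; first by have [+ _ _] := hmom u; apply.
    by rewrite (_ : (fun=> 0%:E) = cst 0%E)//; exact: integrable0.
  have := form_measure_integral sgfin ic; congr (mx_integral _ _ _ _).
  apply/matrixP => i k; rewrite !mxE; apply: eq_bigr => l _; congr (_ * _).
  by apply: complex_eq => //=; rewrite Rintegral_cst// mul0r.
split; last first.
  exists (form_measure sg); split; [split|split].
  - exact: form_measure_herm.
  - move=> z nz; have := form_measure_integral sgfin (fun u => cauchy_ker_integrable (sgfin u) nz).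
    congr (mx_integral _ _ _ _); apply/matrixP => i j; rewrite mxE scalar_entry.
    by apply: eq_bigr => k _; rewrite sgT.
  - move=> j jm; have := moment_int j (ltnW jm); congr (mx_integral _ _ _ _).
    apply: polmx_qform => u; rewrite scalar_seqE ?(ltnW jm)//.
    by have [_ /(_ j jm) -> _] := hmom u.
  - exists (polmx (fun u => \int[sg u]_(t in A) t ^+ m)); split; first exact: moment_int.
    apply/psdmxP => u; rewrite qformB scalar_seqE//.
    have /realform_polmx -> : realform (fun u => \int[sg u]_(t in A) t ^+ m).
      apply: realform_integral => //; first exact: exprn_continuous.
      by move=> v; have [+ _ _] := hmom v; apply.
    by rewrite -rmorphB /= (lecR 0) subr_ge0; have [] := hmom u.
split=> //; split; [|split].
- move=> z zU; apply/psdmxP => u; rewrite Im_form_E (lecR 0).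
  by have [_ _ _ + _] := bound u; apply.
- move=> x xa; apply/psdmxP => u.
  have nx : ~ on_halfline alpha x%:C%C by move=> [_] /=; rewrite leNgt xa.
  rewrite -/(scalar_fun u _) sgT// lecE /=; apply/andP; split.
    rewrite (eq_Rintegral _ (g := fun=> 0)); first by rewrite Rintegral_cst// mul0r.
    by move=> t _; rewrite subrr mul0r oppr0.
  apply: Rintegral_ge0 => t At; rewrite mulr_ge0//.
    by rewrite subr_ge0 (le_trans (ltW xa)).
  by rewrite invr_ge0 addr_ge0 ?sqr_ge0.
- exact: growth_bound.
Qed.

End Sufficiency.

(** * Compression of Potapov matrices to a vector *)

Section PotapovScalar.
Variable R : realType.
Local Notation C := R[i].
Variable q : nat.
Implicit Types (s : nat -> 'M[C]_q) (u : 'cV[C]_q) (z : C).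

(** The lower right block of P_(2n+1) is P_(-1), so every odd Potapov matrix carries the half-line
    condition. *)
Lemma psdmx_drblock m n (M1 : 'M[C]_m) M2 M3 (M4 : 'M[C]_n) :
  psdmx (block_mx M1 M2 M3 M4) -> psdmx M4.
Proof.
move=> [_ h]; apply/psdmxP => w; have := h (col_mx 0 w).
rewrite (_ : adjmx (col_mx 0 w) = row_mx 0 (adjmx w)); last first.
  by rewrite /adjmx map_col_mx tr_col_mx map_mx0 trmx0.
by rewrite mul_row_block mul_row_col !mul0mx !add0r mulmx0 add0r.
Qed.

Lemma potapov_mx_herm n s F z : psdmx (potapov_mx n s F z) ->
  forall j, (j <= 2 * n)%N -> s j = adjmx (s j).
Proof.
move=> [e _].
have H0 : Hmx s n = \mxblock_(j < n.+1, k < n.+1) adjmx (s (k + j)%N).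
  have := congr1 ulsubmx e; rewrite /potapov_mx block_mxKul => ->.
  rewrite (_ : \mxblock_(_, _) _ = adjmx (Hmx s n)); last first.
    rewrite /adjmx /Hmx -tr_mxblock; congr trmx.
    by apply/matrixP => a b; rewrite !mxE.
  rewrite -[in RHS](block_mxKul (Hmx s n) (\mxcol_(j < n.+1) mcol s F z j)
    (adjmx (\mxcol_(j < n.+1) mcol s F z j)) ((z - z^*)^-1 *: (F - adjmx F))).
  by apply/matrixP => a b; rewrite !mxE.
have H := (eq_mxblockP (fun j k : 'I_n.+1 => s (j + k)%N) _).2 H0.
(* Each j <= 2 n is a sum of two admissible block indices, min (j, n) and the truncated difference j
   - n. *)
move=> j jn; pose a := minn j n; pose b := (j - n)%N.
have an : (a < n.+1)%N by rewrite ltnS geq_minr.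
have bn : (b < n.+1)%N by rewrite ltnS leq_subLR addnn -mul2n.
have ab : (a + b = j)%N by rewrite /a /b minnE subnK// leq_subr.
by have := H (Ordinal an) (Ordinal bn); rewrite /= [(b + a)%N]addnC ab.
Qed.

Lemma potapov_form_scalar n s (G : C -> 'M[C]_q) u (c : nat -> C) (a z : C) :
  (forall j, (j <= 2 * n)%N -> s j = adjmx (s j)) ->
  psdmx (potapov_mx n s (G z) z) ->
  0 <= potapov_form n (scalar_fun G u) (scalar_seq s u) c a z.
Proof.
move=> herm /potapov_psdP/(_ (fun j => c j *: u) (a *: u)); congr (0 <= _).
have sE j : (j <= 2 * n)%N -> bform u (s j) u = (scalar_seq s u j)%:C%C.
  by move=> jn; apply: (scalar_seqE herm).
have mE j : (j <= n)%N -> bform u (mcol s (G z) z j) u =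
    potapov_col (scalar_fun G u) (scalar_seq s u) z j.
  elim: j => [//|j IH] jn /=; rewrite bformD bformZ IH ?(ltnW jn)// sE//.
  by rewrite (leq_trans (ltnW jn))// leq_pmull.
rewrite /mform /potapov_form; congr (_ + _ + _).
- apply: eq_bigr => j _; apply: eq_bigr => k _; rewrite bformZl bformZr sE ?mulrA//.
  by rewrite mul2n -addnn leq_add// -ltnS.
- apply: eq_bigr => j _; rewrite bformZl bformZr (mE j (ltn_ord j)).
  by rewrite !rmorphM /= conjCK; move: (potapov_col _ _ _ _) => B; ring.
- rewrite bformZl bformZr -[bform u _ u]/(scalar_fun G u z) !rmorphM /= conjCK.
  by move: (scalar_fun G u z) ((z - z^*)^-1) => B D; ring.
Qed.

End PotapovScalar.

(** * Removing the exceptional set *)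

Section DiscreteExtension.
Variable R : realType.
Local Notation C := R[i].
Variables (D : set C).
Hypothesis hD : discrete_set D.
Implicit Types (h F : C -> C) (z : C).

(** The absolute value keeps the path in the upper half-plane for all real t, so that ordinary
    two-sided limits at 0 can be used. *)
Definition vpath z (t : R) : C := z + Complex 0 `|t|.

Lemma vpath0 z : vpath z 0 = z.
Proof. by rewrite /vpath normr0; apply: complex_eq; rewrite ?cReD ?cImD /= addr0. Qed.

Lemma vpath_UHP z t : UHP z -> UHP (vpath z t).
Proof. by move=> zU; rewrite /UHP /vpath cImD /= ltr_wpDr. Qed.

Definition vcont h z :=
  (complex.Re (h (vpath z t)) @[t --> (0 : R)] --> complex.Re (h z)) /\
  (complex.Im (h (vpath z t)) @[t --> (0 : R)] --> complex.Im (h z)).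

Lemma vcont_cst (c : C) z : vcont (fun=> c) z.
Proof. by split; exact: cvg_cst. Qed.

Lemma vcontD h F z : vcont h z -> vcont F z -> vcont (fun w => h w + F w) z.
Proof.
move=> [h1 h2] [f1 f2]; split.
  by under eq_fun do rewrite cReD; rewrite cReD; exact: cvgD.
by under eq_fun do rewrite cImD; rewrite cImD; exact: cvgD.
Qed.

Lemma vcontM h F z : vcont h z -> vcont F z -> vcont (fun w => h w * F w) z.
Proof.
move=> [h1 h2] [f1 f2]; split.
  by under eq_fun do rewrite cReM; rewrite cReM; apply: cvgB; exact: cvgM.
by under eq_fun do rewrite cImM; rewrite cImM; apply: cvgD; exact: cvgM.
Qed.

Lemma vcontJ h z : vcont h z -> vcont (fun w => (h w)^*) z.
Proof.
move=> [h1 h2]; split; first by under eq_fun do rewrite cReJ; rewrite cReJ.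
by under eq_fun do rewrite cImJ; rewrite cImJ; exact: cvgN.
Qed.

Lemma vcont_sum (I : Type) (r : seq I) (h : I -> C -> C) z :
  (forall k, vcont (h k) z) -> vcont (fun w => \sum_(k <- r) h k w) z.
Proof.
move=> hk; elim: r => [|k r IH].
  by under eq_fun do rewrite big_nil; exact: vcont_cst.
by under eq_fun do rewrite big_cons; exact: vcontD.
Qed.

Lemma vcont_cdiff F z : UHP z -> (forall w, UHP w -> cdiff F w) -> vcont F z.
Proof.
move=> zU Fd; have [] := @path_continuous R F (vpath z).
- move=> t r; rewrite /vpath (_ : _ - _ = 'i%C * (`|t| - `|r|)%:C%C); last first.
    by apply: complex_eq; rewrite !(cReD, cImD, cReN, cImN, cReM, cImM) /=; ring.
  by rewrite ncM nc_i mul1r nc_real ler_dist_dist.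
- by move=> t; apply: cdiff_cont; apply: Fd; exact: vpath_UHP.
by move=> /(_ 0) + /(_ 0); rewrite /continuous_at vpath0 => h1 h2; split.
Qed.

Lemma vcont_im_quotient F z : UHP z -> vcont F z ->
  vcont (fun w => (complex.Im (F w) / complex.Im w)%:C%C) z.
Proof.
move=> zU [f1 f2]; split => /=; last exact: cvg_cst.
apply: cvgM => //; apply: cvgV; first by rewrite gt_eqF.
have [_] := @vcont_cdiff id z zU (fun w _ => cdiff_id w); exact.
Qed.

(** A point z of D is isolated in D, so the points just above it are outside D and the inequality
    passes to the limit down the vertical segment. *)
Lemma discrete_extension h z : UHP z -> vcont h z ->
  (forall w, UHP w -> ~ D w -> 0 <= h w) -> 0 <= h z.
Proof.
move=> zU [h1 h2] h0; have [Dz|nDz] := pselect (D z); last exact: h0.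
have [r [r0 hr]] := hD Dz.
have near0 : \forall t \near (0 : R)^'+, 0 <= h (vpath z t).
  near=> t; have t0 : 0 < t by near: t; exact: nbhs_right_gt.
  have tr : t < r by near: t; exact: nbhs_right_lt.
  apply: h0; first exact: vpath_UHP.
  move=> Dt; have E : vpath z t - z = 'i%C * t%:C%C.
    rewrite /vpath ger0_norm ?(ltW t0)// addrAC subrr add0r.
    by apply: complex_eq; rewrite ?cReM ?cImM /=; ring.
  have : vpath z t = z.
    apply: hr => //; rewrite E ncE ltcR ncM nc_i mul1r nc_real gtr0_norm//.
  move/eqP; rewrite -subr_eq0 E => /eqP/(congr1 (@nc R)).
  by rewrite nc0 ncM nc_i mul1r nc_real => /eqP; rewrite normr_eq0 gt_eqF.
have e1 := cvg_at_right_filter h1; have e2 := cvg_at_right_filter h2.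
rewrite lecE; apply/andP; split; last first.
  apply: (ler_cvg_to (cvg_cst 0) e1); apply: filterS near0 => t.
  by rewrite lecE => /andP[].
apply/eqP; apply: (@cvg_eq_near _ ((0 : R)^'+) _ _ _ _ _ e2); apply: filterS near0 => t.
by rewrite lecE => /andP[/eqP].
Unshelve. all: end_near. Qed.

(** If D covered the half-plane, the extension principle for the constant function -1 would hold
    vacuously and give 0 <= -1. *)
Lemma discrete_avoid : exists2 z, UHP z & ~ D z.
Proof.
have iU : UHP (Complex 0 1 : C) by exact: ltr01.
apply: contrapT => H.
have : (0 : C) <= - 1.
  apply: (@discrete_extension (fun=> - 1) _ iU (vcont_cst _ _)) => w wU nDw.
  by exfalso; apply: H; exists w.
by rewrite oppr_ge0 ler10.
Qed.

Lemma vcont_potapov_form n F (s : nat -> R) (x : nat -> C) (a z : C) : UHP z ->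
  (forall w, UHP w -> cdiff F w) -> vcont (potapov_form n F s x a) z.
Proof.
move=> zU Fd; have Fc := vcont_cdiff zU Fd.
have idc := vcont_cdiff zU (fun w _ => cdiff_id w).
have colc j : vcont (fun w => potapov_col F s w j) z.
  elim: j => //= j IH; apply: vcontD; last exact: vcont_cst.
  exact: vcontM.
pose h w := \sum_(j < n.+1) \sum_(k < n.+1) (x j)^* * x k * (s (j + k)%N)%:C%C +
  \sum_(j < n.+1) ((x j)^* * potapov_col F s w j * a + a^* * (potapov_col F s w j)^* * x j) +
  a^* * a * (complex.Im (F w) / complex.Im w)%:C%C.
have hE w : UHP w -> potapov_form n F s x a w = h w.
  by move=> wU; rewrite /potapov_form im_quotient.
have [h1 h2] : vcont h z.
  apply: vcontD; [apply: vcontD; first exact: vcont_cst|].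
    apply: vcont_sum => j; apply: vcontD.
      by apply: vcontM; [apply: vcontM; [exact: vcont_cst|]|exact: vcont_cst].
    apply: vcontM; last exact: vcont_cst.
    by apply: vcontM; [exact: vcont_cst|exact: vcontJ].
  by apply: vcontM; [exact: vcont_cst|exact: vcont_im_quotient].
split; rewrite hE//.
  rewrite (_ : (fun t => _) = (fun t => complex.Re (h (vpath z t))))//.
  by apply/funext => t; rewrite hE//; exact: vpath_UHP.
rewrite (_ : (fun t => _) = (fun t => complex.Im (h (vpath z t))))//.
by apply/funext => t; rewrite hE//; exact: vpath_UHP.
Qed.

Lemma potapov_psd_extension n F (s : nat -> R) : (forall w, UHP w -> cdiff F w) ->
  (forall z, UHP z -> ~ D z -> forall x a, 0 <= potapov_form n F s x a z) ->
  potapov_psd n F s.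
Proof.
move=> Fd h z zU x a; apply: (discrete_extension zU (vcont_potapov_form _ _ _ _ zU Fd)).
by move=> w wU nDw; exact: h.
Qed.

End DiscreteExtension.

(** * From Potapov matrices to the moment class *)

Section PotapovToMoments.
Variable R : realType.
Local Notation C := R[i].
Variables (q : nat) (alpha : R) (s : nat -> 'M[C]_q) (D : set C) (S : C -> 'M[C]_q).
Hypothesis hD : discrete_set D.
Hypothesis hol : holomorphic_on (fun z => ~ on_halfline alpha z) S.
Variable n : nat.
Hypothesis even_psd : forall z, UHP z -> ~ D z -> psdmx (Peven s S n z).
Hypothesis Pm1_psd : forall z, UHP z -> ~ D z -> psdmx (Pm1 alpha S z).
Local Notation A := (halfline alpha).

Let scalar_cdiff u z : UHP z -> cdiff (scalar_fun S u) z.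
Proof. by move=> zU; apply: (scalar_fun_cdiff u hol); exact: UHP_off_halfline. Qed.

(** Positivity at a single point outside D already forces the Hankel block to be Hermitian. *)
Lemma even_herm j : (j <= 2 * n)%N -> s j = adjmx (s j).
Proof.
have [z zU nDz] := discrete_avoid hD; have := even_psd zU nDz.
by rewrite Peven_potapov => /potapov_mx_herm; apply.
Qed.

Lemma scalar_potapov_psd u : potapov_psd n (scalar_fun S u) (scalar_seq s u).
Proof.
apply: (potapov_psd_extension hD) => [w wU|z zU nDz x a]; first exact: scalar_cdiff.
apply: (potapov_form_scalar _ _ _ even_herm).
by rewrite -Peven_potapov; exact: even_psd.
Qed.

Lemma scalar_stieltjes_bound u :
  stieltjes_bound alpha (scalar_seq s u 0) (scalar_fun S u).
Proof.
have b z (zU : UHP z) := potapov_bound (scalar_potapov_psd u) zU.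
have iU : UHP (Complex 0 1 : C) by exact: ltr01.
split.
- by have [] := b _ iU.
- exact: scalar_fun_cdiff.
- by move=> z /b[].
- by move=> z /b[].
move=> z zU; pose G z := (z - alpha%:C%C) * scalar_fun S u z.
have Gd w : UHP w -> cdiff G w.
  move=> wU; apply: cdiffM; last exact: scalar_cdiff.
  by apply: cdiffB; [exact: cdiff_id|exact: cdiff_cst].
pose Q w : C := (complex.Im (G w) / complex.Im w)%:C%C.
have : 0 <= Q z.
  apply: (@discrete_extension _ D hD Q z zU).
    by apply: vcont_im_quotient => //; exact: vcont_cdiff.
  move=> w wU nDw; have /psdmxP/(_ u) := Pm1_psd wU nDw.
  rewrite /Pm1 qformZ qformB qform_adj qformZ -/(scalar_fun S u w) -/(G w).
  by rewrite mulrC im_quotient.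
by rewrite /Q (lecR 0) pmulr_lge0 ?invr_gt0.
Qed.

Lemma even_sufficiency : stieltjes_moment_class alpha s (2 * n) S.
Proof.
apply: sufficiency => //; [exact: even_herm|exact: scalar_stieltjes_bound|].
move=> u sg sgfin sgT.
have [|z zU|] := potapov_moments (integrable_one sgfin) _ _ (scalar_potapov_psd u).
- by [].
- by rewrite sgT//; apply: eq_cint => t _; rewrite mul1r.
move=> h1 h2 h3; split.
- by move=> j /h1; under eq_fun do rewrite mulr1.
- by move=> j /h2; under eq_Rintegral do rewrite mulr1.
- by move: h3; under eq_Rintegral do rewrite mulr1.
Qed.

Hypothesis odd_psd : forall z, UHP z -> ~ D z -> psdmx (Podd alpha s S n z).

Lemma salpha_herm j : (j <= 2 * n)%N -> salpha alpha s j = adjmx (salpha alpha s j).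
Proof.
have [z zU nDz] := discrete_avoid hD; have := odd_psd zU nDz.
by rewrite (Podd_potapov _ _ _ _ (even_herm (leq0n _))) => /potapov_mx_herm; apply.
Qed.

Lemma odd_herm j : (j <= (2 * n).+1)%N -> s j = adjmx (s j).
Proof.
case: j => [_|j]; first exact: even_herm.
rewrite ltnS => jn; have := salpha_herm jn.
rewrite /salpha adjmxD -scaleNr adjmxZ -even_herm// rmorphN /= conj_real.
by move/addrI.
Qed.

Lemma odd_sufficiency : stieltjes_moment_class alpha s (2 * n).+1 S.
Proof.
apply: sufficiency => //; [exact: odd_herm|exact: scalar_stieltjes_bound|].
move=> u sg sgfin sgT; apply: (potapov_moments_odd sgfin sgT).
pose G z := (z - alpha%:C%C) *: S z + s 0%N.
have GE z : scalar_fun G u z = (z - alpha%:C%C) * scalar_fun S u z + (scalar_seq s u 0)%:C%C.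
  by rewrite /scalar_fun qformD qformZ (scalar_seqE even_herm).
have sE j : scalar_seq (salpha alpha s) u j = scalar_seq s u j.+1 - alpha * scalar_seq s u j.
  rewrite /scalar_seq /salpha qformD -scaleNr qformZ cReD cReM cReN cImN /=.
  by rewrite oppr0 mul0r subr0 mulNr addrC.
have : potapov_psd n (scalar_fun G u) (scalar_seq (salpha alpha s) u).
  apply: (potapov_psd_extension hD) => [w wU|z zU nDz x a].
    rewrite (funext GE); apply: cdiffD; last exact: cdiff_cst.
    apply: cdiffM; last exact: scalar_cdiff.
    by apply: cdiffB; [exact: cdiff_id|exact: cdiff_cst].
  apply: (potapov_form_scalar _ _ _ salpha_herm).
  by have := odd_psd zU nDz; rewrite (Podd_potapov _ _ _ _ (even_herm (leq0n _))).
by rewrite (funext GE) (funext sE).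
Qed.

End PotapovToMoments.

Lemma Ppsd_even (R : realType) (q : nat) (alpha : R) (s : nat -> 'M[R[i]]_q)
  (S : R[i] -> 'M[R[i]]_q) (n : nat) z :
  Ppsd alpha s S (2 * n)%:Z z = psdmx (Peven s S n z).
Proof. by rewrite /Ppsd mul2n odd_double doubleK. Qed.

Lemma Ppsd_odd (R : realType) (q : nat) (alpha : R) (s : nat -> 'M[R[i]]_q)
  (S : R[i] -> 'M[R[i]]_q) (n : nat) z :
  Ppsd alpha s S (2 * n).+1%:Z z = psdmx (Podd alpha s S n z).
Proof. by rewrite /Ppsd /= mul2n odd_double /= uphalf_double. Qed.

Theorem theorem6p18 (R : realType) (q : nat) (alpha : R) (kappa : option nat)
  (s : nat -> 'M[R[i]]_q) (D : set R[i]) (S : R[i] -> 'M[R[i]]_q) :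
  (0 < q)%N ->
  D `<=` (@UHP R) -> discrete_set D ->
  holomorphic_on (fun z => ~ on_halfline alpha z) S ->
  (forall n : nat, le_kappa (2 * n) kappa ->
     (stieltjes_moment_class alpha s (2 * n) S <->
      forall z, UHP z -> ~ D z ->
        Ppsd alpha s S ((2 * n)%:Z - 1) z /\ Ppsd alpha s S (2 * n)%:Z z)) /\
  (forall n : nat, le_kappa (2 * n).+1 kappa ->
     (stieltjes_moment_class alpha s (2 * n).+1 S <->
      forall z, UHP z -> ~ D z ->
        Ppsd alpha s S (2 * n)%:Z z /\ Ppsd alpha s S (2 * n).+1%:Z z)).

Proof.
move=> _ _ hD hol; split=> n _; split.
- move=> hS z zU _; rewrite Ppsd_even; split; last exact: (moment_class_even hS zU).
  (* For n = 0 the index 2 n - 1 is -1 and selects [Pm1]; otherwise it is the odd index 2 (n - 1) +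
     1. *)
  case: n hS => [|n] hS; first by rewrite muln0; exact: moment_class_Pm1 hS zU.
  rewrite mulnS (_ : _ - _ = (2 * n).+1%:Z) ?Ppsd_odd//.
  by apply: (moment_class_odd hS zU); rewrite mulnS addnC addn2 ltnS leqnSn.
- move=> hP; apply: (even_sufficiency hD hol) => z zU nDz.
    by have [_] := hP z zU nDz; rewrite Ppsd_even.
  have [+ _] := hP z zU nDz; case: n hP => [|n] hP; first by rewrite muln0.
  rewrite mulnS (_ : _ - _ = (2 * n).+1%:Z) ?Ppsd_odd//.
  exact: psdmx_drblock.
- move=> hS z zU _; rewrite Ppsd_even Ppsd_odd; split.
    exact: (moment_class_even hS zU).
  exact: (moment_class_odd hS zU).
- move=> hP.
  have he z : UHP z -> ~ D z -> psdmx (Peven s S n z).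
    by move=> zU nDz; have [+ _] := hP z zU nDz; rewrite Ppsd_even.
  have ho z : UHP z -> ~ D z -> psdmx (Podd alpha s S n z).
    by move=> zU nDz; have [_] := hP z zU nDz; rewrite Ppsd_odd.
  apply: (odd_sufficiency hD hol he _ ho) => z zU nDz.
  exact: psdmx_drblock (ho z zU nDz).
Qed.
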